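(* Let $n_0$ be a nonnegative bounded measurable function on $(0,\infty)$ which is not identically $0$ and satisfies $\lim_{x\to\infty} x^2 n_0(x) = 0$, and let $n$ be the unique global solution of the Kompaneets problem with initial data $n_0$. Then \[ \lim_{t\to\infty} \|n_t - \hat n_\mu\|_{L^1(0,\infty)} = 0, \] where $\mu\in[0,\infty)$ is the unique number for which \[ N(\hat n_\mu) = N(n_0) - \int_0^\infty n_t(0)^2\,dt. \]
   Context: The Kompaneets problem: for $x>0$, $t>0$, $\partial_t n = \partial_x J$ with flux $J = J(x,n) = x^2\partial_x n + (x^2-2x)n + n^2$, together with the no-flux condition $\lim_{x\to\infty} J(x,n_t)=0$; no boundary condition is imposed at $x=0$. We write $n_t(x)=n(x,t)$. For bounded measurable $n_0\ge 0$ with $x^2n_0(x)\to0$ as $x\to\infty$, it is known that there is a unique nonnegative solution $n \in C([0,\infty);L^1)\cap L^\infty_{loc}([0,\infty);L^\infty(0,\infty))\cap C^{2,1}((0,\infty)^2)$ with initial data $n_0$ (called the global solution). For $t>0$, $n_t(0)$ denotes $\lim_{x\to0^+} n_t(x)$, which exists. $N(n)=\int_0^\infty n(x)\,dx$ is the total photon number, and $\hat n_\mu(x) = \frac{x^2}{e^{x+\mu}-1}$ for $\mu\ge 0$ are the Bose--Einstein equilibria. *)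

(* Defs.v *)
From HB Require Import structures.
From mathcomp Require Import all_boot all_order all_algebra.
From mathcomp Require Import all_classical all_reals all_analysis.
Set Implicit Arguments. Unset Strict Implicit. Unset Printing Implicit Defensive.
Import Order.TTheory GRing.Theory Num.Theory.
Import numFieldNormedType.Exports.
Local Open Scope classical_set_scope.
Local Open Scope ring_scope.

Section Kompaneets.
Variable R : realType.

Definition halfline : set R := `]0%R, +oo[%classic.

(* A density n : R -> R -> R is read as n x t = n_t(x). *)

Definition dx (n : R -> R -> R) (x t : R) : R := derive1 (fun y => n y t) x.
Definition dxx (n : R -> R -> R) (x t : R) : R := derive1 (fun y => dx n y t) x.
Definition dt (n : R -> R -> R) (x t : R) : R := derive1 (fun s => n x s) t.

Definition flux (n : R -> R -> R) (x t : R) : R :=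
  x ^+ 2 * dx n x t + (x ^+ 2 - 2 * x) * n x t + (n x t) ^+ 2.

Definition photon_number (f : R -> R) : \bar R :=
  (\int[@lebesgue_measure R]_(x in halfline) (f x)%:E)%E.

Definition L1dist (f g : R -> R) : \bar R :=
  (\int[@lebesgue_measure R]_(x in halfline) (`|f x - g x|)%:E)%E.

Definition BE (mu x : R) : R := x ^+ 2 / (expR (x + mu) - 1).

Definition trace0 (n : R -> R -> R) (t : R) : R :=
  lim ((fun x => n x t) @ 0^'+).

Definition C21_quadrant (n : R -> R -> R) : Prop :=
  forall x t, 0 < x -> 0 < t ->
  (derivable (fun y => n y t) x 1 /\
   derivable (fun y => dx n y t) x 1 /\
   derivable (fun s => n x s) t 1) /\
  ({for (x, t), continuous (fun p : R * R => n p.1 p.2)} /\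
   {for (x, t), continuous (fun p : R * R => dx n p.1 p.2)} /\
   {for (x, t), continuous (fun p : R * R => dxx n p.1 p.2)} /\
   {for (x, t), continuous (fun p : R * R => dt n p.1 p.2)}).

Definition kompaneets_solution (n0 : R -> R) (n : R -> R -> R) : Prop :=
  (forall x, 0 < x -> n x 0 = n0 x) /\
  (forall x t, 0 < x -> 0 <= t -> 0 <= n x t) /\
  (forall t, 0 <= t ->
     (@lebesgue_measure R).-integrable halfline (fun x => (n x t)%:E)) /\
  (forall s, 0 <= s ->
     (L1dist (fun x => n x t) (fun x => n x s))
       @[t --> within [set t | 0 <= t] (nbhs s)] --> 0%E) /\
  (forall T, 0 <= T -> exists M : R,
     forall x t, 0 < x -> 0 <= t <= T -> `|n x t| <= M) /\
  C21_quadrant n /\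
  (forall x t, 0 < x -> 0 < t ->
     dt n x t = derive1 (fun y => flux n y t) x) /\
  (forall t, 0 < t -> flux n x t @[x --> +oo] --> 0).

End Kompaneets.

(* Main.v *)
(* Tested against cutoffs, the equation shows that the mass which has entered
   from infinity is a nondecreasing function of time; since [x^2 n_t -> 0] at each
   fixed time, its derivative vanishes, so the mass changes only through the
   outflow [n_t(0)^2] at [x = 0]. A doubling of variables bounds [d n_t / d x] from
   below, which makes the trace [n_t(0)] exist. The integral of the positive part
   of [BE mu - n_t] is nonincreasing, which keeps the mass away from zero. An
   entropy whose dissipation is the integral of [e^x J^2 / Q^2], with
   [Q = x^2 + n + n e^x], gives times tending to infinity along which the
   dissipation tends to zero and the densities are tight. There the function
   [w = e^x n / Q] of the fugacity, with [w_x = e^x J / Q^2], becomes constant in [x],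
   so that the densities converge to an equilibrium together with their masses.
   Monotonicity of the mass and of the integral of the positive part extends the
   convergence to all times. *)
Require Import Defs.
From HB Require Import structures.
From mathcomp Require Import all_boot all_order all_algebra.
From mathcomp Require Import all_classical all_reals all_analysis.
From mathcomp Require Import measurable_realfun.
From mathcomp Require Import ring lra.
Import Order.TTheory GRing.Theory Num.Theory.
Import numFieldNormedType.Exports.
Local Open Scope classical_set_scope.
Local Open Scope ring_scope.
Set Implicit Arguments.
Unset Strict Implicit.
Unset Printing Implicit Defensive.

(** No derivative is assumed bounded or integrable near [x = 0] or infinity, and the sup bound is
    local in time. Every identity is therefore first proved with the cutoff [psi k] on [[1 / k, k]],
    where differentiating under the integral and integrating by parts are legitimate, and the errors
    are charged to one quantity, [eps n k t], which tends to 0 uniformly on bounded time intervals.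
    The one boundary term that this does not control is the inflow [Fk], whose density grows like
    [x^2 n]; [no_influx] produces [r], of size [eps] and with derivative [Fk] up to [eps], and
    subtracting multiples of [r] removes the inflow from the mass and entropy balances. In the
    estimates that decide the behaviour at large times, constants depending on the local sup bound
    are multiplied by a parameter sent to 0, so no bound uniform in time is needed. The classical
    entropy has [n]-derivative [ln z], unbounded as [n] tends to 0; [Phi] uses the bounded function
    [z / (1 + z)] of the same fugacity, which puts it between 0 and [n], so that its cutoff errors
    are again multiples of [eps]. *)

Section Calculus.
Variable R : realType.
Implicit Types (f g : R -> R) (x t a b c : R).

(* [is_derive] is a class; behind this constant, instance resolution does not
   preempt the syntax-directed rules below. *)
Definition D1 f x a : Prop := is_derive x (1 : R) f a.

Lemma deq f x a b : D1 f x a -> a = b -> D1 f x b.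
Proof. by move=> h <-. Qed.

Lemma dcst c x : D1 (fun _ : R => c) x 0.
Proof. exact: is_derive_cst. Qed.

Lemma did x : D1 (fun y : R => y) x 1.
Proof. exact: is_derive_id. Qed.

Lemma dadd f g x a b : D1 f x a -> D1 g x b ->
  D1 (fun y => f y + g y) x (a + b).
Proof. by move=> fa gb; exact: is_deriveD. Qed.

Lemma dopp f x a : D1 f x a -> D1 (fun y => - f y) x (- a).
Proof. by move=> fa; exact: is_deriveN. Qed.

Lemma dmul f g x a b : D1 f x a -> D1 g x b ->
  D1 (fun y => f y * g y) x (f x * b + g x * a).
Proof. by move=> fa gb; exact: is_deriveM. Qed.

Lemma dpow f n x a : D1 f x a ->
  D1 (fun y => f y ^+ n) x (n%:R * f x ^+ n.-1 * a).
Proof.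
move=> fa; elim: n => [|n ih].
  by rewrite !mul0r; exact: dcst.
under eq_fun do rewrite exprS.
apply: (is_derive_eq (dmul fa ih)); rewrite /=.
case: n {ih} => [|n]; first by rewrite expr0 /=; ring.
by rewrite /= exprS -[n.+2]add1n natrD; ring.
Qed.

Lemma dinv f x a : f x != 0 -> D1 f x a ->
  D1 (fun y => (f y)^-1) x (- ((f x) ^+ 2)^-1 * a).
Proof.
move=> fx fa; apply: (is_derive_eq (is_deriveV fx fa)).
by [].
Qed.

Lemma dexp f x a : D1 f x a ->
  D1 (fun y => expR (f y)) x (expR (f x) * a).
Proof. by move=> fa; exact: is_derive1_comp. Qed.

Lemma dln f x a : 0 < f x -> D1 f x a ->
  D1 (fun y => ln (f y)) x ((f x)^-1 * a).
Proof.
move=> f0 fa; apply: (is_derive1_comp _ fa); exact: is_derive1_ln.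
Qed.

Lemma dsqrt f x a : 0 < f x -> D1 f x a ->
  D1 (fun y => Num.sqrt (f y)) x ((2 * Num.sqrt (f x))^-1 * a).
Proof.
move=> f0 fa; apply: (is_derive1_comp _ fa); exact: is_derive1_sqrt.
Qed.

Lemma dcont f x a : D1 f x a -> {for x, continuous f}.
Proof.
move=> [fa _]; apply: differentiable_continuous.
exact/derivable1_diffP.
Qed.

Lemma derive1_is_derive f x a : D1 f x a -> derive1 f x = a.
Proof. by move=> fa; rewrite derive1E; exact: derive_val. Qed.

Definition cpos f := forall x, 0 < x -> {for x, continuous f}.

Lemma cpos_cst c : cpos (fun _ => c).
Proof. by move=> x _; exact: cvg_cst. Qed.
Lemma cpos_id : cpos (fun x => x).
Proof. by move=> x _; exact: cvg_id. Qed.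
Lemma cposD f g : cpos f -> cpos g -> cpos (fun x => f x + g x).
Proof. by move=> cf cg x x0; apply: cvgD; [exact: cf|exact: cg]. Qed.
Lemma cposN f : cpos f -> cpos (fun x => - f x).
Proof. by move=> cf x x0; apply: cvgN; exact: cf. Qed.
Lemma cposM f g : cpos f -> cpos g -> cpos (fun x => f x * g x).
Proof. by move=> cf cg x x0; apply: cvgM; [exact: cf|exact: cg]. Qed.
Lemma cposX f n : cpos f -> cpos (fun x => f x ^+ n).
Proof.
move=> cf x x0; apply: (@continuous_comp _ _ _ f (fun y => y ^+ n)); first exact: cf.
exact: exprn_continuous.
Qed.
Lemma cposV f : (forall x, 0 < x -> f x != 0) -> cpos f -> cpos (fun x => (f x)^-1).
Proof. by move=> f0 cf x x0; apply: cvgV; [exact: f0|exact: cf]. Qed.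
Lemma cposexp f : cpos f -> cpos (fun x => expR (f x)).
Proof.
move=> cf x x0; apply: (@continuous_comp _ _ _ f expR); first exact: cf.
exact: continuous_expR.
Qed.
Lemma cposln f : (forall x, 0 < x -> 0 < f x) -> cpos f -> cpos (fun x => ln (f x)).
Proof.
move=> f0 cf x x0; apply: (@continuous_comp _ _ _ f (@ln R)); first exact: cf.
by apply: continuous_ln; exact: f0.
Qed.
Lemma cpossqrt f : cpos f -> cpos (fun x => Num.sqrt (f x)).
Proof.
move=> cf x x0; apply: (@continuous_comp _ _ _ f (@Num.sqrt R)); first exact: cf.
exact: sqrt_continuous.
Qed.
Lemma cposabs f : cpos f -> cpos (fun x => `|f x|).
Proof. by move=> cf x x0; apply: cvg_norm; exact: cf. Qed.
Lemma cpos_derive f (df : R -> R) :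
  (forall x, 0 < x -> D1 f x (df x)) -> cpos f.
Proof. by move=> h x x0; apply: dcont (h x x0). Qed.

Lemma cpos_within f a b : 0 < a -> cpos f -> {within `[a, b], continuous f}.
Proof.
move=> a0 cf; apply: continuous_in_subspaceT => x /set_mem /=.
rewrite in_itv /= => /andP[ax _]; apply: cf; exact: lt_le_trans ax.
Qed.

Lemma within_cc f a b : (forall x, a <= x <= b -> {for x, continuous f}) ->
  {within `[a, b], continuous f}.
Proof.
move=> cf; apply: continuous_in_subspaceT => x /set_mem /=.
by rewrite in_itv /= => /cf.
Qed.

Local Notation mu := (@lebesgue_measure R).

Local Notation mR := (@measurable _ (measurableTypeR R)).

Definition ID (D : set R) f : R := (\int[mu]_(x in D) f x)%R.
Definition itg (D : set R) f := mu.-integrable D (EFin \o f).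

Lemma itg_cc f a b : {within `[a, b], continuous f} -> itg `[a, b] f.
Proof. by move=> cf; apply: continuous_compact_integrable => //; exact: segment_compact. Qed.

Lemma itg_cpos f a b : 0 < a -> cpos f -> itg `[a, b] f.
Proof. by move=> a0 cf; apply: itg_cc; exact: cpos_within. Qed.

Lemma IDD (D : set R) f g : mR D -> itg D f -> itg D g ->
  ID D (fun x => f x + g x) = ID D f + ID D g.
Proof. by move=> mD itf itg_; exact: RintegralD. Qed.
Lemma IDB (D : set R) f g : mR D -> itg D f -> itg D g ->
  ID D (fun x => f x - g x) = ID D f - ID D g.
Proof. by move=> mD itf itg_; exact: RintegralB. Qed.
Lemma IDZ (D : set R) f c : mR D -> itg D f ->
  ID D (fun x => c * f x) = c * ID D f.
Proof. by move=> mD itf; exact: RintegralZl. Qed.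
Lemma IDle (D : set R) f g : mR D -> itg D f -> itg D g ->
  (forall x, D x -> f x <= g x) -> ID D f <= ID D g.
Proof. by move=> mD itf itg_ fg; exact: le_Rintegral. Qed.
Lemma ID_ge0 (D : set R) f : (forall x, D x -> 0 <= f x) -> 0 <= ID D f.
Proof. by move=> h; exact: Rintegral_ge0. Qed.
Lemma IDeq (D : set R) f g : (forall x, D x -> f x = g x) -> ID D f = ID D g.
Proof. by move=> h; apply: eq_Rintegral => x /set_mem; exact: h. Qed.
Lemma IDEFin (D : set R) f : mR D -> itg D f ->
  (\int[mu]_(x in D) (f x)%:E)%E = (ID D f)%:E.
Proof.
by move=> mD itf; rewrite /ID /Rintegral fineK//; exact: integrable_fin_num.
Qed.

Lemma itg_le (D : set R) f g : mR D -> measurable_fun D f -> itg D g ->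
  (forall x, D x -> `|f x| <= g x) -> itg D f.
Proof.
rewrite /itg => mD mf itg_ h; apply: le_integrable itg_ => //.
  exact/measurable_EFinP.
move=> x Dx /=; rewrite lee_fin; apply: (le_trans (h _ Dx)); exact: ler_norm.
Qed.

Lemma itgD (D : set R) f g : mR D -> itg D f -> itg D g ->
  itg D (fun x => f x + g x).
Proof.
by move=> mD itf itg_; exact: (integrableD mD itf itg_).
Qed.
Lemma itgB (D : set R) f g : mR D -> itg D f -> itg D g ->
  itg D (fun x => f x - g x).
Proof.
by move=> mD itf itg_; exact: (integrableB mD itf itg_).
Qed.
Lemma itgZ (D : set R) f c : mR D -> itg D f ->
  itg D (fun x => c * f x).
Proof.
by move=> mD itf; exact: (integrableZl mD c itf).
Qed.
Lemma itg_abs (D : set R) f : mR D -> itg D f -> itg D (fun x => `|f x|).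
Proof. by move=> mD itf; exact: (integrable_norm itf). Qed.
Lemma itgS (D E : set R) f : mR D -> mR E -> E `<=` D -> itg D f -> itg E f.
Proof. by move=> mD mE ED; exact: integrableS. Qed.
Lemma itg_mfun (D : set R) f : itg D f -> measurable_fun D f.
Proof. by move=> /integrableP[/measurable_EFinP]. Qed.

Lemma IDabs_le (D : set R) f g : mR D -> itg D f -> itg D g ->
  (forall x, D x -> `|f x| <= g x) -> `|ID D f| <= ID D g.
Proof.
move=> mD itf itg_ h; apply: le_trans (le_normr_Rintegral mD itf) _.
by apply: IDle => //; exact: itg_abs.
Qed.

Lemma ID_subset (D E : set R) f : mR D -> mR E -> E `<=` D ->
  itg D f -> (forall x, D x -> 0 <= f x) -> ID E f <= ID D f.
Proof.
move=> mD mE ED itf f0.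
have itE := itgS mD mE ED itf.
rewrite -lee_fin -!IDEFin//; apply: ge0_subset_integral => //.
by apply/measurable_EFinP; exact: itg_mfun.
Qed.

Lemma FTC f F a b : 0 < a -> a <= b -> (forall x, 0 < x -> D1 F x (f x)) ->
  cpos f -> ID `[a, b] f = F b - F a.
Proof.
move=> a0; rewrite le_eqVlt => /predU1P[<- _ _|ab dF cf].
  by rewrite subrr /ID set_itv1 Rintegral_set1.
rewrite /ID /Rintegral (@continuous_FTC2 _ f F) //.
- exact: cpos_within.
- split.
  + move=> x; rewrite in_itv/= => /andP[ax _].
    by have [] := dF x (lt_trans a0 ax).
  + by apply: cvg_at_right_filter; apply: dcont; exact: dF.
  + by apply: cvg_at_left_filter; apply: dcont; apply: dF; exact: lt_trans ab.
- move=> x; rewrite in_itv/= => /andP[ax _].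
  by apply: derive1_is_derive; apply: dF; exact: lt_trans ax.
Qed.

Lemma mono_of_derive f (df : R -> R) (C a b : R) : a <= b ->
  (forall x, a <= x <= b -> D1 f x (df x)) ->
  (forall x, a <= x <= b -> C <= df x) -> C * (b - a) <= f b - f a.
Proof.
move=> ab dF dC.
have [c|c|c cab ->] := @MVT_segment _ f df a b ab.
- by rewrite in_itv/= => /andP[ac cb]; apply: dF; rewrite !ltW.
- by apply: within_cc => x xab; apply: dcont; exact: dF.
- by rewrite ler_wpM2r ?subr_ge0//; apply: dC; move: cab; rewrite in_itv.
Qed.

Lemma mono_of_derive_le f (df : R -> R) (C a b : R) : a <= b ->
  (forall x, a <= x <= b -> D1 f x (df x)) ->
  (forall x, a <= x <= b -> df x <= C) -> f b - f a <= C * (b - a).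
Proof.
move=> ab dF dC.
have := @mono_of_derive (fun x => - f x) (fun x => - df x) (- C) a b ab.
have -> : - f b - - f a = - (f b - f a) by ring.
rewrite mulNr lerN2; apply.
- by move=> x xab; apply: dopp; exact: dF.
- by move=> x xab; rewrite lerN2; exact: dC.
Qed.

End Calculus.

(** The clauses for partial applications such as [+%R ?c] catch the eta-reduced functions that
    second-order matching leaves behind. Side conditions such as a nonzero denominator remain as
    goals. *)
Ltac dstep := match goal with
  | |- D1 (fun _ => ?c) _ _ => exact: dcst
  | |- D1 (fun y => @?f y + @?g y) _ _ => apply: dadd
  | |- D1 (fun y => - @?f y) _ _ => apply: dopp
  | |- D1 (fun y => @?f y ^+ _) _ _ => apply: dpow
  | |- D1 (fun y => expR (@?f y)) _ _ => apply: dexp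
  | |- D1 (fun y => (@?f y)^-1) _ _ => apply: dinv
  | |- D1 (fun y => ln (@?f y)) _ _ => apply: dln
  | |- D1 (fun y => Num.sqrt (@?f y)) _ _ => apply: dsqrt
  | |- D1 (fun y => @?f y * @?g y) _ _ => apply: dmul
  | |- D1 ( *%R ?c) _ _ => apply: (@dmul _ (fun=> c) (fun y => y))
  | |- D1 ( +%R ?c) _ _ => apply: (@dadd _ (fun=> c) (fun y => y))
  | |- D1 GRing.inv _ _ => apply: (@dinv _ (fun y => y))
  | |- D1 expR _ _ => apply: (@dexp _ (fun y => y))
  | |- D1 -%R _ _ => apply: (@dopp _ (fun y => y))
  | |- D1 (fun y => y) _ _ => exact: did
  end.
Ltac cstep := match goal with
  | |- cpos (fun _ => ?c) => exact: cpos_cst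
  | |- cpos (fun y => @?f y + @?g y) => apply: cposD
  | |- cpos (fun y => - @?f y) => apply: cposN
  | |- cpos (fun y => @?f y ^+ _) => apply: cposX
  | |- cpos (fun y => expR (@?f y)) => apply: cposexp
  | |- cpos (fun y => (@?f y)^-1) => apply: cposV
  | |- cpos (fun y => ln (@?f y)) => apply: cposln
  | |- cpos (fun y => Num.sqrt (@?f y)) => apply: cpossqrt
  | |- cpos (fun y => `|@?f y|) => apply: cposabs
  | |- cpos (fun y => @?f y * @?g y) => apply: cposM
  | |- cpos ( *%R ?c) => apply: (@cposM _ (fun=> c) (fun y => y))
  | |- cpos ( +%R ?c) => apply: (@cposD _ (fun=> c) (fun y => y))
  | |- cpos GRing.inv => apply: (@cposV _ (fun y => y))
  | |- cpos expR => apply: (@cposexp _ (fun y => y))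
  | |- cpos -%R => apply: (@cposN _ (fun y => y))
  | |- cpos (fun y => y) => exact: cpos_id
  end.

Section EntropyIntegrand.
Variable R : realType.
Implicit Types (p q r f g u v w E : R -> R).

(** This is the integrand in the conclusion of [entropy_derive], at a frozen time and with abstract
    ingredients; it serves in that proof and again for the two nonlinear entropies. *)
Lemma entropy_integrand_cpos p q r E f g v w : cpos p -> cpos q -> cpos r -> cpos E ->
  cpos f -> cpos g -> cpos v -> cpos w -> forall h, cpos h ->
  cpos (fun x => (x ^+ 2 * r x + 2 * x * q x) * E x + q x * x ^+ 2 * f x
    - q x * g x * ((x ^+ 2 - 2 * x) * v x + v x ^+ 2) - p x * h x * w x).
Proof. by move=> *; repeat first [cstep|assumption]. Qed.

End EntropyIntegrand.

(** * Pointwise consequences of the solution concept, and the time derivative of localized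
    entropies *)

Section Solution.
Variable R : realType.
Implicit Types (x y t s a b c d T : R).
Local Notation mu := (@lebesgue_measure R).
Local Notation mR := (@measurable _ (measurableTypeR R)).
Local Notation H := (@halfline R).

Lemma mH : mR H.
Proof. exact: measurable_itv. Qed.

Lemma Hpos x : H x <-> 0 < x.
Proof. by rewrite /halfline /= in_itv/= andbT. Qed.

Lemma ccH a b : 0 < a -> `[a, b]%classic `<=` H.
Proof.
move=> a0 x /=; rewrite in_itv/= => /andP[ax _]; apply/Hpos.
exact: lt_le_trans ax.
Qed.

Lemma cpos_mfun (f : R -> R) : cpos f -> measurable_fun H f.
Proof.
move=> cf; apply: open_continuous_measurable_fun.
  exact: interval_open.
by move=> x /set_mem /Hpos; exact: cf.
Qed.

Lemma ID_cc_le (f g : R -> R) a b : 0 < a -> itg `[a, b] f -> itg H g ->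
  (forall x, 0 < x -> 0 <= g x) -> (forall x, a <= x <= b -> f x <= g x) ->
  ID `[a, b] f <= ID H g.
Proof.
move=> a0 itf itg_ g0 fg.
have mab : mR `[a, b] by exact: measurable_itv.
apply: (@le_trans _ _ (ID `[a, b] g)).
  apply: IDle => //; first by apply: itgS itg_ => //; [exact: mH|exact: ccH].
apply: ID_subset => //; first exact: mH.
- exact: ccH.
- by move=> x /Hpos; exact: g0.
Qed.

Lemma ID_cc_abs (f g : R -> R) a b : 0 < a -> itg `[a, b] f -> itg H g ->
  (forall x, 0 < x -> 0 <= g x) -> (forall x, a <= x <= b -> `|f x| <= g x) ->
  `|ID `[a, b] f| <= ID H g.
Proof.
move=> a0 itf itg_ g0 fg.
have mab : mR `[a, b] by exact: measurable_itv.
apply: le_trans (le_normr_Rintegral _ itf) _ => //.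
apply: ID_cc_le => //; exact: itg_abs.
Qed.

Lemma rect_bound (g : R -> R -> R) a b c d : 0 < a -> 0 < c ->
  (forall x t, 0 < x -> 0 < t -> {for (x, t), continuous (fun p : R * R => g p.1 p.2)}) ->
  exists C, forall x t, a <= x <= b -> c <= t <= d -> `|g x t| <= C.
Proof.
move=> a0 c0 cg.
have cK : compact (`[a, b] `*` `[c, d] : set (R * R)).
  by apply: compact_setX; exact: segment_compact.
have cgK : {within `[a, b] `*` `[c, d], continuous (fun p : R * R => g p.1 p.2)}.
  apply: continuous_in_subspaceT => -[x t] /set_mem[/=].
  rewrite !in_itv/= => /andP[ax _] /andP[ct _].
  by apply: cg; [exact: lt_le_trans ax|exact: lt_le_trans ct].
have := continuous_compact cgK cK.
move=> /compact_bounded[M [Mr MM]].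
exists (M + 1) => x t abx cdt.
have MM1 : M < M + 1 by rewrite ltrDl.
have := MM _ MM1 => /= MB; apply: MB.
by exists (x, t) => //=; split; rewrite /= in_itv.
Qed.

Lemma cont_pair1 (g : R -> R -> R) x t :
  {for (x, t), continuous (fun p : R * R => g p.1 p.2)} ->
  {for x, continuous (fun y => g y t)}.
Proof.
move=> cg.
exact: (@continuous2_cvg R R R R (nbhs x) _ id (fun=> t) g x t cg cvg_id (cvg_cst t)).
Qed.

Variables (n0 : R -> R) (n : R -> R -> R).
Hypothesis sol : kompaneets_solution n0 n.

Lemma n_init x : 0 < x -> n x 0 = n0 x.
Proof. by case: sol => h _; exact: h. Qed.

Lemma n_ge0 x t : 0 < x -> 0 <= t -> 0 <= n x t.
Proof. by case: sol => _ [h _]; exact: h. Qed.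

Lemma n_itg t : 0 <= t -> itg H (fun x => n x t).
Proof. by case: sol => _ [_ [h _]]; exact: h. Qed.

Lemma n_L1cont s : 0 <= s ->
  (L1dist (fun x => n x t) (fun x => n x s))
       @[t --> within [set t | 0 <= t] (nbhs s)] --> 0%E.
Proof. by case: sol => _ [_ [_ [h _]]]; exact: h. Qed.

Lemma n_bounded T : exists2 M, 0 < M &
  forall x t, 0 < x -> 0 <= t <= T -> n x t <= M.
Proof.
case: sol => _ [_ [_ [_ [h _]]]].
case: (lerP 0 T) => [T0|T0].
- have [M hM] := h T T0.
  exists (`|M| + 1); first by rewrite ltr_wpDl.
  move=> x t x0 tT; apply: (le_trans (ler_norm _)).
  by apply: (le_trans (hM x t x0 tT)); apply: (le_trans (ler_norm _)); rewrite lerDl.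
- exists 1 => // x t _ /andP[t0 tT].
  by have := lt_le_trans T0 (le_trans t0 tT); rewrite ltxx.
Qed.

Lemma n_dx x t : 0 < x -> 0 < t -> D1 (fun y => n y t) x (dx n x t).
Proof.
case: sol => _ [_ [_ [_ [_ [h _]]]]] x0 t0; have [[d1 _] _] := h x t x0 t0.
by rewrite /dx derive1E; exact: derivableP.
Qed.

Lemma n_dxx x t : 0 < x -> 0 < t -> D1 (fun y => dx n y t) x (dxx n x t).
Proof.
case: sol => _ [_ [_ [_ [_ [h _]]]]] x0 t0; have [[_ [d1 _]] _] := h x t x0 t0.
by rewrite /dxx derive1E; exact: derivableP.
Qed.

Lemma n_dt x t : 0 < x -> 0 < t -> D1 (fun s => n x s) t (dt n x t).
Proof.
case: sol => _ [_ [_ [_ [_ [h _]]]]] x0 t0; have [[_ [_ d1]] _] := h x t x0 t0.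
by rewrite /dt derive1E; exact: derivableP.
Qed.

Lemma n_jc x t : 0 < x -> 0 < t -> {for (x, t), continuous (fun p : R * R => n p.1 p.2)}.
Proof. by case: sol => _ [_ [_ [_ [_ [h _]]]]] x0 t0; have [_ []] := h x t x0 t0. Qed.

Lemma dx_jc x t : 0 < x -> 0 < t ->
  {for (x, t), continuous (fun p : R * R => dx n p.1 p.2)}.
Proof. by case: sol => _ [_ [_ [_ [_ [h _]]]]] x0 t0; have [_ [_ []]] := h x t x0 t0. Qed.

Lemma dt_jc x t : 0 < x -> 0 < t ->
  {for (x, t), continuous (fun p : R * R => dt n p.1 p.2)}.
Proof. by case: sol => _ [_ [_ [_ [_ [h _]]]]] x0 t0; have [_ [_ [_ []]]] := h x t x0 t0. Qed.

Lemma flux_derive x t : 0 < x -> 0 < t ->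
  D1 (fun y => flux n y t) x (dt n x t).
Proof.
case: sol => _ [_ [_ [_ [_ [_ [h _]]]]]] x0 t0; rewrite h// derive1E.
apply: derivableP.
suff : D1 (fun y => flux n y t) x (x ^+ 2 * dxx n x t + 2 * x * dx n x t +
  ((x ^+ 2 - 2 * x) * dx n x t + (2 * x - 2) * n x t) + 2 * n x t * dx n x t) by case.
rewrite /flux; apply: deq; first by
  repeat first [dstep|exact: n_dx|exact: n_dxx].
by rewrite /=; ring.
Qed.

Lemma n_pde x t : 0 < x -> 0 < t ->
  dt n x t = x ^+ 2 * dxx n x t + (x ^+ 2 + 2 * n x t) * dx n x t + (2 * x - 2) * n x t.
Proof.
move=> x0 t0; have /derive1_is_derive <- := flux_derive x0 t0.
apply: derive1_is_derive.
rewrite /flux; apply: deq; first by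
  repeat first [dstep|exact: n_dx|exact: n_dxx].
by rewrite /=; ring.
Qed.

Lemma flux_lim t : 0 < t -> flux n x t @[x --> +oo] --> 0.
Proof. by case: sol => _ [_ [_ [_ [_ [_ [_ h]]]]]]; exact: h. Qed.

Lemma n_cpos t : 0 < t -> cpos (fun x => n x t).
Proof. by move=> t0 x x0; apply: cont_pair1; exact: n_jc. Qed.

Lemma dx_cpos t : 0 < t -> cpos (fun x => dx n x t).
Proof. by move=> t0 x x0; apply: (@cont_pair1 (dx n)); exact: dx_jc. Qed.

Lemma dt_cpos t : 0 < t -> cpos (fun x => dt n x t).
Proof. by move=> t0 x x0; apply: (@cont_pair1 (dt n)); exact: dt_jc. Qed.

Lemma flux_cpos t : 0 < t -> cpos (fun x => flux n x t).
Proof. by move=> t0 x x0; apply: dcont; exact: flux_derive. Qed.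

(* The chain-rule data of an entropy [E x t = eta (x, n x t)]: [G] is the
   derivative of [eta] in [n], [Ex] its explicit [x]-derivative, and [Gx] the
   total [x]-derivative of [G]. *)
Lemma entropy_derive (psi psi1 psi2 : R -> R) (E G Ex Gx : R -> R -> R)
  (a b C t : R) : 0 < a -> a < b -> 0 < t ->
  (forall x, 0 < x -> D1 psi x (psi1 x)) ->
  (forall x, 0 < x -> D1 psi1 x (psi2 x)) ->
  cpos psi2 ->
  psi a = 0 -> psi b = 0 -> psi1 a = 0 -> psi1 b = 0 ->
  (forall x t, 0 < x -> 0 < t -> D1 (E x) t (G x t * dt n x t)) ->
  (forall x t, 0 < x -> 0 < t ->
    D1 (fun y => E y t) x (G x t * dx n x t + Ex x t)) ->
  (forall x t, 0 < x -> 0 < t -> D1 (fun y => G y t) x (Gx x t)) ->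
  (forall x t, 0 < x -> 0 < t -> `|G x t| <= C) ->
  (forall t, 0 < t -> cpos (fun x => Ex x t)) ->
  (forall t, 0 < t -> cpos (fun x => Gx x t)) ->
  D1 (fun s => ID `[a, b] (fun x => psi x * E x s)) t (ID `[a, b] (fun x => (x ^+ 2 * psi2 x + 2 * x * psi1 x) * E x t
       + psi1 x * x ^+ 2 * Ex x t
       - psi1 x * G x t * ((x ^+ 2 - 2 * x) * n x t + n x t ^+ 2)
       - psi x * Gx x t * flux n x t)).
Proof.
move=> a0 ab t0 dpsi dpsi1 cpsi2 psia psib psi1a psi1b Et Exd Gxd GC cEx cGx.
have cpsi : cpos psi by exact: cpos_derive dpsi.
have cpsi1 : cpos psi1 by exact: cpos_derive dpsi1.
have cE s : 0 < s -> cpos (fun x => E x s).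
  by move=> s0; apply: (@cpos_derive _ _ (fun x => G x s * dx n x s + Ex x s)) => x x0; exact: Exd.
have cG s : 0 < s -> cpos (fun x => G x s).
  by move=> s0; apply: (@cpos_derive _ _ (fun x => Gx x s)) => x x0; exact: Gxd.
have t20 : 0 < t / 2 by rewrite divr_gt0.
have Iab : `](t / 2), (2 * t)[%classic t.
  by rewrite /= in_itv/=; apply/andP; split; lra.
have Ipos s : `](t / 2), (2 * t)[%classic s -> 0 < s.
  by rewrite /= in_itv/= => /andP[h _]; exact: lt_trans h.
have xpos x : `[a, b]%classic x -> 0 < x.
  by rewrite /= in_itv/= => /andP[h _]; exact: lt_le_trans h.
(* On a compact rectangle around time [t], the bounds on [dt n], [psi] and [G] combine to the
   constant that dominates the differentiated integrand. *)
have [D hD] := rect_bound b (2 * t) a0 t20 dt_jc.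
have [P hP] : exists P, forall x, a <= x <= b -> `|psi x| <= P.
  have [|P hP] := @rect_bound (fun x _ => psi x) a b 1 1 a0 ltr01.
    by move=> x s x0 _; apply: (@continuous_comp _ _ _ (fun p : R * R => p.1) psi); [exact: cvg_fst|exact: cpsi].
  by exists P => x xab; apply: (hP x 1) => //; rewrite lexx.
pose f s x := psi x * E x s.
have df s x : `](t / 2), (2 * t)[%classic s -> `[a, b]%classic x ->
    D1 (f ^~ x) s (psi x * (G x s * dt n x s)).
  move=> /Ipos s0 /xpos x0; rewrite /f; apply: deq.
    by apply: dmul; [exact: dcst|exact: Et].
  by rewrite mulr0 addr0.
have mab : mR `[a, b] by exact: measurable_itv.
have intf s : `](t / 2), (2 * t)[%classic s -> itg `[a, b] (f s).
  by move=> /Ipos s0; apply: itg_cpos => //; apply: cposM => //; exact: cE.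
have derf s x : `](t / 2), (2 * t)[%classic s -> `[a, b]%classic x -> derivable (f ^~ x) s 1.
  by move=> h1 h2; have [] := df s x h1 h2.
pose K : R := P * (C * D).
have intK : itg `[a, b] (fun=> `|K|).
  by apply: itg_cpos => //; exact: cpos_cst.
have Kub s x : `](t / 2), (2 * t)[%classic s -> `[a, b]%classic x ->
   `|partial1of2 f s x| <= `|K|.
  move=> h1 h2; rewrite /partial1of2 (derive1_is_derive (df _ _ h1 h2)).
  have x0 := xpos _ h2; have s0 := Ipos _ h1.
  have xab : a <= x <= b by move: h2; rewrite /= in_itv.
  have sI : t / 2 <= s <= 2 * t.
    by move: h1; rewrite /= in_itv/= => /andP[/ltW -> /ltW ->].
  suff hK : `|psi x * (G x s * dt n x s)| <= K by exact: le_trans hK (ler_norm K).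
  rewrite !normrM /K; apply: ler_pM => //; first exact: hP.
  by apply: ler_pM => //; [exact: GC|exact: hD].
have K0 : forall x : R, 0 <= `|K| by [].
have der := derivable_under_integral mab Iab intf derf (fun=> K0 0) intK Kub.
have derE := differentiation_under_integral mab Iab intf derf (fun=> K0 0) intK Kub.
apply: (@deq _ _ _ _ _ (derivableP der)).
have {}derE : derive1 (fun s => ID `[a, b] (f s)) t =
    ID `[a, b] (fun x => psi x * (G x t * dt n x t)).
  rewrite [LHS]derE; apply: IDeq => x xab.
  by rewrite /partial1of2 (derive1_is_derive (df _ _ Iab xab)).
rewrite -derive1E derE.
(* [V] is the boundary term of two integrations by parts: one takes the derivative off the flux, the
   other trades [G * dx n] for the total derivative of [E], so that [psi1] no longer meets [dx n].
   It vanishes at [a] and [b] because [psi] and [psi1] do. *)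
pose V x := psi x * (G x t * flux n x t) - psi1 x * (x ^+ 2 * E x t).
pose V1 x := psi x * (G x t * dt n x t) -
  ((x ^+ 2 * psi2 x + 2 * x * psi1 x) * E x t
       + psi1 x * x ^+ 2 * Ex x t
       - psi1 x * G x t * ((x ^+ 2 - 2 * x) * n x t + n x t ^+ 2)
       - psi x * Gx x t * flux n x t).
have dV x : 0 < x -> D1 V x (V1 x).
  move=> x0; rewrite /V; apply: deq; first by
   repeat first [dstep|exact: dpsi|exact: dpsi1|exact: Gxd|exact: Exd|exact: flux_derive].
  by rewrite /V1 /flux /=; ring.
have cn : cpos (n^~ t) by exact: n_cpos.
have cF : cpos ((flux n)^~ t) by exact: flux_cpos.
have cdt : cpos ((dt n)^~ t) by exact: dt_cpos.
have cA : cpos (fun x => psi x * (G x t * dt n x t)).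
  exact: (cposM cpsi (cposM (cG t t0) cdt)).
have cB : cpos (fun x => (x ^+ 2 * psi2 x + 2 * x * psi1 x) * E x t
       + psi1 x * x ^+ 2 * Ex x t
       - psi1 x * G x t * ((x ^+ 2 - 2 * x) * n x t + n x t ^+ 2)
       - psi x * Gx x t * flux n x t).
  exact: (entropy_integrand_cpos cpsi cpsi1 cpsi2 (cE t t0) (cEx t t0) (cG t t0) cn cF (cGx t t0)).
have cV1 : cpos V1 by exact: (cposD cA (cposN cB)).
have := FTC a0 (ltW ab) dV cV1.
rewrite /V psia psib psi1a psi1b !mul0r !subr0.
rewrite /V1 IDB //; [|exact: itg_cpos|exact: itg_cpos].
by move/eqP; rewrite subr_eq0 => /eqP.
Qed.

End Solution.
Arguments mH {R}.

(** * The cutoff and its scale-invariant derivative bounds *)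

Section Cutoff.
Variable R : realType.
Local Notation mu := (@lebesgue_measure R).
Local Notation mR := (@measurable _ (measurableTypeR R)).
Local Notation H := (@halfline R).
Implicit Types (x y t s a b c d e k T : R) (f g : R -> R).

Lemma DCT (D : set R) (f_ : nat -> R -> R) f g : mR D ->
  (forall j, measurable_fun D (f_ j)) ->
  (forall x, D x -> f_ j x @[j --> \oo] --> f x) ->
  itg D g -> (forall j x, D x -> `|f_ j x| <= g x) ->
  itg D f /\ ID D (f_ j) @[j --> \oo] --> ID D f.
Proof.
move=> mD mf fc ig fg.
have mfE j : measurable_fun D (EFin \o f_ j) by exact/measurable_EFinP.
have mf' : measurable_fun D (EFin \o f).
  apply/measurable_EFinP.
  exact: (measurable_fun_cvg mf).
have aec : {ae mu, forall x, D x -> (EFin \o f_ j) x @[j --> \oo] --> (EFin \o f) x}.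
  by apply: aeW => x Dx; apply: cvg_EFin; [exact: nearW|exact: fc].
have ael : {ae mu, forall x, forall j, D x -> (`|(EFin \o f_ j) x| <= (EFin \o g) x)%E}.
  by apply: aeW => x j Dx /=; rewrite lee_fin; exact: fg.
have [if_ _ cf] := @dominated_convergence _ _ _ mu D mD _ _ _ mfE mf' aec ig ael.
split => //; rewrite /ID /Rintegral; apply: fine_cvg.
by rewrite fineK//; exact: integrable_fin_num.
Qed.

(* The errors caused by the cutoff [psi k], supported on [[1 / k, k]], are
   multiples of [rho k]. *)
Definition rho k x : R := Num.min 1 ((x + x^-1) / k).

Lemma rho_ge0 k x : 0 < k -> 0 < x -> 0 <= rho k x.
Proof.
move=> k0 x0; rewrite /rho le_min ler01/=.
by rewrite divr_ge0 ?addr_ge0 ?invr_ge0//; exact: ltW.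
Qed.

Lemma rho_le1 k x : rho k x <= 1.
Proof. by rewrite /rho ge_min lexx. Qed.

Lemma rho_anti k k' x : 0 < k -> k <= k' -> 0 < x -> rho k' x <= rho k x.
Proof.
move=> k0 kk x0; rewrite /rho le_min ge_min lexx/= ge_min; apply/orP; right.
apply: ler_wpM2l; first by rewrite addr_ge0 ?invr_ge0// ltW.
by rewrite lef_pV2 ?posrE//; exact: lt_le_trans kk.
Qed.

Lemma rho_meas k : measurable_fun H (rho k).
Proof.
apply: measurable_minr; first exact: measurable_cst.
apply: cpos_mfun; repeat cstep.
by move=> x x0; rewrite gt_eqF.
Qed.

Lemma rho_cvg x : 0 < x -> rho j.+1%:R x @[j --> \oo] --> 0.
Proof.
move=> x0.
apply: (@squeeze_cvgr _ _ _ _ (fun=> 0) (fun j => (x + x^-1) * (j.+1%:R)^-1)).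
- near=> j; rewrite rho_ge0//=; rewrite /rho ge_min; apply/orP; right.
  exact: lexx.
- exact: cvg_cst.
- rewrite -[X in _ --> X](mulr0 (x + x^-1)); apply: cvgMr.
  exact: cvg_harmonic.
Unshelve. all: by end_near. Qed.

Definition pc k x : R := 1 - (k * x)^-1.
Definition qc k x : R := 1 - x / k.
(** The squares make [psi] vanish together with its derivative at both ends [1 / k] and [k]. In the
    variables [(k x)^-1] and [x / k] not only [psi] but also [x psi'] and [x^2 psi''] are
    polynomials, which is what lets [rho] control them. *)
Definition psi k x : R := pc k x ^+ 2 * qc k x ^+ 2.
Definition psi1 k x : R := 2 * pc k x * (k * x ^+ 2)^-1 * qc k x ^+ 2
   - 2 * pc k x ^+ 2 * qc k x / k.
Definition psi2 k x : R := 2 * ((k * x ^+ 2)^-1) ^+ 2 * qc k x ^+ 2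
   - 4 * pc k x * (k * x ^+ 3)^-1 * qc k x ^+ 2
   - 8 * pc k x * (k * x ^+ 2)^-1 * qc k x / k
   + 2 * pc k x ^+ 2 * (k^-1) ^+ 2.

Lemma psi_d k x : 0 < k -> 0 < x -> D1 (psi k) x (psi1 k x).
Proof.
move=> k0 x0; have kn : k != 0 by rewrite gt_eqF.
have xn : x != 0 by rewrite gt_eqF.
rewrite /psi /pc /qc; apply: deq; first by
  repeat first [dstep|by rewrite mulf_neq0].
by rewrite /psi1 /pc /qc /=; field; rewrite kn xn.
Qed.

Lemma psi1_d k x : 0 < k -> 0 < x -> D1 (psi1 k) x (psi2 k x).
Proof.
move=> k0 x0; have kn : k != 0 by rewrite gt_eqF.
have xn : x != 0 by rewrite gt_eqF.
rewrite /psi1 /pc /qc; apply: deq; first by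
  repeat first [dstep|by rewrite mulf_neq0 ?expf_neq0].
by rewrite /psi2 /pc /qc /=; field; rewrite kn xn.
Qed.

Lemma psi2_cpos k : 0 < k -> cpos (psi2 k).
Proof.
move=> k0; rewrite /psi2 /pc /qc.
repeat first [cstep | move=> x x0]; by rewrite ?mulf_neq0 ?expf_neq0 ?gt_eqF.
Qed.

Lemma psi_cpos k : 0 < k -> cpos (psi k).
Proof. by move=> k0 x x0; apply: dcont; exact: psi_d. Qed.
Lemma psi1_cpos k : 0 < k -> cpos (psi1 k).
Proof. by move=> k0 x x0; apply: dcont; exact: psi1_d. Qed.
Lemma pc_cpos k : 0 < k -> cpos (pc k).
Proof.
move=> k0; rewrite /pc.
repeat first [cstep | move=> x x0]; by rewrite ?mulf_neq0 ?expf_neq0 ?gt_eqF.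
Qed.
Lemma qc_cpos k : cpos (qc k).
Proof. by rewrite /qc; repeat cstep. Qed.

Lemma psi_a k : 0 < k -> psi k k^-1 = 0 /\ psi1 k k^-1 = 0.
Proof.
move=> k0; have kn : k != 0 by rewrite gt_eqF.
by rewrite /psi /psi1 /pc divff// invr1 subrr expr0n/= !mulr0 !mul0r subr0.
Qed.

Lemma psi_b k : 0 < k -> psi k k = 0 /\ psi1 k k = 0.
Proof.
move=> k0; have kn : k != 0 by rewrite gt_eqF.
by rewrite /psi /psi1 /qc divff// subrr expr0n/= !mulr0 !mul0r subr0.
Qed.

Lemma prod01 x y : 0 <= x <= 1 -> 0 <= y <= 1 -> 0 <= x * y <= 1.
Proof.
move=> /andP[x0 x1] /andP[y0 y1]; rewrite mulr_ge0//=.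
by rewrite mulr_ile1.
Qed.

Lemma sqr01 x : 0 <= x <= 1 -> 0 <= x ^+ 2 <= 1.
Proof. by move=> h; rewrite expr2; exact: prod01. Qed.

Lemma mul01 x y : 0 <= x -> 0 <= y <= 1 -> 0 <= x * y <= x.
Proof. by move=> x0 /andP[y0 y1]; rewrite mulr_ge0//= ler_piMr. Qed.

Section bounds.
Variables (k x : R).
Hypotheses (k1 : 1 < k) (kx : k^-1 <= x <= k).
Let al := (k * x)^-1.
Let be := x / k.

Lemma k_gt0 : 0 < k. Proof. exact: lt_trans k1. Qed.
Lemma x_gt0 : 0 < x.
Proof.
by case/andP: kx => h _; apply: lt_le_trans h; rewrite invr_gt0; exact: k_gt0.
Qed.

Lemma al01 : 0 <= al <= 1.
Proof.
have k0 := k_gt0; have x0 := x_gt0.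
apply/andP; split; first by rewrite /al invr_ge0 mulr_ge0// ltW.
rewrite /al invf_le1 ?mulr_gt0//.
case/andP: kx => h _; rewrite -ler_pdivrMl// mulr1//.
Qed.
Lemma be01 : 0 <= be <= 1.
Proof.
have k0 := k_gt0; have x0 := x_gt0.
apply/andP; split; first by rewrite /be divr_ge0// ltW.
by rewrite /be ler_pdivrMr// mul1r; case/andP: kx.
Qed.
Lemma pc01 : 0 <= pc k x <= 1.
Proof. have := al01; rewrite /pc -/al => /andP[h1 h2]; apply/andP; split; lra. Qed.
Lemma qc01 : 0 <= qc k x <= 1.
Proof. have := be01; rewrite /qc -/be => /andP[h1 h2]; apply/andP; split; lra. Qed.

Lemma albe_rho : al + be <= 2 * rho k x.
Proof.
have k0 := k_gt0; have x0 := x_gt0.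
have -> : al + be = (x + x^-1) / k.
  by rewrite /al /be; field; rewrite !gt_eqF.
rewrite /rho; have /andP[a0 a1] := al01; have /andP[b0 b1] := be01.
have E : (x + x^-1) / k = al + be.
  by rewrite /al /be; field; rewrite !gt_eqF.
rewrite E; have [h|h] := leP 1 (al + be); lra.
Qed.

Lemma kV_rho : k^-1 <= rho k x.
Proof.
have k0 := k_gt0; have x0 := x_gt0.
rewrite /rho le_min; apply/andP; split; first by rewrite invf_le1// ltW.
rewrite -[X in X <= _]mul1r; apply: ler_wpM2r; first by rewrite invr_ge0 ltW.
have : 0 <= (x - 1) ^+ 2 by exact: sqr_ge0.
move=> h; rewrite -(@ler_pM2r _ x)// mul1r mulrDl mulVf ?gt_eqF//.
nra.
Qed.

Lemma psi01 : 0 <= psi k x <= 1.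
Proof.
by rewrite /psi; apply: prod01; apply: sqr01; [exact: pc01|exact: qc01].
Qed.

Lemma psi_rho : 1 - psi k x <= 4 * rho k x.
Proof.
have /andP[a0 a1] := al01; have /andP[b0 b1] := be01; have h := albe_rho.
rewrite /psi /pc /qc -/al -/be.
suff : 1 - (1 - al) ^+ 2 * (1 - be) ^+ 2 <= 2 * (al + be) by lra.
have -> : 1 - (1 - al) ^+ 2 * (1 - be) ^+ 2 =
  2 * (al + be) - (al ^+ 2 * (1 - be) ^+ 2 + be ^+ 2 + (2 * al) * be * (1 + (1 - be))) by ring.
rewrite gerBl; apply: addr_ge0; first by
  apply: addr_ge0; [apply: mulr_ge0; exact: sqr_ge0|exact: sqr_ge0].
by apply: mulr_ge0; [apply: mulr_ge0|]; lra.
Qed.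

Lemma xpsi1_rho : `|x * psi1 k x| <= 4 * rho k x.
Proof.
have k0 := k_gt0; have x0 := x_gt0.
have /andP[a0 a1] := al01; have /andP[b0 b1] := be01; have h := albe_rho.
have p01 := pc01; have q01 := qc01; have a01 := al01; have b01 := be01.
have -> : x * psi1 k x = 2 * al * (pc k x * qc k x ^+ 2) - 2 * be * (pc k x ^+ 2 * qc k x).
  by rewrite /psi1 /al /be; field; rewrite !gt_eqF.
have u2 : 0 <= pc k x * qc k x ^+ 2 <= 1 by apply: prod01 => //; exact: sqr01.
have u4 : 0 <= pc k x ^+ 2 * qc k x <= 1 by apply: prod01 => //; exact: sqr01.
have w1 := mul01 (mulr_ge0 (ler0n _ 2) a0) u2.
have w2 := mul01 (mulr_ge0 (ler0n _ 2) b0) u4.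
by rewrite ler_norml; lra.
Qed.

Lemma x2psi2_rho : `|x ^+ 2 * psi2 k x| <= 28 * rho k x.
Proof.
have k0 := k_gt0; have x0 := x_gt0.
have /andP[a0 a1] := al01; have /andP[b0 b1] := be01; have h := albe_rho.
have p01 := pc01; have q01 := qc01; have a01 := al01; have b01 := be01.
have -> : x ^+ 2 * psi2 k x = 2 * al * (al * qc k x ^+ 2) - 4 * al * (pc k x * qc k x ^+ 2)
  - 8 * al * (pc k x * qc k x * be) + 2 * be * (pc k x ^+ 2 * be).
  by rewrite /psi2 /al /be; field; rewrite !gt_eqF.
have u1 : 0 <= al * qc k x ^+ 2 <= 1 by apply: prod01 => //; exact: sqr01.
have u2 : 0 <= pc k x * qc k x ^+ 2 <= 1 by apply: prod01 => //; exact: sqr01.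
have u3 : 0 <= pc k x * qc k x * be <= 1 by apply: prod01 => //; exact: prod01.
have u4 : 0 <= pc k x ^+ 2 * be <= 1 by apply: prod01 => //; exact: sqr01.
have w1 := mul01 (mulr_ge0 (ler0n _ 2) a0) u1.
have w2 := mul01 (mulr_ge0 (ler0n _ 4) a0) u2.
have w3 := mul01 (mulr_ge0 (ler0n _ 8) a0) u3.
have w4 := mul01 (mulr_ge0 (ler0n _ 2) b0) u4.
by rewrite ler_norml; lra.
Qed.

End bounds.
End Cutoff.

Lemma increasing_seq_ge (f : nat -> nat) : increasing_seq f -> forall j, (j <= f j)%N.
Proof.
move=> finc; elim=> // j ih; apply: (leq_ltn_trans ih).
by rewrite ltnNge; apply/negP => h; have := finc j.+1 j; rewrite leEnat h ltnn.
Qed.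

(** * Uniform smallness of the cutoff error, and the localized weak formulation *)

Section WeakForm.
Variable R : realType.
Local Notation mu := (@lebesgue_measure R).
Local Notation mR := (@measurable _ (measurableTypeR R)).
Local Notation H := (@halfline R).
Implicit Types (x y t s a b c d e k T : R) (f g : R -> R).
Variables (n0 : R -> R) (n : R -> R -> R).
Hypothesis sol : kompaneets_solution n0 n.

Definition eps (n : R -> R -> R) k t : R := ID H (fun x => rho k x * n x t).
Definition mass (n : R -> R -> R) t : R := ID H (fun x => n x t).
Definition L1d (n : R -> R -> R) t s : R := ID H (fun x => `|n x t - n x s|).

Lemma n_mfun t : 0 <= t -> measurable_fun H (fun x => n x t).
Proof. by move=> t0; apply: itg_mfun; exact: (n_itg sol). Qed.

Lemma itg_bn (g : R -> R) C t : 0 <= t -> measurable_fun H g ->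
  (forall x, 0 < x -> `|g x| <= C) -> itg H (fun x => g x * n x t).
Proof.
move=> t0 mg gC; have itn := n_itg sol t0.
apply: (@itg_le _ _ _ (fun x => C * n x t)); first exact: mH.
- by apply: measurable_funM => //; exact: n_mfun.
- by apply: itgZ => //; exact: mH.
- move=> x /Hpos x0; rewrite normrM (ger0_norm (n_ge0 sol x0 t0)).
  by rewrite ler_wpM2r ?(n_ge0 sol)//; exact: gC.
Qed.

Lemma itg_rhon k t : 0 < k -> 0 <= t -> itg H (fun x => rho k x * n x t).
Proof.
move=> k0 t0; apply: (@itg_bn _ 1) => //; first exact: rho_meas.
by move=> x x0; rewrite ger0_norm ?rho_le1// rho_ge0.
Qed.

Lemma itg_absd t s : 0 <= t -> 0 <= s -> itg H (fun x => `|n x t - n x s|).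
Proof.
by move=> t0 s0; apply: itg_abs; [exact: mH|apply: itgB; [exact: mH|exact: (n_itg sol)..]].
Qed.

Lemma L1d_cont s e : 0 <= s -> 0 < e ->
  exists2 d, 0 < d & forall t, 0 <= t -> `|t - s| < d -> L1d n t s < e.
Proof.
move=> s0 e0; have := n_L1cont sol s0.
move=> /fine_cvgP[fn]; move=> /cvgrPdist_lt /(_ e e0).
rewrite /prop_near1 /nbhs/= /within/= => -[d d0 hd]; exists d => // t t0 ts.
have := hd t; rewrite /ball_ /= distrC => /(_ ts t0).
rewrite sub0r normrN; apply: le_lt_trans.
rewrite /L1d /L1dist; exact: ler_norm.
Qed.

Lemma ID_L1d (g : R -> R) C t s : 0 <= t -> 0 <= s -> measurable_fun H g ->
  (forall x, 0 < x -> `|g x| <= C) ->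
  `|ID H (fun x => g x * n x t) - ID H (fun x => g x * n x s)| <= C * L1d n t s.
Proof.
move=> t0 s0 mg gC.
have i1 := itg_bn t0 mg gC; have i2 := itg_bn s0 mg gC.
rewrite -IDB//; [|exact: mH].
rewrite /L1d -IDZ; [|exact: mH|exact: itg_absd].
apply: IDabs_le; [exact: mH|by apply: itgB => //; exact: mH|..].
- by apply: itgZ; [exact: mH|exact: itg_absd].
- move=> x /Hpos x0; rewrite -mulrBr normrM ler_wpM2r//; exact: gC.
Qed.

Lemma eps_ge0 k t : 0 < k -> 0 <= t -> 0 <= eps n k t.
Proof.
move=> k0 t0; apply: ID_ge0 => x /Hpos x0; rewrite mulr_ge0 ?rho_ge0//.
exact: (n_ge0 sol).
Qed.

Lemma eps_anti k k' t : 0 < k -> k <= k' -> 0 <= t -> eps n k' t <= eps n k t.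
Proof.
move=> k0 kk t0; have k'0 : 0 < k' by exact: lt_le_trans kk.
apply: IDle; [exact: mH|exact: itg_rhon|exact: itg_rhon|].
move=> x /Hpos x0; rewrite ler_wpM2r ?(n_ge0 sol)//; exact: rho_anti.
Qed.

Lemma eps_pt t e : 0 <= t -> 0 < e -> exists2 K, 1 < K & eps n K t < e.
Proof.
move=> t0 e0.
have h1 (j : nat) : measurable_fun H (fun x => rho j.+1%:R x * n x t).
  by apply: measurable_funM; [exact: rho_meas|exact: n_mfun].
have h2 x : H x -> rho j.+1%:R x * n x t @[j --> \oo] --> (0 : R).
  move=> /Hpos x0; rewrite -[X in _ --> X](mul0r (n x t)).
  by apply: cvgMl; exact: rho_cvg.
have h3 (j : nat) x : H x -> `|rho j.+1%:R x * n x t| <= n x t.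
  move=> /Hpos x0; rewrite ger0_norm ?mulr_ge0 ?rho_ge0// ?(n_ge0 sol)//.
  by rewrite ler_piMl ?rho_le1// (n_ge0 sol).
have [_] := DCT mH h1 h2 (n_itg sol t0) h3.
have -> : ID H (fun=> 0 : R) = 0.
  by rewrite /ID Rintegral_cst ?mul0r//; exact: mH.
move=> /cvgrPdist_lt /(_ e e0)[J _ hJ].
exists J.+2%:R; first by rewrite ltr1n.
have := hJ J.+1 (leqnSn J); rewrite /= sub0r normrN; apply: le_lt_trans.
exact: ler_norm.
Qed.

(** A Dini argument: [eps] decreases in [k], tends to 0 at each time by dominated convergence, and
    its variation in time is bounded by the [L1] distance uniformly in [k]. A sequence of bad pairs
    [(k, t)] would accumulate at a time [s], where a fixed [K] already gives a contradiction. *)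
Lemma eps_unif T e : 0 < e ->
  exists2 K, 1 < K & forall k t, K <= k -> 0 <= t <= T -> eps n k t <= e.
Proof.
move=> e0; apply: contrapT => hn.
have hj (j : nat) : exists kt : R * R, j.+2%:R <= kt.1 /\ (0 <= kt.2 <= T /\ e < eps n kt.1 kt.2).
  apply: contrapT => hc; apply: hn; exists j.+2%:R; first by rewrite ltr1n.
  move=> k t jk tT; rewrite leNgt; apply/negP => h.
  by apply: hc; exists (k, t).
pose u j := sval (cid (hj j)).
have hu j : j.+2%:R <= (u j).1 /\ (0 <= (u j).2 <= T /\ e < eps n (u j).1 (u j).2).
  exact: svalP (cid (hj j)).
have bu : bounded_fun (fun j => (u j).2).
  exists T; split; first exact: num_real.
  move=> M TM j _ /=; have [_ [/andP[h1 h2] _]] := hu j.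
  by rewrite ger0_norm//; apply: ltW; exact: le_lt_trans TM.
have [f finc /cvg_ex[s us]] := bolzano_weierstrass bu.
have s0 : 0 <= s.
  have <- : lim ((fun j => (u j).2) \o f @ \oo) = s by exact/cvg_lim.
  apply: limr_ge; first by apply/cvg_ex; exists s.
  by near=> j; have [_ [/andP[]]] := hu (f j).
have e20 : 0 < e / 2 by rewrite divr_gt0.
have [K K1 hK] := eps_pt s0 e20.
have [d d0 hd] := L1d_cont s0 e20.
move/cvgrPdist_lt : us => /(_ d d0)[J _ hJ].
have fge := increasing_seq_ge finc.
pose j := maxn J (Num.truncn K).+1.
have [h1 [/andP[h2 h3] h4]] := hu (f j).
have K0 : 0 < K by exact: lt_trans K1.
have Kk : K <= (u (f j)).1.
  apply: le_trans h1; apply: (@le_trans _ _ (Num.truncn K).+1%:R).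
    by apply: ltW; apply: truncnS_gt.
  rewrite ler_nat; apply: (@leq_trans j); first exact: leq_maxr.
  by apply: (leq_trans (fge j)); rewrite -addn2 leq_addr.
have dist : `|(u (f j)).2 - s| < d.
  by rewrite distrC; apply: (hJ j); rewrite /= leq_maxl.
have := hd _ h2 dist.
have a1 : eps n (u (f j)).1 (u (f j)).2 <= eps n K (u (f j)).2 by exact: eps_anti.
have a2 : `|eps n K (u (f j)).2 - eps n K s| <= 1 * L1d n (u (f j)).2 s.
  apply: ID_L1d => //; first exact: rho_meas.
  by move=> x x0; rewrite ger0_norm ?rho_le1// rho_ge0.
move: a2; rewrite mul1r ler_norml => /andP[_ a2] a3.
lra.
Unshelve. all: by end_near. Qed.

Definition Jk k f : R := ID `[k^-1, k] f.

Definition Lop (n : R -> R -> R) (phi1 phi2 : R -> R) t x : R :=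
  x ^+ 2 * phi2 x + (4 * x - x ^+ 2 - n x t) * phi1 x.
(* [loss] and [gain] come from the cutoff near [0] and near infinity; they
   converge to the outflow [n_t(0)^2] and to the inflow from infinity. *)
Definition loss (n : R -> R -> R) phi k t x : R :=
  phi x * (2 * pc k x * (k * x ^+ 2)^-1 * qc k x ^+ 2) * n x t ^+ 2.
Definition gain (n : R -> R -> R) phi k t x : R :=
  phi x * (2 * pc k x ^+ 2 * qc k x / k) * ((x ^+ 2 + n x t) * n x t).

Lemma kinv_gt0 k : 1 < k -> 0 < k^-1.
Proof. by move=> k1; rewrite invr_gt0; exact: lt_trans k1. Qed.

Lemma kinv_lt k : 1 < k -> k^-1 < k.
Proof. by move=> k1; apply: (@lt_trans _ _ 1) => //; rewrite invf_lt1//; exact: lt_trans k1. Qed.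

Lemma itg_Jk k f : 1 < k -> cpos f -> itg `[k^-1, k] f.
Proof. by move=> k1 cf; apply: itg_cpos => //; exact: kinv_gt0. Qed.

Lemma Jk_eps k C f t : 1 < k -> 0 <= t -> cpos f -> 0 <= C ->
  (forall x, k^-1 <= x <= k -> `|f x| <= C * (rho k x * n x t)) ->
  `|Jk k f| <= C * eps n k t.
Proof.
move=> k1 t0 cf C0 fC; have k0 : 0 < k by exact: lt_trans k1.
rewrite /eps -IDZ; [|exact: mH|exact: itg_rhon].
apply: ID_cc_abs => //; [exact: kinv_gt0|exact: itg_Jk| |].
- by apply: itgZ; [exact: mH|exact: itg_rhon].
- by move=> x x0; rewrite !mulr_ge0 ?rho_ge0 ?(n_ge0 sol).
Qed.

Lemma cut_cpos phi k t : 0 < k -> 0 < t -> cpos phi ->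
  [/\ cpos (loss n phi k t) & cpos (gain n phi k t)].
Proof.
move=> k0 t0 cphi; rewrite /loss /gain.
have cn := n_cpos sol t0; have cp := pc_cpos k0; have cq := @qc_cpos _ k.
have kn : k != 0 by rewrite gt_eqF.
split; repeat first [cstep | assumption | move=> x x0; rewrite ?mulf_neq0 ?expf_neq0 ?gt_eqF//].
Qed.

Lemma Lop_cpos phi1 phi2 t : 0 < t -> cpos phi1 -> cpos phi2 -> cpos (Lop n phi1 phi2 t).
Proof.
move=> t0 c1 c2; rewrite /Lop; have cn := n_cpos sol t0.
by repeat first [cstep | assumption].
Qed.

(** This is [entropy_derive] for the linear entropy [n] and the test function [phi * psi k]. The
    terms without derivatives of [psi k] form [Lop]. The lower half of [psi1] tested against [n^2]
    gives [loss], the upper half tested against [x^2 n + n^2] gives [gain], and what remains is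
    linear in [n] with a coefficient of size [rho k]. *)
Lemma weak_form (phi phi1 phi2 : R -> R) C k t : 1 < k -> 0 < t ->
  (forall x, 0 < x -> D1 phi x (phi1 x)) ->
  (forall x, 0 < x -> D1 phi1 x (phi2 x)) -> cpos phi2 -> 0 <= C ->
  (forall x, 0 < x -> `|phi x| <= C) ->
  (forall x, 0 < x -> `|x * phi1 x| <= C) ->
  exists2 e, `|e| <= 54 * C * eps n k t &
  D1 (fun s => Jk k (fun x => phi x * psi k x * n x s)) t
    (Jk k (fun x => psi k x * Lop n phi1 phi2 t x * n x t)
     - Jk k (loss n phi k t) + Jk k (gain n phi k t) + e).
Proof.
move=> k1 t0 dphi dphi1 cphi2 C0 phiC phi1C.
have k0 : 0 < k by exact: lt_trans k1.
have kn : k != 0 by rewrite gt_eqF.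
have t0' := ltW t0.
have cphi : cpos phi by exact: cpos_derive dphi.
have cphi1 : cpos phi1 by exact: cpos_derive dphi1.
have cn := n_cpos sol t0; have cp := pc_cpos k0; have cq := @qc_cpos _ k.
have cpsi := psi_cpos k0; have cpsi1 := psi1_cpos k0; have cpsi2 := psi2_cpos k0.
have [closs cgain] := cut_cpos k0 t0 cphi.
have cL := Lop_cpos t0 cphi1 cphi2.
(* The last summand is [x^2 n] tested against the lower half of [psi1], since
   [x^2 (k x^2)^-1 = k^-1]. The constant 54 is 44 + 8 + 2, one number per summand, where 44 is 28
   from [x2psi2_rho] plus four times the 4 of [xpsi1_rho]. *)
pose err x := (phi x * (x ^+ 2 * psi2 k x + 4 * (x * psi1 k x))
   + 2 * (x * phi1 x) * (x * psi1 k x)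
   - phi x * (2 * pc k x * qc k x ^+ 2 / k)) * n x t.
have cerr : cpos err by rewrite /err; repeat first [cstep|assumption].
exists (Jk k err).
  apply: Jk_eps => //; first by rewrite mulr_ge0.
  move=> x kx; rewrite /err normrM.
  have x0 := x_gt0 k1 kx.
  rewrite (ger0_norm (n_ge0 sol x0 t0')).
  suff h : `|phi x * (x ^+ 2 * psi2 k x + 4 * (x * psi1 k x))
      + 2 * (x * phi1 x) * (x * psi1 k x)
      - phi x * (2 * pc k x * qc k x ^+ 2 / k)| <= 54 * C * rho k x.
    apply: le_trans (ler_wpM2r (n_ge0 sol x0 t0') h) _.
    by rewrite -!mulrA.
  have r0 := rho_ge0 k0 x0.
  have h1 := xpsi1_rho k1 kx; have h2 := x2psi2_rho k1 kx.
  have h3 := kV_rho k1 kx.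
  have u : 0 <= pc k x * qc k x ^+ 2 <= 1.
    by apply: prod01; [exact: pc01|apply: sqr01; exact: qc01].
  have b1 : `|phi x * (x ^+ 2 * psi2 k x + 4 * (x * psi1 k x))| <= C * (44 * rho k x).
    rewrite normrM; apply: ler_pM => //; first exact: phiC.
    apply: (le_trans (ler_normD _ _)); rewrite [`|4 * _|]normrM normr_nat.
    by lra.
  have b2 : `|2 * (x * phi1 x) * (x * psi1 k x)| <= (2 * C) * (4 * rho k x).
    rewrite normrM; apply: ler_pM => //.
    rewrite normrM normr_nat.
    by rewrite ler_wpM2l// phi1C.
  have b3 : `|phi x * (2 * pc k x * qc k x ^+ 2 / k)| <= C * (2 * rho k x).
    rewrite normrM; apply: ler_pM => //; first exact: phiC.
    have -> : 2 * pc k x * qc k x ^+ 2 / k = (2 * k^-1) * (pc k x * qc k x ^+ 2) by ring.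
    have k20 : 0 <= 2 * k^-1 by rewrite mulr_ge0// invr_ge0 ltW.
    have /andP[m0 m1] := mul01 k20 u.
    by rewrite ger0_norm//; lra.
  apply: (le_trans (ler_normB _ _)).
  apply: (le_trans (lerD (ler_normD _ _) (lexx _))).
  by lra.
pose Psi x := phi x * psi k x.
pose Psi1 x := phi x * psi1 k x + psi k x * phi1 x.
pose Psi2 x := phi x * psi2 k x + psi1 k x * phi1 x + (psi k x * phi2 x + phi1 x * psi1 k x).
have dPsi x : 0 < x -> D1 Psi x (Psi1 x).
  by move=> x0; apply: dmul; [exact: dphi|exact: psi_d].
have dPsi1 x : 0 < x -> D1 Psi1 x (Psi2 x).
  move=> x0; apply: dadd; apply: dmul; [exact: dphi|exact: psi1_d|exact: psi_d|exact: dphi1].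
have cPsi2 : cpos Psi2 by rewrite /Psi2; repeat first [cstep|assumption].
have [pa p1a] := psi_a k0; have [pb p1b] := psi_b k0.
have Pa : Psi k^-1 = 0 by rewrite /Psi pa mulr0.
have Pb : Psi k = 0 by rewrite /Psi pb mulr0.
have P1a : Psi1 k^-1 = 0 by rewrite /Psi1 pa p1a mul0r mulr0 addr0.
have P1b : Psi1 k = 0 by rewrite /Psi1 pb p1b mul0r mulr0 addr0.
have := @entropy_derive R n0 n sol Psi Psi1 Psi2 n (fun _ _ => 1) (fun _ _ => 0) (fun _ _ => 0)
  k^-1 k 1 t (kinv_gt0 k1) (kinv_lt k1) t0 dPsi dPsi1 cPsi2 Pa Pb P1a P1b.
have E1 x s : 0 < x -> 0 < s -> D1 (n x) s (1 * dt n x s).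
  by move=> x0 s0; rewrite mul1r; exact: (n_dt sol).
have E2 x s : 0 < x -> 0 < s -> D1 (fun y => n y s) x (1 * dx n x s + 0).
  by move=> x0 s0; rewrite mul1r addr0; exact: (n_dx sol).
have E3 x s : 0 < x -> 0 < s -> D1 (fun=> 1) x (0 : R).
  by move=> _ _; exact: dcst.
have E4 x s : 0 < x -> 0 < s -> `|1 : R| <= 1 by rewrite normr1.
have E5 s : 0 < s -> cpos (fun _ : R => 0 : R) by move=> _; exact: cpos_cst.
move=> /(_ E1 E2 E3 E4 E5 E5) hD.
apply: (deq hD).
rewrite /Jk -IDB; [|exact: measurable_itv|apply: itg_Jk => //|exact: itg_Jk]; last first.
  by repeat first [cstep|assumption].
have c1 : cpos (fun x => psi k x * Lop n phi1 phi2 t x * n x t - loss n phi k t x).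
  by repeat first [cstep|assumption].
rewrite -IDD; [|exact: measurable_itv|exact: itg_Jk|exact: itg_Jk].
have c2 : cpos (fun x => psi k x * Lop n phi1 phi2 t x * n x t - loss n phi k t x + gain n phi k t x).
  by repeat first [cstep|assumption].
rewrite -IDD; [|exact: measurable_itv|exact: itg_Jk|exact: itg_Jk].
apply: IDeq => x /=; rewrite in_itv/= => kx.
have x0 := x_gt0 k1 kx; have xn : x != 0 by rewrite gt_eqF.
rewrite /err /Lop /loss /gain /Psi1 /Psi2 /psi1.
by field; rewrite kn xn.
Qed.

End WeakForm.

(** * Passage to the limit in the cutoff parameter, and decay at large energy *)

Section Limits.
Variable R : realType.
Local Notation mu := (@lebesgue_measure R).
Local Notation mR := (@measurable _ (measurableTypeR R)).
Local Notation H := (@halfline R).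
Implicit Types (x y t s a b c d e k T h : R) (f g : R -> R).

Lemma le_of_small x y : (forall e, 0 < e -> x <= y + e) -> x <= y.
Proof. by move=> h; apply/ler_addgt0Pr. Qed.

(* At a maximum point of [F - e * id] other than [a], the left difference
   quotient of [F] would be at least [e]. *)
Lemma dini_le (F : R -> R) a b : a < b -> (forall t, a <= t <= b -> {for t, continuous F}) ->
  (forall t e, a < t <= b -> 0 < e ->
    exists2 d, 0 < d & forall h, 0 < h < d -> F t - F (t - h) <= e * h) ->
  F b <= F a.
Proof.
move=> ab cF hF; apply: le_of_small => e e0.
pose e' := e / (b - a).
have ba0 : 0 < b - a by rewrite subr_gt0.
have e'0 : 0 < e' by rewrite divr_gt0.
pose G t := F t - e' * t.
have cG : {within `[a, b], continuous G}.
  apply: within_cc => t tab; apply: cvgB; first exact: cF.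
  by apply: cvgMr; exact: cvg_id.
have [c cab hc] := EVT_max (ltW ab) cG.
have cab' : a <= c <= b by move: cab; rewrite in_itv.
have [ac|ca] := ltP a c.
  have e20 : 0 < e' / 2 by rewrite divr_gt0.
  have acb : a < c <= b by rewrite ac; case/andP: cab'.
  have [d d0 hd] := hF c (e' / 2) acb e20.
  pose h := Num.min (d / 2) (c - a).
  have h0 : 0 < h by rewrite lt_min divr_gt0//= subr_gt0.
  have hd' : 0 < h < d.
    by rewrite h0/= gt_min; apply/orP; left; rewrite ltr_pdivrMr//; lra.
  have hca : h <= c - a by rewrite ge_min lexx orbT.
  have := hd h hd'.
  have := hc (c - h); rewrite in_itv/= => /(_ _).
  have -> : a <= c - h <= b by apply/andP; split; lra.
  move=> /(_ isT); rewrite /G.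
  nra.
have cE : c = a by apply/eqP; rewrite eq_le ca; case/andP: cab'.
have := hc b; rewrite cE in_itv/= lexx (ltW ab) => /(_ isT); rewrite /G /e'.
have -> : e = e / (b - a) * (b - a) by rewrite divfK// gt_eqF.
rewrite mulfK ?gt_eqF//; nra.
Qed.

Lemma primitive g t0 : 0 < t0 -> (forall t, 0 < t -> {for t, continuous g}) ->
  exists G : R -> R, forall t, t0 <= t -> D1 G t (g t).
Proof.
move=> t00 cg; pose c := t0 / 2.
have c0 : 0 < c by rewrite divr_gt0.
exists (fun t => ID `[c, t] g) => t t0t.
have ct : c < t by apply: lt_le_trans t0t; rewrite /c; lra.
have tt1 : t < t + 1 by rewrite ltrDl.
have ig : itg `[c, (t + 1)] g by apply: itg_cpos => //; move=> x x0; exact: cg.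
have cgt : {for t, continuous g} by apply: cg; exact: lt_trans ct.
have [dG GE] := continuous_FTC1_closed tt1 ig ct cgt.
by apply: deq (derivableP dG) _; rewrite -derive1E.
Qed.

Lemma y_expN y : 0 <= y -> y * expR (- y) <= 1.
Proof.
move=> y0; rewrite expRN ler_pdivrMr ?expR_gt0// mul1r.
by apply: le_trans (expR_ge1Dx y); rewrite lerDr.
Qed.

Lemma y2_expN y : 0 <= y -> y ^+ 2 * expR (- y) <= 4.
Proof.
move=> y0; have y20 : 0 <= y / 2 by rewrite divr_ge0.
have h := y_expN y20.
have E : expR (- y) = expR (- (y / 2)) ^+ 2.
  by rewrite expr2 -expRD; congr expR; field.
have h0 : 0 <= y / 2 * expR (- (y / 2)) by rewrite mulr_ge0// expR_ge0.
have -> : y ^+ 2 * expR (- y) = 4 * (y / 2 * expR (- (y / 2))) ^+ 2.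
  by rewrite E; field.
have : (y / 2 * expR (- (y / 2))) ^+ 2 <= 1 by rewrite exprn_ile1.
lra.
Qed.

Variables (n0 : R -> R) (n : R -> R -> R).
Hypothesis sol : kompaneets_solution n0 n.

(* At a fixed time the flux condition is an ODE in [x] for [v = x^2 n], namely
   [v' + (1 - 4 / x) v + n^2 = flux]. *)
Lemma x2n_small t e : 0 < t -> 0 < e ->
  exists2 X, 1 < X & forall x, X <= x -> x ^+ 2 * n x t <= e.
Proof.
move=> t0 e0; have t0' := ltW t0.
have e3 : 0 < e / 3 by rewrite divr_gt0.
have := flux_lim sol t0 => /cvgrPdist_lt /(_ _ e3)[A [_ hA]].
(* For [x >= 8] the coefficient [1 - 4 / x] is at least 1/2, which suggests the integrating factor
   [expR (x / 2)]; [2 * (e / 3)] is the rest state of [v' + v / 2 = e / 3]. *)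
pose X0 := Num.max 8 (A + 1).
have X08 : 8 <= X0 by rewrite le_max lexx.
have X0A : A < X0 by rewrite lt_max ltrDl ltr01 orbT.
pose v x := x ^+ 2 * n x t.
pose w x := (v x - 2 * (e / 3)) * expR (x / 2).
have v0 x : 0 < x -> 0 <= v x by move=> x0; rewrite /v mulr_ge0 ?sqr_ge0 ?(n_ge0 sol).
have dw x : X0 <= x -> exists2 d, D1 w x d & d <= 0.
  move=> Xx; have x8 : 8 <= x by exact: le_trans Xx.
  have x0 : 0 < x by lra.
  have hJ : `|flux n x t| < e / 3.
    by have := hA x; rewrite sub0r normrN; apply; exact: lt_le_trans Xx.
  have J : flux n x t = x ^+ 2 * dx n x t + (x ^+ 2 - 2 * x) * n x t + n x t ^+ 2 by [].
  exists (expR (x / 2) * ((flux n x t - e / 3) - n x t * (x * (x / 2 - 4)) - n x t ^+ 2)).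
    rewrite /w /v J; apply: deq; first by repeat first [dstep|exact: (n_dx sol)].
    by rewrite /=; field.
  have nn := n_ge0 sol x0 t0'.
  move: hJ; rewrite ltr_norml => /andP[_ hJ].
  rewrite pmulr_rle0 ?expR_gt0//.
  have : 0 <= n x t * (x * (x / 2 - 4)) by rewrite !mulr_ge0//; lra.
  have : 0 <= n x t ^+ 2 by exact: sqr_ge0.
  lra.
have mono x : X0 <= x -> w x <= w X0.
  move=> Xx; pose dd y := sval (cid2 (dw (Num.max X0 y) ltac:(by rewrite le_max lexx))).
  have hdd y : X0 <= y -> D1 w y (dd y) /\ dd y <= 0.
    move=> Xy; rewrite /dd; case: cid2 => d /=; by rewrite max_r.
  have := @mono_of_derive_le R w dd 0 X0 x Xx.
  rewrite mul0r subr_le0; apply=> y /andP[Xy _]; by case: (hdd y Xy).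
have X00 : 0 < X0 by lra.
(* Beyond [X] the integrating factor, bounded below by [1 + (x - X0) / 2], has outgrown the starting
   value [v X0]. *)
pose X := X0 + 2 * (v X0 / (e / 3)).
have XX : X0 <= X by rewrite /X lerDl mulr_ge0// divr_ge0 ?v0// ltW.
exists X; first by lra.
move=> x Xx; have Xx' : X0 <= x by exact: le_trans Xx.
have x0 : 0 < x by lra.
have := mono x Xx'; rewrite /w -/(v x).
have EE : expR (x / 2) = expR (X0 / 2) * expR ((x - X0) / 2).
  by rewrite -expRD; congr expR; field.
rewrite EE mulrCA (mulrC (v X0 - _)) ler_pM2l ?expR_gt0// => h.
have h1 := expR_ge1Dx ((x - X0) / 2).
have vX0 := v0 _ X00.
have h2 : v X0 / (e / 3) <= (x - X0) / 2 by move: Xx; rewrite /X; lra.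
have h3 : v X0 <= e / 3 * expR ((x - X0) / 2).
  rewrite mulrC -ler_pdivrMr//; apply: le_trans h1; lra.
have E1 : 0 < expR ((x - X0) / 2) by exact: expR_gt0.
rewrite leNgt; apply/negP => hv.
have : (e - 2 * (e / 3)) * expR ((x - X0) / 2) < (v x - 2 * (e / 3)) * expR ((x - X0) / 2).
  by rewrite ltr_pM2r// ltrD2r.
lra.
Qed.

Lemma rho_out k x : 1 < k -> 0 < x -> ~ (k^-1 <= x <= k) -> rho k x = 1.
Proof.
move=> k1 x0 hx; have k0 : 0 < k by exact: lt_trans k1.
rewrite /rho min_l// ler_pdivlMr// mul1r.
have xV : 0 < x^-1 by rewrite invr_gt0.
have [h|h] := ltP k x; first by lra.
have [h'|h'] := leP k^-1 x; first by exfalso; apply: hx; rewrite h' h.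
have : k < x^-1 by rewrite -[k]invrK ltf_pV2 ?posrE ?invr_gt0.
lra.
Qed.

Lemma itg_rhow (w : R -> R) k : 0 < k -> itg H w -> (forall x, 0 < x -> 0 <= w x) ->
  itg H (fun x => rho k x * w x).
Proof.
move=> k0 iw w0; apply: (itg_le mH _ iw).
  by apply: measurable_funM; [exact: rho_meas|exact: itg_mfun].
move=> x /Hpos x0; rewrite ger0_norm ?mulr_ge0 ?rho_ge0 ?w0//.
by rewrite ler_piMl ?rho_le1 ?w0.
Qed.

(** Inside [[1 / k, k]] the cutoff misses at most [4 rho], and outside that interval [rho] equals
    1. *)
Lemma cut_approx_gen g (w : R -> R) k : 1 < k -> measurable_fun H g -> itg H w ->
  (forall x, 0 < x -> `|g x| <= w x) ->
  `|Jk k (fun x => psi k x * g x) - ID H g| <= 4 * ID H (fun x => rho k x * w x).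
Proof.
move=> k1 mg iw gw; have k0 : 0 < k by exact: lt_trans k1.
have w0 x : 0 < x -> 0 <= w x by move=> x0; exact: le_trans (gw x x0).
have irw := itg_rhow k0 iw w0.
have ig : itg H g by apply: (itg_le mH mg iw) => x /Hpos; exact: gw.
have mab : mR `[k^-1, k] by exact: measurable_itv.
have sub : `[k^-1, k]%classic `<=` H by apply: ccH; exact: kinv_gt0.
pose gg := (fun x => psi k x * g x) \_ `[k^-1, k].
have JE : Jk k (fun x => psi k x * g x) = ID H gg.
  by rewrite /Jk /ID /gg -Rintegral_mkcondr setIidr.
have iJ : itg `[k^-1, k] (fun x => psi k x * g x).
  apply: (@itg_le _ _ _ w) => //.
  - apply: measurable_funM; last by apply: measurable_funS mg => //; exact: mH.
    apply: measurable_funS (cpos_mfun (psi_cpos k0)) => //.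
    exact: mH.
  - by apply: itgS iw => //; exact: mH.
  - move=> x xk; have xk' : k^-1 <= x <= k by move: xk; rewrite /= in_itv.
    rewrite normrM; have /andP[p0 p1] := psi01 k1 xk'.
    rewrite ger0_norm//; apply: le_trans (gw _ (x_gt0 k1 xk')).
    by rewrite ler_piMl.
have igg : itg H gg.
  have h : mu.-integrable setT (EFin \o gg).
    by rewrite /gg -restrict_EFin; apply/(integrable_mkcond (mu := mu) _ mab).
  by apply: itgS h => //; exact: mH.
rewrite JE -IDB; [|exact: mH|by []..].
rewrite -IDZ; [|exact: mH|by []].
apply: IDabs_le; [exact: mH|by apply: itgB => //; exact: mH| |].
  by apply: itgZ; [exact: mH|].
move=> x /Hpos x0; rewrite /gg patchE.
have wx := w0 x x0; have r0 := rho_ge0 k0 x0.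
case: ifPn => [/set_mem /=|].
  rewrite in_itv/= => xk; have /andP[p0 p1] := psi01 k1 xk.
  have -> : psi k x * g x - g x = - ((1 - psi k x) * g x) by ring.
  rewrite normrN normrM ger0_norm ?subr_ge0// mulrA.
  apply: ler_pM => //; [by rewrite subr_ge0|exact: psi_rho|exact: gw].
move=> /negP hx; rewrite [X in `|X - _|](_ : _ = 0)// sub0r normrN.
rewrite (@rho_out k x) //; last first.
  by move=> h; apply: hx; apply/mem_set; rewrite /= in_itv.
have := gw _ x0; lra.
Qed.

Lemma cut_approx g C k t : 1 < k -> 0 <= t -> measurable_fun H g ->
  (forall x, 0 < x -> `|g x| <= C * n x t) ->
  `|Jk k (fun x => psi k x * g x) - ID H g| <= 4 * C * eps n k t.
Proof.
move=> k1 t0 mg gC; have k0 : 0 < k by exact: lt_trans k1.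
have iw := itgZ C mH (n_itg sol t0).
apply: (le_trans (cut_approx_gen k1 mg iw gC)).
rewrite (@IDeq _ _ _ (fun x => C * (rho k x * n x t))); last by move=> x _; ring.
by rewrite IDZ ?mulrA//; [exact: mH|exact: (itg_rhon sol)].
Qed.

(** The differential inequality holds only for the cutoff functionals [fk k]. It is integrated at a
    fixed [k], chosen by [eps_unif] so that all errors on [[s, t]] are small at once; this gives
    monotonicity of [f] without differentiating it. *)
Lemma limit_mono f (fk : R -> R -> R) A C s t : 0 < s -> s <= t -> 0 <= C ->
  (forall k tau, 1 < k -> s <= tau <= t -> `|fk k tau - f tau| <= C * eps n k tau) ->
  (forall k tau, 1 < k -> s <= tau <= t ->
    exists2 d, D1 (fk k) tau d & A - C * eps n k tau <= d) ->
  A * (t - s) <= f t - f s.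
Proof.
move=> s0 st C0 fkf dfk; apply: le_of_small => e e0.
(* The factor [2 + (t - s)] counts the two endpoint errors and the integrated one; [C + 1] keeps [L]
   positive when [C = 0]. *)
pose L := (C + 1) * (2 + (t - s)).
have L0 : 0 < L by rewrite /L; apply: mulr_gt0; lra.
have e'0 : 0 < e / L by rewrite divr_gt0.
have [k k1 hk] := eps_unif sol t e'0.
have hk' tau : s <= tau <= t -> 0 <= eps n k tau <= e / L.
  move=> /andP[h1 h2]; apply/andP; split.
    by apply: (eps_ge0 sol); [exact: lt_trans k1|apply: ltW; exact: lt_le_trans h1].
  by apply: hk => //; apply/andP; split=> //; apply: ltW; exact: lt_le_trans h1.
(* [mono_of_derive] wants the derivative as a function on the whole line; the value 0 outside
   [[s, t]] is a filler. *)
pose dd tau := if pselect (s <= tau <= t) is left h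
  then sval (cid2 (dfk k tau k1 h)) else 0.
have hdd tau : s <= tau <= t -> D1 (fk k) tau (dd tau) /\ A - C * (e / L) <= dd tau.
  move=> h; rewrite /dd; case: pselect => // h'; case: cid2 => d /= h1 h2; split=> //.
  apply: le_trans h2; rewrite lerD2l lerN2 ler_wpM2l//.
  by case/andP: (hk' _ h).
have := @mono_of_derive R (fk k) dd (A - C * (e / L)) s t st
  (fun x xst => (hdd x xst).1) (fun x xst => (hdd x xst).2).
have ss : s <= s <= t by rewrite lexx.
have tt : s <= t <= t by rewrite st lexx.
have a1 := fkf k s k1 ss; have a2 := fkf k t k1 tt.
have b1 : C * eps n k s <= C * (e / L) by rewrite ler_wpM2l//; case/andP: (hk' _ ss).
have b2 : C * eps n k t <= C * (e / L) by rewrite ler_wpM2l//; case/andP: (hk' _ tt).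
move: (le_trans a1 b1) (le_trans a2 b2); rewrite !ler_norml => /andP[u1 u2] /andP[u3 u4] h.
have E : C * (e / L) * (2 + (t - s)) <= e.
  have -> : C * (e / L) * (2 + (t - s)) = e * (C * (2 + (t - s)) / L) by ring.
  rewrite ler_piMr ?(ltW e0)// ler_pdivrMr// mul1r /L ler_wpM2r//; last by lra.
  by rewrite addr_ge0// subr_ge0.
lra.
Qed.

End Limits.

(** * The weights [exp (- K / x)], which see the inflow from infinity but not the outflow at 0 *)

Section ExponentialWeight.
Variable R : realType.
Local Notation mu := (@lebesgue_measure R).
Local Notation mR := (@measurable _ (measurableTypeR R)).
Local Notation H := (@halfline R).
Implicit Types (x y t s a b c d e k T h : R) (f g : R -> R).
Variables (n0 : R -> R) (n : R -> R -> R).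
Hypothesis sol : kompaneets_solution n0 n.

(** The weight is flat to infinite order at [x = 0], which kills the outflow, and tends to 1 at
    infinity, so that the inflow is counted in full. A large [K] pushes the observed region to [x]
    of order [K]. *)
Definition phk K x : R := expR (- (K / x)).
Definition phk1 K x : R := K / x ^+ 2 * phk K x.
Definition phk2 K x : R := ((K / x ^+ 2) ^+ 2 - 2 * K / x ^+ 3) * phk K x.

Lemma phk_d K x : 0 < x -> D1 (phk K) x (phk1 K x).
Proof.
move=> x0; have xn : x != 0 by rewrite gt_eqF.
rewrite /phk; apply: deq; first by repeat dstep.
by rewrite /phk1 /phk /=; field.
Qed.

Lemma phk1_d K x : 0 < x -> D1 (phk1 K) x (phk2 K x).
Proof.
move=> x0; have xn : x != 0 by rewrite gt_eqF.
rewrite /phk1; apply: deq; first by repeat first [dstep|exact: phk_d|by rewrite expf_neq0].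
by rewrite /phk2 /phk1 /=; field.
Qed.

Lemma phk2_cpos K : cpos (phk2 K).
Proof.
rewrite /phk2 /phk.
by repeat first [cstep | move=> x x0; rewrite ?expf_neq0 ?gt_eqF//].
Qed.
Lemma phk_cpos K : cpos (phk K).
Proof. by move=> x x0; apply: dcont; exact: phk_d. Qed.
Lemma phk1_cpos K : cpos (phk1 K).
Proof. by move=> x x0; apply: dcont; exact: phk1_d. Qed.

Lemma phk_ge0 K x : 0 <= phk K x.
Proof. exact: expR_ge0. Qed.

Lemma phk_le1 K x : 0 <= K -> 0 < x -> phk K x <= 1.
Proof. by move=> K0 x0; rewrite /phk expR_le1 oppr_le0 divr_ge0// ltW. Qed.

Lemma phk_onem K x : 1 - phk K x <= K / x.
Proof. by have := expR_ge1Dx (- (K / x)); rewrite /phk; lra. Qed.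

Lemma phk_lex K x : 1 <= K -> 0 < x -> phk K x <= x.
Proof.
move=> K1 x0; have K0 : 0 < K by lra.
have := @y_expN R (K / x) (divr_ge0 (ltW K0) (ltW x0)); rewrite -/(phk K x) => h.
have E : phk K x = (K / x * phk K x) * (x / K) by field; rewrite !gt_eqF.
have xK : 0 <= x / K by rewrite divr_ge0// ltW.
rewrite E; apply: (@le_trans _ _ (x / K)); first by rewrite ler_piMl.
by rewrite ler_pdivrMr// ler_peMr// ltW.
Qed.

Lemma phk_abs K x : 0 <= K -> 0 < x -> `|phk K x| <= 1.
Proof. by move=> K0 x0; rewrite ger0_norm ?phk_ge0// phk_le1. Qed.

Lemma phk1_abs K x : 0 <= K -> 0 < x -> `|x * phk1 K x| <= 1.
Proof.
move=> K0 x0; have xn : x != 0 by rewrite gt_eqF.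
have -> : x * phk1 K x = K / x * expR (- (K / x)) by rewrite /phk1 /phk; field.
have y0 : 0 <= K / x by rewrite divr_ge0// ltW.
by rewrite ger0_norm ?y_expN// mulr_ge0// expR_ge0.
Qed.

Lemma Lop_phk K t x : 0 < x -> Lop n (phk1 K) (phk2 K) t x =
  phk K x * ((K / x) ^+ 2 + 2 * (K / x) - K - K / x ^+ 2 * n x t).
Proof. by move=> x0; rewrite /Lop /phk2 /phk1; field; rewrite gt_eqF. Qed.

Definition Fk (n : R -> R -> R) k t : R := Jk k (gain n (fun=> 1) k t).

Lemma Fk_ge0 k t : 1 < k -> 0 <= t -> 0 <= Fk n k t.
Proof.
move=> k1 t0; apply: ID_ge0 => x /=; rewrite in_itv/= => kx.
have x0 := x_gt0 k1 kx; have k0 : 0 < k by exact: lt_trans k1.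
have /andP[p0 p1] := pc01 k1 kx; have /andP[q0 q1] := qc01 k1 kx.
have nn := n_ge0 sol x0 t0.
rewrite /gain mul1r; apply: mulr_ge0.
  by rewrite divr_ge0 ?(ltW k0)// !mulr_ge0// exprn_ge0.
by apply: mulr_ge0 => //; rewrite addr_ge0// sqr_ge0.
Qed.

(** Since [1 - phi <= K / x], replacing [phi] by 1 multiplies the gain weight by at most [K / x],
    and [(K / x) (2 / k) (x^2 + M)] is [2 K (x / k + M / (k x))], of size [rho]. Up to [eps], the
    inflow is thus the same for all these weights. *)
Lemma gain_cmp phi K M k t : 1 < k -> 0 < t -> 0 <= M -> 0 <= K -> cpos phi ->
  (forall x, 0 < x -> n x t <= M) ->
  (forall x, 0 < x -> 0 <= phi x <= 1) -> (forall x, 0 < x -> 1 - phi x <= K / x) ->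
  0 <= Jk k (gain n phi k t) /\
  0 <= Fk n k t - Jk k (gain n phi k t) <= 4 * K * (1 + M) * eps n k t.
Proof.
move=> k1 t0 M0 K0 cphi nM phi01 phiK; have k0 : 0 < k by exact: lt_trans k1.
have t0' := ltW t0.
have [_ cg] := cut_cpos sol k0 t0 cphi.
have [_ cg1] := cut_cpos sol k0 t0 (@cpos_cst R 1).
have aux x : k^-1 <= x <= k -> 0 <= 2 * pc k x ^+ 2 * qc k x / k <= 2 / k.
  move=> kx; have p01 := pc01 k1 kx; have q01 := qc01 k1 kx.
  have -> : 2 * pc k x ^+ 2 * qc k x / k = 2 / k * (pc k x ^+ 2 * qc k x) by ring.
  apply: mul01; first by rewrite divr_ge0// ltW.
  by apply: prod01 => //; exact: sqr01.
split.
  apply: ID_ge0 => x /=; rewrite in_itv/= => kx.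
  have x0 := x_gt0 k1 kx; have nn := n_ge0 sol x0 t0'.
  rewrite /gain; apply: mulr_ge0.
    by apply: mulr_ge0; [case/andP: (phi01 _ x0)|case/andP: (aux _ kx)].
  by apply: mulr_ge0 => //; rewrite addr_ge0// sqr_ge0.
rewrite /Fk /Jk -IDB; [|exact: measurable_itv|exact: itg_Jk|exact: itg_Jk].
have pt x : k^-1 <= x <= k ->
   0 <= gain n (fun=> 1) k t x - gain n phi k t x <= 4 * K * (1 + M) * (rho k x * n x t).
  move=> kx; have x0 := x_gt0 k1 kx; have nn := n_ge0 sol x0 t0'.
  have /andP[f0 f1] := phi01 _ x0; have fK := phiK _ x0.
  have /andP[u0 u1] := aux _ kx.
  have -> : gain n (fun=> 1) k t x - gain n phi k t x =
    ((1 - phi x) * (2 * pc k x ^+ 2 * qc k x / k) * (x ^+ 2 + n x t)) * n x t.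
    by rewrite /gain; ring.
  have xn0 : 0 <= x ^+ 2 + n x t by rewrite addr_ge0// sqr_ge0.
  have g0 : 0 <= (1 - phi x) * (2 * pc k x ^+ 2 * qc k x / k).
    by rewrite mulr_ge0// subr_ge0.
  rewrite (mulr_ge0 (mulr_ge0 g0 xn0) nn) /=.
  have -> : 4 * K * (1 + M) * (rho k x * n x t) = (4 * K * (1 + M) * rho k x) * n x t by ring.
  rewrite ler_wpM2r//.
  have g1 : (1 - phi x) * (2 * pc k x ^+ 2 * qc k x / k) <= K / x * (2 / k).
    by apply: ler_pM => //; rewrite subr_ge0.
  have al := al01 k1 kx; have be := be01 k1 kx; have ab := albe_rho k1 kx.
  have s2 : x ^+ 2 + n x t <= x ^+ 2 + M by rewrite lerD2l nM.
  have := ler_pM g0 xn0 g1 s2.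
  have -> : K / x * (2 / k) * (x ^+ 2 + M) = 2 * K * (x / k + M * (k * x)^-1).
    by field; rewrite !gt_eqF.
  move=> h; apply: (le_trans h).
  have -> : 4 * K * (1 + M) * rho k x = 2 * K * ((1 + M) * (2 * rho k x)) by ring.
  rewrite ler_wpM2l ?mulr_ge0//.
  have := ler_wpM2l (addr_ge0 ler01 M0) ab.
  apply: le_trans.
  case/andP: al => al0 _; case/andP: be => be0 _.
  have : 0 <= M * (x / k) by rewrite mulr_ge0.
  lra.
have cd : cpos (fun x => gain n (fun=> 1) k t x - gain n phi k t x).
  by apply: cposD => //; exact: cposN.
apply/andP; split.
  by apply: ID_ge0 => x /=; rewrite in_itv/= => /pt /andP[].
apply: le_trans (ler_norm _) _; apply: (Jk_eps sol) => //.
  by rewrite !mulr_ge0// addr_ge0.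
by move=> x /pt /andP[h1 h2]; rewrite ger0_norm.
Qed.

(** The factor [x] gained from [phi] turns the singular weight [(k x^2)^-1] into [(k x)^-1], which
    is at most [2 rho]. *)
Lemma loss_small phi M k t : 1 < k -> 0 < t -> 0 <= M -> cpos phi ->
  (forall x, 0 < x -> n x t <= M) ->
  (forall x, 0 < x -> 0 <= phi x <= x) ->
  0 <= Jk k (loss n phi k t) <= 4 * M * eps n k t.
Proof.
move=> k1 t0 M0 cphi nM phi0; have k0 : 0 < k by exact: lt_trans k1.
have t0' := ltW t0.
have [cl _] := cut_cpos sol k0 t0 cphi.
have pt x : k^-1 <= x <= k -> 0 <= loss n phi k t x <= 4 * M * (rho k x * n x t).
  move=> kx; have x0 := x_gt0 k1 kx; have nn := n_ge0 sol x0 t0'.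
  have /andP[f0 f1] := phi0 _ x0.
  have p01 := pc01 k1 kx; have q01 := qc01 k1 kx.
  have al := al01 k1 kx; have be := be01 k1 kx; have ab := albe_rho k1 kx.
  have E : loss n phi k t x =
     (2 * (pc k x * qc k x ^+ 2)) * (phi x * (k * x ^+ 2)^-1) * (n x t * n x t).
    by rewrite /loss; field; rewrite !gt_eqF.
  have u : 0 <= pc k x * qc k x ^+ 2 <= 1.
    by apply: prod01 => //; exact: sqr01.
  have v0 : 0 <= phi x * (k * x ^+ 2)^-1.
    by rewrite mulr_ge0// invr_ge0 mulr_ge0 ?sqr_ge0// ltW.
  have v1 : phi x * (k * x ^+ 2)^-1 <= (k * x)^-1.
    have -> : (k * x)^-1 = x * (k * x ^+ 2)^-1 by field; rewrite !gt_eqF.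
    by rewrite ler_wpM2r// invr_ge0 mulr_ge0 ?sqr_ge0// ltW.
  have w1 : n x t * n x t <= M * n x t by rewrite ler_wpM2r// nM.
  have w0 : 0 <= n x t * n x t by rewrite mulr_ge0.
  have z0 : 0 <= 2 * (pc k x * qc k x ^+ 2) by lra.
  have z1 : 2 * (pc k x * qc k x ^+ 2) <= 2 by lra.
  rewrite E; apply/andP; split; first exact: (mulr_ge0 (mulr_ge0 z0 v0) w0).
  have a0 := ler_pM z0 v0 z1 v1.
  have a1 := ler_pM (mulr_ge0 z0 v0) w0 a0 w1.
  apply: (le_trans a1).
  have -> : 4 * M * (rho k x * n x t) = 2 * (2 * rho k x) * (M * n x t) by ring.
  rewrite ler_wpM2r ?mulr_ge0//; lra.
apply/andP; split.
  by apply: ID_ge0 => x /=; rewrite in_itv/= => /pt /andP[].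
apply: le_trans (ler_norm _) _; apply: (Jk_eps sol) => //.
  by rewrite !mulr_ge0.
by move=> x /pt /andP[h1 h2]; rewrite ger0_norm.
Qed.

Definition Pk (n : R -> R -> R) k K t : R := Jk k (fun x => phk K x * psi k x * n x t).
Definition Ph (n : R -> R -> R) K t : R := ID H (fun x => phk K x * n x t).

Lemma Pk_Ph k K t : 1 < k -> 0 <= K -> 0 <= t -> `|Pk n k K t - Ph n K t| <= 4 * eps n k t.
Proof.
move=> k1 K0 t0.
have -> : Pk n k K t = Jk k (fun x => psi k x * (phk K x * n x t)).
  by apply: IDeq => x _; ring.
rewrite -[X in X * eps _ _ _]mulr1.
apply: (cut_approx sol) => //.
  by apply: measurable_funM; [apply: cpos_mfun; exact: phk_cpos|exact: (n_mfun sol)].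
move=> x x0; rewrite normrM (ger0_norm (n_ge0 sol x0 t0)) ler_wpM2r ?(n_ge0 sol)//.
exact: phk_abs.
Qed.

Lemma Pk_le_Ph k K t : 1 < k -> 0 <= K -> 0 < t -> Pk n k K t <= Ph n K t.
Proof.
move=> k1 K0 t0; have k0 : 0 < k by exact: lt_trans k1.
have t0' := ltW t0.
have cn := n_cpos sol t0; have cp := psi_cpos k0; have cf := @phk_cpos K.
apply: ID_cc_le; first exact: kinv_gt0.
- by apply: itg_Jk => //; repeat first [cstep|assumption].
- apply: (itg_bn sol (C := 1)) => //; first by apply: cpos_mfun.
  by move=> x x0; exact: phk_abs.
- by move=> x x0; rewrite mulr_ge0 ?phk_ge0 ?(n_ge0 sol).
- move=> x kx; have x0 := x_gt0 k1 kx.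
  rewrite ler_wpM2r ?(n_ge0 sol)//; rewrite ler_piMr ?phk_ge0//.
  by case/andP: (psi01 k1 kx).
Qed.

(** By [Lop_phk] the only nonlinear term of the drift is [- (K / x^2) n]. Once [n <= M <= K] the
    square [(K / x)^2] absorbs it, and what is left is at least [- K]. *)
Lemma Pk_der k K M t : 1 < k -> 0 < t -> 0 <= M -> 1 <= K -> M <= K ->
  (forall x, 0 < x -> n x t <= M) ->
  exists2 d, D1 (Pk n k K) t d &
    - K * Pk n k K t + Fk n k t - (54 + 4 * M + 4 * K * (1 + M)) * eps n k t <= d.
Proof.
move=> k1 t0 M0 K1 MK nM; have k0 : 0 < k by exact: lt_trans k1.
have K0 : 0 <= K by lra.
have t0' := ltW t0.
have cn := n_cpos sol t0; have cp := psi_cpos k0; have cf := @phk_cpos K.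
have [e he hd] := weak_form sol k1 t0 (@phk_d K) (@phk1_d K) (@phk2_cpos K) (@ler01 R)
  (fun x => @phk_abs K x K0) (fun x => @phk1_abs K x K0).
exists (Jk k (fun x => psi k x * Lop n (phk1 K) (phk2 K) t x * n x t) -
        Jk k (loss n (phk K) k t) + Jk k (gain n (phk K) k t) + e) => //.
have [_ /andP[_ g1]] := gain_cmp (phi := phk K) k1 t0 M0 K0 cf nM
   (fun x px => ltac:(by rewrite phk_ge0 phk_le1)) (fun x _ => @phk_onem K x).
have /andP[_ l1] := loss_small (phi := phk K) k1 t0 M0 cf nM
   (fun x px => ltac:(by rewrite phk_ge0 phk_lex)).
have cL := Lop_cpos sol t0 (@phk1_cpos K) (@phk2_cpos K).
have L1 : - K * Pk n k K t <= Jk k (fun x => psi k x * Lop n (phk1 K) (phk2 K) t x * n x t).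
  rewrite /Pk /Jk -IDZ; [|exact: measurable_itv|by apply: itg_Jk => //; repeat first [cstep|assumption]].
  apply: IDle; [exact: measurable_itv| | |].
  - by apply: itg_Jk => //; repeat first [cstep|assumption].
  - by apply: itg_Jk => //; repeat first [cstep|assumption].
  move=> x /=; rewrite in_itv/= => kx.
  have x0 := x_gt0 k1 kx; have nn := n_ge0 sol x0 t0'.
  rewrite Lop_phk//.
  have -> : - K * (phk K x * psi k x * n x t) = (psi k x * (phk K x * (- K))) * n x t by ring.
  rewrite ler_wpM2r// ler_wpM2l//; first by case/andP: (psi01 k1 kx).
  rewrite ler_wpM2l ?phk_ge0//.
  have y0 : 0 <= K / x by rewrite divr_ge0// ltW.
  have -> : K / x ^+ 2 * n x t = (K / x) * (n x t / x) by field; rewrite gt_eqF.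
  have : (K / x) * (n x t / x) <= (K / x) * (K / x).
    rewrite ler_wpM2l// ler_wpM2r ?invr_ge0 ?(ltW x0)//.
    by apply: le_trans (nM _ x0) MK.
  lra.
move: he; rewrite ler_norml mulr1 => /andP[he _].
lra.
Qed.

Definition gB (n : R -> R -> R) t : R := ID H (fun x => Lop n (phk1 1) (phk2 1) t x * n x t).

Lemma phk_y x : 0 < x -> phk 1 x * (1 / x) <= 1 /\ phk 1 x * (1 / x) ^+ 2 <= 4.
Proof.
move=> x0; have y0 : 0 <= 1 / x by rewrite divr_ge0// ltW.
by rewrite /phk mulrC y_expN// mulrC y2_expN.
Qed.

Lemma phk_A x : 0 < x -> `|phk 1 x * ((1 / x) ^+ 2 + 2 * (1 / x) - 1)| <= 7.
Proof.
move=> x0; have [h1 h2] := phk_y x0.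
have y0 : 0 <= 1 / x by rewrite divr_ge0// ltW.
have p0 := phk_ge0 1 x; have p1 := phk_le1 ler01 x0.
have q0 : 0 <= phk 1 x * (1 / x) by rewrite mulr_ge0.
have r0 : 0 <= phk 1 x * (1 / x) ^+ 2 by rewrite mulr_ge0// sqr_ge0.
rewrite mulrBr mulrDr mulr1 ler_norml; lra.
Qed.

Lemma Lop1_abs M t x : 0 < x -> 0 <= t -> n x t <= M -> `|Lop n (phk1 1) (phk2 1) t x| <= 7 + 4 * M.
Proof.
move=> x0 t0 nM; have nn := n_ge0 sol x0 t0.
rewrite Lop_phk//.
have -> : phk 1 x * ((1 / x) ^+ 2 + 2 * (1 / x) - 1 - 1 / x ^+ 2 * n x t) =
  phk 1 x * ((1 / x) ^+ 2 + 2 * (1 / x) - 1) - phk 1 x * (1 / x) ^+ 2 * n x t.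
  by field; rewrite gt_eqF.
apply: (le_trans (ler_normB _ _)); apply: lerD; first exact: phk_A.
have [_ h2] := phk_y x0.
have r0 : 0 <= phk 1 x * (1 / x) ^+ 2 by rewrite mulr_ge0 ?phk_ge0// sqr_ge0.
by rewrite (ger0_norm (mulr_ge0 r0 nn)); exact: ler_pM.
Qed.

(** For [K = 1] the drift is bounded, hence equals [gB] up to [eps] from both sides. As [gB] does
    not involve [k] and is continuous in time, subtracting a primitive of it leaves the inflow
    alone. *)
Lemma Pk1_der k M t : 1 < k -> 0 < t -> 0 <= M ->
  (forall x, 0 < x -> n x t <= M) ->
  exists2 d, D1 (Pk n k 1) t d &
    `|d - (gB n t + Fk n k t)| <= (86 + 24 * M) * eps n k t.
Proof.
move=> k1 t0 M0 nM; have k0 : 0 < k by exact: lt_trans k1.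
have K0 : (0 : R) <= 1 by [].
have t0' := ltW t0.
have cn := n_cpos sol t0; have cp := psi_cpos k0; have cf := @phk_cpos 1.
have [e he hd] := weak_form sol k1 t0 (@phk_d 1) (@phk1_d 1) (@phk2_cpos 1) (@ler01 R)
  (fun x => @phk_abs 1 x K0) (fun x => @phk1_abs 1 x K0).
exists (Jk k (fun x => psi k x * Lop n (phk1 1) (phk2 1) t x * n x t) -
        Jk k (loss n (phk 1) k t) + Jk k (gain n (phk 1) k t) + e) => //.
have [_ /andP[g0 g1]] := gain_cmp (phi := phk 1) k1 t0 M0 K0 cf nM
   (fun x px => ltac:(by rewrite phk_ge0 phk_le1)) (fun x _ => @phk_onem 1 x).
have /andP[l0 l1] := loss_small (phi := phk 1) k1 t0 M0 cf nM
   (fun x px => ltac:(by rewrite phk_ge0 phk_lex)).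
have cL := Lop_cpos sol t0 (@phk1_cpos 1) (@phk2_cpos 1).
have L1 : `|Jk k (fun x => psi k x * Lop n (phk1 1) (phk2 1) t x * n x t) - gB n t| <=
    4 * (7 + 4 * M) * eps n k t.
  have -> : Jk k (fun x => psi k x * Lop n (phk1 1) (phk2 1) t x * n x t) =
     Jk k (fun x => psi k x * (Lop n (phk1 1) (phk2 1) t x * n x t)).
    by apply: IDeq => x _; ring.
  apply: (cut_approx sol) => //.
    by apply: cpos_mfun; repeat first [cstep|assumption].
  move=> x x0; rewrite normrM (ger0_norm (n_ge0 sol x0 t0')) ler_wpM2r ?(n_ge0 sol)//.
  by apply: Lop1_abs => //; exact: nM.
have e0 := eps_ge0 sol k0 t0'.
move: he L1; rewrite !ler_norml => /andP[he he'] /andP[L1 L2].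
by apply/andP; split; lra.
Qed.

Lemma gB_cont t : 0 < t -> {for t, continuous (gB n)}.
Proof.
move=> t0; have t0' := ltW t0.
have [M M0 nM] := n_bounded sol (2 * t).
have C0 : 0 < 7 + 8 * M by lra.
apply/cvgrPdist_lt => e e0.
have e1 : 0 < e / (7 + 8 * M) by rewrite divr_gt0.
have [d d0 hd] := L1d_cont sol t0' e1.
have itL s : 0 < s -> s <= 2 * t -> itg H (fun x => Lop n (phk1 1) (phk2 1) s x * n x s).
  move=> s0 s1; apply: (itg_bn sol (C := 7 + 4 * M)); first exact: ltW.
    by apply: cpos_mfun; apply: (Lop_cpos sol) => //; [exact: phk1_cpos|exact: phk2_cpos].
  by move=> x x0; apply: Lop1_abs => //; [exact: ltW|apply: nM => //; rewrite s1 ltW].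
near=> s.
have sdt : `|s - t| < Num.min d t.
  near: s; have dt0 : 0 < Num.min d t by rewrite lt_min d0 t0.
  by have := @nbhsx_ballx R R t _ dt0; apply: filterS => s; rewrite /ball/= distrC.
move: (sdt); rewrite lt_min ltr_norml => /andP[_].
rewrite ltr_norml => /andP[s1 s2'].
have s0 : 0 < s by lra.
have s2 : s <= 2 * t by lra.
have sd : `|s - t| < d by move: sdt; rewrite lt_min => /andP[].
have s0' := ltW s0.
rewrite distrC /gB -IDB; [|exact: mH|exact: itL|by apply: itL => //; lra].
apply: (@le_lt_trans _ _ ((7 + 8 * M) * L1d n s t)); last first.
  by rewrite mulrC -ltr_pdivlMr//; exact: hd.
rewrite /L1d -IDZ; [|exact: mH|exact: (itg_absd sol)].
apply: IDabs_le; [exact: mH|..].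
- apply: itgB; [exact: mH|exact: itL|by apply: itL => //; lra].
- by apply: itgZ; [exact: mH|exact: (itg_absd sol)].
move=> x /Hpos x0.
rewrite !Lop_phk//.
have -> : phk 1 x * ((1 / x) ^+ 2 + 2 * (1 / x) - 1 - 1 / x ^+ 2 * n x s) * n x s -
   phk 1 x * ((1 / x) ^+ 2 + 2 * (1 / x) - 1 - 1 / x ^+ 2 * n x t) * n x t =
   (phk 1 x * ((1 / x) ^+ 2 + 2 * (1 / x) - 1)
    - (phk 1 x * (1 / x) ^+ 2) * (n x s + n x t)) * (n x s - n x t).
  by field; rewrite gt_eqF.
rewrite normrM ler_wpM2r//.
have [_ h2] := phk_y x0.
have r0 : 0 <= phk 1 x * (1 / x) ^+ 2 by rewrite mulr_ge0 ?phk_ge0// sqr_ge0.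
have ns := n_ge0 sol x0 s0'; have nt := n_ge0 sol x0 t0'.
apply: (le_trans (ler_normB _ _)); apply: lerD; first exact: phk_A.
rewrite ger0_norm; last by rewrite mulr_ge0// addr_ge0.
have -> : 8 * M = 4 * (M + M) by ring.
apply: ler_pM => //; first by rewrite addr_ge0.
by apply: lerD; apply: nM => //; rewrite ?s0' ?t0'//=; lra.
Unshelve. all: by end_near. Qed.

End ExponentialWeight.

(** * No photons enter from infinity *)

Section NoInflux.
Variable R : realType.
Local Notation mu := (@lebesgue_measure R).
Local Notation mR := (@measurable _ (measurableTypeR R)).
Local Notation H := (@halfline R).
Implicit Types (x y t s a b c d e k T h tau : R) (f g : R -> R).
Variables (n0 : R -> R) (n : R -> R -> R).
Hypothesis sol : kompaneets_solution n0 n.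

Lemma mass_ge0 t : 0 <= t -> 0 <= mass n t.
Proof. by move=> t0; apply: ID_ge0 => x /Hpos x0; exact: (n_ge0 sol). Qed.

(** For [x < X] the exponential gives [K phk <= 4 X^2 / K]. For [x >= X] one has
    [K phk n = phk1 (x^2 n)], where [x^2 n] is small and [phk1], the derivative of [phk], has
    integral at most 1. This is where the decay of [x^2 n] enters. *)
Lemma kPh_small t e : 0 < t -> 0 < e ->
  exists2 K0, 0 < K0 & forall K, K0 <= K -> K * Ph n K t <= e.
Proof.
move=> t0 e0; have t0' := ltW t0.
have e4 : 0 < e / 4 by rewrite divr_gt0.
have [X X1 hX] := x2n_small sol t0 e4.
have m0 := mass_ge0 t0'.
have X0 : 0 < X by lra.
have Q0 : 0 <= 16 * X ^+ 2 * mass n t / e.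
  apply: divr_ge0; last exact: ltW.
  by apply: mulr_ge0 => //; apply: mulr_ge0 => //; exact: sqr_ge0.
exists (1 + 16 * X ^+ 2 * mass n t / e); first by rewrite ltr_wpDr.
move=> K hK.
have K1 : 1 <= K.
  by apply: le_trans hK; rewrite lerDl.
have K0 : 0 < K by lra.
have e8 : 0 < e / (8 * K) by rewrite divr_gt0// mulr_gt0.
have [k k1 hk] := eps_pt sol t0' e8.
have k0 : 0 < k by exact: lt_trans k1.
have h1 := Pk_Ph sol k1 (ltW K0) t0'.
have cn := n_cpos sol t0; have cp := psi_cpos k0; have cf := @phk_cpos R K.
have cf1 := @phk1_cpos R K.
have iA : itg `[k^-1, k] (fun x => phk K x * psi k x * n x t).
  by apply: itg_Jk => //; repeat first [cstep|assumption].
have iB : itg `[k^-1, k] (fun x => 4 * X ^+ 2 / K * n x t).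
  by apply: itg_Jk => //; repeat first [cstep|assumption].
have iC : itg `[k^-1, k] (fun x => e / 4 * phk1 K x).
  by apply: itg_Jk => //; repeat first [cstep|assumption].
have mab : mR `[k^-1, k] by exact: measurable_itv.
have h2 : K * Pk n k K t <= 4 * X ^+ 2 / K * mass n t + e / 4.
  rewrite /Pk /Jk -IDZ//.
  apply: (@le_trans _ _ (ID `[k^-1, k] (fun x => 4 * X ^+ 2 / K * n x t + e / 4 * phk1 K x))).
    apply: IDle => //; [exact: itgZ|exact: itgD|].
    move=> x /=; rewrite in_itv/= => kx.
    have x0 := x_gt0 k1 kx; have nn := n_ge0 sol x0 t0'.
    have /andP[p0 p1] := psi01 k1 kx; have f0 := phk_ge0 K x.
    have : K * (phk K x * psi k x * n x t) <= K * (phk K x * n x t).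
      by rewrite ler_wpM2l ?(ltW K0)// ler_wpM2r// ler_piMr.
    move=> h; apply: (le_trans h).
    have B0 : 0 <= 4 * X ^+ 2 / K * n x t.
      by rewrite mulr_ge0// divr_ge0 ?(ltW K0)// mulr_ge0// sqr_ge0.
    have C0 : 0 <= e / 4 * phk1 K x.
      by rewrite mulr_ge0 ?(ltW e4)// /phk1 mulr_ge0// divr_ge0 ?sqr_ge0// ltW.
    have [xX|Xx] := ltP x X.
      suff : K * phk K x <= 4 * X ^+ 2 / K.
        by move=> h'; have := ler_wpM2r nn h'; lra.
      have a1 : phk K x <= expR (- (K / X)).
        rewrite /phk ler_expR lerN2 ler_wpM2l ?(ltW K0)//.
        by rewrite lef_pV2 ?posrE// ltW.
      have a2 := @y2_expN R (K / X) (divr_ge0 (ltW K0) (ltW X0)).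
      apply: (@le_trans _ _ (K * expR (- (K / X)))); first by rewrite ler_wpM2l// ltW.
      have -> : K * expR (- (K / X)) = X ^+ 2 / K * ((K / X) ^+ 2 * expR (- (K / X))).
        by field; rewrite !gt_eqF.
      have -> : 4 * X ^+ 2 / K = X ^+ 2 / K * 4 by ring.
      by rewrite ler_wpM2l// divr_ge0 ?sqr_ge0// ltW.
    have -> : K * (phk K x * n x t) = phk1 K x * (x ^+ 2 * n x t).
      by rewrite /phk1; field; rewrite gt_eqF.
    have q0 : 0 <= phk1 K x by rewrite /phk1 mulr_ge0// divr_ge0 ?sqr_ge0// ltW.
    have := ler_wpM2l q0 (hX x Xx); lra.
  rewrite IDD//; apply: lerD.
    rewrite /mass -IDZ; [|exact: mH|exact: (n_itg sol)].
    apply: ID_cc_le => //; first exact: kinv_gt0.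
      by apply: itgZ; [exact: mH|exact: (n_itg sol)].
    move=> x x0; apply: mulr_ge0; last exact: (n_ge0 sol).
    by rewrite divr_ge0 ?(ltW K0)// mulr_ge0// sqr_ge0.
  rewrite IDZ//; last by apply: itg_Jk.
  rewrite (@FTC _ (phk1 K) (phk K)) ?kinv_gt0//; last 2 first.
  - exact: ltW (kinv_lt k1).
  - by move=> x; exact: phk_d.
  rewrite -[X in _ <= X]mulr1 ler_wpM2l ?(ltW e4)//.
  have := @phk_le1 R K k (ltW K0) k0; have := phk_ge0 K k^-1; lra.
have h3 : 4 * X ^+ 2 / K * mass n t <= e / 4.
  have -> : 4 * X ^+ 2 / K * mass n t = (16 * X ^+ 2 * mass n t / e) / K * (e / 4).
    by field; rewrite !gt_eqF.
  rewrite ler_piMl ?(ltW e4)// ler_pdivrMr// mul1r; apply: le_trans hK.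
  by rewrite lerDr.
have h4 : K * Ph n K t - K * Pk n k K t <= e / 2.
  rewrite -mulrBr.
  move: h1; rewrite ler_norml => /andP[h1 _].
  apply: (@le_trans _ _ (K * (4 * (e / (8 * K))))).
    by rewrite ler_wpM2l ?(ltW K0)//; lra.
  by have -> : K * (4 * (e / (8 * K))) = e / 2 by field; rewrite !gt_eqF.
lra.
Qed.

Lemma Ph_ge0 K t : 0 <= t -> 0 <= Ph n K t.
Proof. by move=> t0; apply: ID_ge0 => x /Hpos x0; rewrite mulr_ge0 ?phk_ge0 ?(n_ge0 sol). Qed.

(** A Gronwall inequality backwards in time: the inflow is nonnegative and the drift is at least
    [- K], so [expR (K * tau) * Ph n K tau] is nondecreasing in the limit. *)
Lemma Ph_exp K M s t : 0 < s -> s <= t -> 0 <= M -> 1 <= K -> M <= K ->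
  (forall x tau, 0 < x -> s <= tau <= t -> n x tau <= M) ->
  Ph n K s <= expR (K * (t - s)) * Ph n K t.
Proof.
move=> s0 st M0 K1 MK nM; have K0 : 0 <= K by lra.
pose c := 54 + 4 * M + 4 * K * (1 + M).
have c0 : 0 <= c.
  by rewrite /c addr_ge0 ?addr_ge0// ?mulr_ge0// addr_ge0.
pose C := expR (K * t) * (4 + c).
have C0 : 0 <= C by apply: mulr_ge0; [exact: expR_ge0|exact: addr_ge0].
have le_exp tau : s <= tau <= t -> expR (K * tau) <= expR (K * t).
  by move=> /andP[_ h]; rewrite ler_expR ler_wpM2l.
have := @limit_mono R n0 n sol (fun tau => expR (K * tau) * Ph n K tau)
  (fun k tau => expR (K * tau) * Pk n k K tau) 0 C s t s0 st C0.
rewrite mul0r => hl.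
have : 0 <= expR (K * t) * Ph n K t - expR (K * s) * Ph n K s.
  apply: hl.
  - move=> k tau k1 stau; have tau0 : 0 < tau by apply: lt_le_trans s0 _; case/andP: stau.
    have e0 := eps_ge0 sol (lt_trans ltr01 k1) (ltW tau0).
    rewrite -mulrBr normrM ger0_norm ?expR_ge0//.
    have h := Pk_Ph sol k1 K0 (ltW tau0).
    apply: (@le_trans _ _ (expR (K * t) * (4 * eps n k tau))).
      by apply: ler_pM; [exact: expR_ge0|exact: normr_ge0|exact: le_exp|].
    rewrite /C -mulrA ler_wpM2l ?expR_ge0// ler_wpM2r// lerDl//.
  - move=> k tau k1 stau; have tau0 : 0 < tau by apply: lt_le_trans s0 _; case/andP: stau.
    have e0 := eps_ge0 sol (lt_trans ltr01 k1) (ltW tau0).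
    have [d hd dge] := Pk_der sol k1 tau0 M0 K1 MK (fun x px => nM x tau px stau).
    exists (expR (K * tau) * d + Pk n k K tau * (expR (K * tau) * K)).
      apply: deq; first by repeat first [dstep|exact: hd].
      by rewrite /=; ring.
    have F0 := Fk_ge0 sol k1 (ltW tau0).
    have -> : expR (K * tau) * d + Pk n k K tau * (expR (K * tau) * K) =
       expR (K * tau) * (d + K * Pk n k K tau) by ring.
    have h1 : - c * eps n k tau <= d + K * Pk n k K tau by move: dge; rewrite -/c; lra.
    apply: (@le_trans _ _ (expR (K * tau) * (- c * eps n k tau))); last first.
      by rewrite ler_wpM2l// expR_ge0.
    have h2 : expR (K * tau) * (c * eps n k tau) <= expR (K * t) * (c * eps n k tau).
      by rewrite ler_wpM2r ?mulr_ge0//; exact: le_exp.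
    have h3 : 0 <= expR (K * t) * (4 * eps n k tau) by rewrite mulr_ge0 ?expR_ge0// mulr_ge0.
    rewrite /C; lra.
rewrite subr_ge0 => h.
have -> : expR (K * (t - s)) = expR (- (K * s)) * expR (K * t).
  by rewrite -expRD; congr expR; ring.
rewrite -mulrA -(@ler_pM2l _ (expR (K * s))) ?expR_gt0//.
by rewrite [X in _ <= X]mulrA expRxMexpNx_1 mul1r.
Qed.

(* [B = Ph 1 - G] measures the mass that has entered from infinity. It is
   nondecreasing, and [x^2 n -> 0] at time [t] forces its left derivative at
   [t] to vanish, whence it is constant. *)
Lemma no_influx t0 T : 0 < t0 -> t0 < T ->
  exists r : R -> R -> R, exists2 C, 0 <= C &
  (forall k t, 1 < k -> t0 <= t <= T -> exists2 d, D1 (r k) t d &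
     `|d - Fk n k t| <= C * eps n k t) /\
  (forall k t, 1 < k -> t0 <= t <= T -> `|r k t| <= 4 * eps n k t).
Proof.
move=> t00 t0T.
have T0 : 0 < T by lra.
have [M M0' nM] := n_bounded sol T; have M0 := ltW M0'.
have t020 : 0 < t0 / 2 by rewrite divr_gt0.
have [G dG] := primitive t020 (gB_cont sol).
pose B t := Ph n 1 t - G t.
pose r k t := Pk n k 1 t - G t.
pose c1 := 86 + 24 * M.
have c10 : 0 <= c1 by rewrite addr_ge0 ?mulr_ge0.
have dr k t : 1 < k -> t0 / 2 <= t <= T -> exists2 d, D1 (r k) t d &
     `|d - Fk n k t| <= c1 * eps n k t.
  move=> k1 /andP[t1 t2]; have tp : 0 < t by exact: lt_le_trans t1.
  have nMt x : 0 < x -> n x t <= M by move=> x0; apply: nM => //; rewrite t2 ltW.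
  have [d hd hde] := Pk1_der sol k1 tp M0 nMt.
  exists (d - gB n t).
    by apply: dadd => //; apply: dopp; exact: dG.
  by move: hde; rewrite opprD addrA.
have rB k t : 1 < k -> t0 / 2 <= t -> `|r k t - B t| <= 4 * eps n k t.
  move=> k1 t1; have tp : 0 < t by exact: lt_le_trans t1.
  have -> : r k t - B t = Pk n k 1 t - Ph n 1 t by rewrite /r /B; ring.
  by apply: (Pk_Ph sol) => //; exact: ltW.
have Bmono s t : t0 / 2 <= s -> s <= t -> t <= T -> B s <= B t.
  move=> s1 st tT; have s0 : 0 < s by exact: lt_le_trans s1.
  have C0 : 0 <= 4 + c1 by rewrite addr_ge0.
  rewrite -subr_ge0 -(mul0r (t - s)); apply: (limit_mono sol (fk := r) s0 st C0).
  - move=> k tau k1 /andP[h1 h2].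
    have e0 := eps_ge0 sol (lt_trans ltr01 k1) (ltW (lt_le_trans s0 h1)).
    apply: (le_trans (rB k tau k1 (le_trans s1 h1))).
    by rewrite ler_wpM2r// lerDl.
  - move=> k tau k1 /andP[h1 h2].
    have tau0 : 0 < tau by exact: lt_le_trans h1.
    have e0 := eps_ge0 sol (lt_trans ltr01 k1) (ltW tau0).
    have F0 := Fk_ge0 sol k1 (ltW tau0).
    have tI : t0 / 2 <= tau <= T by rewrite (le_trans s1 h1) (le_trans h2 tT).
    have [d hd] := dr k tau k1 tI.
    rewrite ler_norml => /andP[hd1 _]; exists d => //; lra.
(* In the difference [Pk - r] the inflow cancels, so its derivative is at least [- K Ph n K tau] up
   to [eps]. By [Ph_exp], [Ph n K] grows by at most the factor [expR 1] going back over a time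
   [1 / K]; integrating over that time bounds the increment of [B]. *)
have Bstep K t : 1 <= K -> M <= K -> t0 / 2 <= t - K^-1 -> t <= T ->
    B t - B (t - K^-1) <= (1 + expR 1) * Ph n K t.
  move=> K1 MK s1 tT; have K0 : 0 < K by lra.
  have K0' := ltW K0.
  set s := t - K^-1.
  have s0 : 0 < s by exact: lt_le_trans s1.
  have KV : 0 < K^-1 by rewrite invr_gt0.
  have st : s <= t by rewrite /s; lra.
  pose c := 54 + 4 * M + 4 * K * (1 + M).
  have c0 : 0 <= c by rewrite /c addr_ge0 ?addr_ge0// ?mulr_ge0// addr_ge0.
  have C0 : 0 <= 8 + c + c1 by apply: addr_ge0 => //; exact: addr_ge0.
  have := @limit_mono R n0 n sol (fun tau => Ph n K tau - B tau)
    (fun k tau => Pk n k K tau - r k tau) (- (K * (expR 1 * Ph n K t))) _ s t s0 st C0.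
  have sP := Ph_ge0 K (ltW s0).
  have -> : t - s = K^-1 by rewrite /s; ring.
  have -> : - (K * (expR 1 * Ph n K t)) * K^-1 = - (expR 1 * Ph n K t).
    by field; rewrite gt_eqF.
  move=> hl; suff : - (expR 1 * Ph n K t) <= Ph n K t - B t - (Ph n K s - B s) by lra.
  apply: hl.
  - move=> k tau k1 /andP[h1 h2].
    have tau0 : 0 < tau by exact: lt_le_trans h1.
    have e0 := eps_ge0 sol (lt_trans ltr01 k1) (ltW tau0).
    have a1 := Pk_Ph sol k1 K0' (ltW tau0).
    have a2 := rB k tau k1 (le_trans s1 h1).
    have -> : Pk n k K tau - r k tau - (Ph n K tau - B tau) =
      (Pk n k K tau - Ph n K tau) - (r k tau - B tau) by ring.
    apply: (le_trans (ler_normB _ _)).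
    have : 0 <= (c + c1) * eps n k tau by rewrite mulr_ge0// addr_ge0.
    lra.
  - move=> k tau k1 /andP[h1 h2].
    have tau0 : 0 < tau by exact: lt_le_trans h1.
    have e0 := eps_ge0 sol (lt_trans ltr01 k1) (ltW tau0).
    have nMt x : 0 < x -> n x tau <= M.
      by move=> x0; apply: nM => //; rewrite (le_trans h2 tT) ltW.
    have [d hd dge] := Pk_der sol k1 tau0 M0 K1 MK nMt.
    have tI : t0 / 2 <= tau <= T by rewrite (le_trans s1 h1) (le_trans h2 tT).
    have [d1 hd1 dge1] := dr k tau k1 tI.
    exists (d - d1); first by apply: dadd => //; exact: dopp.
    have P1 := Pk_le_Ph sol k1 K0' tau0.
    have P2 : Ph n K tau <= expR 1 * Ph n K t.
      have nMt2 x y : 0 < x -> tau <= y <= t -> n x y <= M.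
        move=> x0 /andP[y1 y2]; apply: nM => //.
        by rewrite (le_trans y2 tT) ltW// (lt_le_trans tau0).
      apply: (le_trans (Ph_exp tau0 h2 M0 K1 MK nMt2)).
      rewrite ler_wpM2r//; first by apply: Ph_ge0; lra.
      rewrite ler_expR mulrC -ler_pdivlMr// mul1r /s in h1 *; lra.
    have P3 := ler_wpM2l K0' (le_trans P1 P2).
    move: dge1; rewrite ler_norml => /andP[_ dge1].
    move: dge; rewrite -/c => dge.
    have : 0 <= 8 * eps n k tau by rewrite mulr_ge0.
    lra.
have Bcont t : t0 <= t <= T -> {for t, continuous B}.
  move=> /andP[t1 t2]; apply: cvgB; last first.
    by apply: dcont (dG _ _); lra.
  have t0' : 0 < t by lra.
  apply/cvgrPdist_lt => e e0.
  have [d d0 hd] := L1d_cont sol (ltW t0') e0.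
  near=> s.
  have sdt : `|s - t| < Num.min d t.
    near: s; have dt0 : 0 < Num.min d t by rewrite lt_min d0 t0'.
    by have := @nbhsx_ballx R R t _ dt0; apply: filterS => s; rewrite /ball/= distrC.
  move: (sdt); rewrite lt_min => /andP[sd].
  rewrite ltr_norml => /andP[s1 s2'].
  have s0 : 0 <= s by lra.
  rewrite distrC; apply: (@le_lt_trans _ _ (1 * L1d n s t)).
    apply: (ID_L1d sol) => //; first exact: ltW.
      by apply: cpos_mfun; exact: phk_cpos.
    by move=> x x0; exact: phk_abs.
  by rewrite mul1r; exact: hd.
(* With [K = 1 / h], [Bstep] and [kPh_small] bound the backward increment over [h] by an arbitrarily
   small multiple of [h]. *)
have Bdec s t : t0 <= s -> s < t -> t <= T -> B t <= B s.
  move=> s1 st tT; apply: (dini_le st).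
    by move=> tau /andP[h1 h2]; apply: Bcont; rewrite (le_trans s1 h1) (le_trans h2 tT).
  move=> tau e /andP[h1 h2] e0.
  have tau0 : 0 < tau by lra.
  have E0 : (0 : R) < 1 + expR 1 by apply: addr_gt0 => //; exact: expR_gt0.
  have [K0 K00 hK] := kPh_small tau0 (divr_gt0 e0 E0).
  (* The entry [2 / t0] forces [h <= t0 / 2], so that [tau - h] stays in the range where [G] is a
     primitive of [gB]; the entries 1 and [M] are the demands of [Bstep]. *)
  pose K1 := Num.max K0 (Num.max 1 (Num.max M (2 / t0))).
  have K10 : 0 < K1 by rewrite lt_max K00.
  exists K1^-1; first by rewrite invr_gt0.
  move=> h /andP[h0 hK1].
  have hV : K1 <= h^-1.
    by rewrite -[K1]invrK lef_pV2 ?posrE ?invr_gt0// ltW.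
  have [a1 a2 a3 a4] : [/\ K0 <= h^-1, 1 <= h^-1, M <= h^-1 & 2 / t0 <= h^-1].
    by split; apply: le_trans hV; rewrite /K1 !le_max lexx ?orbT.
  have := Bstep h^-1 tau a2 a3; rewrite invrK => Bs.
  apply: (@le_trans _ _ ((1 + expR 1) * Ph n h^-1 tau)).
    apply: Bs; last exact: le_trans tT.
    have : h <= t0 / 2.
      by rewrite -[h]invrK -[t0 / 2]invrK lef_pV2 ?posrE ?invr_gt0// invf_div.
    lra.
  have := hK _ a1; rewrite ler_pdivlMr// => b.
  have -> : (1 + expR 1) * Ph n h^-1 tau = (h^-1 * Ph n h^-1 tau * (1 + expR 1)) * h.
    by field; rewrite gt_eqF.
  by rewrite ler_wpM2r// ltW.
have Bcst s t : t0 <= s <= T -> t0 <= t <= T -> B s = B t.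
  have aux s' t' : t0 <= s' -> s' <= t' -> t' <= T -> B s' = B t'.
    move=> h1; rewrite le_eqVlt => /predU1P[->//|h2] h3.
    apply/eqP; rewrite eq_le; apply/andP; split; last exact: Bdec.
    by apply: Bmono => //; [lra|exact: ltW].
  move=> /andP[s1 s2] /andP[u1 u2]; have [h|h] := leP s t; first exact: aux.
  by apply/esym; apply: aux => //; exact: ltW.
(* As [B] is constant, subtracting one value of it makes [r k] small at all times and leaves its
   derivative unchanged. *)
exists (fun k t => r k t - B t0), c1 => //; split.
  move=> k t k1 /andP[u1 u2]; have [|d hd hde] := dr k t k1.
    by rewrite u2 andbT; lra.
  exists d => //; apply: deq; first by apply: dadd; [exact: hd|exact: dcst].
  by rewrite addr0.
move=> k t k1 tI; rewrite (Bcst t0 t)//; last by rewrite lexx ltW.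
by apply: rB => //; case/andP: tI => *; lra.
Unshelve. all: by end_near. Qed.

End NoInflux.

(** * One-sided Lipschitz bound and existence of the trace at [x = 0] *)

Section Trace.
Variable R : realType.
Local Notation H := (@halfline R).
Implicit Types (x y t s a b c d e k T h tau : R) (f g : R -> R).

Lemma D1_eps f c d e : D1 f c d -> 0 < e ->
  exists2 eta, 0 < eta & forall h, `|h| < eta -> `|f (c + h) - f c - d * h| <= e * `|h|.
Proof.
move=> [df fd] e0.
have : (fun h => h^-1 *: ((f \o shift c) (h *: (1 : R)) - f c)) @ 0^' --> d.
  by rewrite -fd; exact: df.
move=> /cvgrPdist_le /(_ e e0)[eta eta0 heta].
exists eta => // h hlt; have [->|hn] := eqVneq h 0.
  by rewrite addr0 subrr mulr0 subr0 normr0 mulr0.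
have := heta h; rewrite /ball_ /= sub0r normrN => /(_ hlt hn).
rewrite [h *: 1]mulr1 => hh.
have -> : f (c + h) - f c - d * h = - (h * (d - h^-1 * (f (h + c) - f c))).
  by rewrite (addrC h c); field.
by rewrite normrN normrM mulrC ler_wpM2r.
Qed.

Lemma max_first f c d eta : 0 < eta -> (forall y, `|y - c| < eta -> f y <= f c) ->
  D1 f c d -> d = 0.
Proof.
move=> eta0 fmax df; apply/eqP; rewrite -normr_le0; apply: le_of_small => e e0.
rewrite add0r; have [u u0 hu] := D1_eps df e0.
pose h := Num.min eta u / 2.
have m0 : 0 < Num.min eta u by rewrite lt_min eta0.
have h0 : 0 < h by rewrite divr_gt0.
have hm : h < Num.min eta u by rewrite /h; lra.
move: hm; rewrite lt_min => /andP[h1 h2].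
have a1 := hu h; have a2 := hu (- h); have b1 := fmax (c + h); have b2 := fmax (c - h).
move: a1 a2 b1 b2; rewrite normrN gtr0_norm// => /(_ h2) a1 /(_ h2) a2.
rewrite (_ : c + h - c = h); last by ring.
rewrite (_ : c - h - c = - h); last by ring.
rewrite normrN gtr0_norm// => /(_ h1) b1 /(_ h1) b2.
move: a1 a2; rewrite !ler_norml => /andP[a1 a1'] /andP[a2 a2'].
have q1 : d * h <= e * h by lra.
have q2 : - e * h <= d * h by lra.
by rewrite -(ler_pM2r h0) q2 -(ler_pM2r h0).
Qed.

Lemma left_max f c d eta : 0 < eta -> (forall y, c - eta < y <= c -> f y <= f c) ->
  D1 f c d -> 0 <= d.
Proof.
move=> eta0 fmax df; apply: le_of_small => e e0.
have [u u0 hu] := D1_eps df e0.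
pose h := Num.min eta u / 2.
have m0 : 0 < Num.min eta u by rewrite lt_min eta0.
have h0 : 0 < h by rewrite divr_gt0.
have hm : h < Num.min eta u by rewrite /h; lra.
move: hm; rewrite lt_min => /andP[h1 h2].
have a2 := hu (- h); have b2 : f (c - h) <= f c by apply: fmax; apply/andP; split; lra.
move: a2; rewrite normrN gtr0_norm// => /(_ h2); rewrite ler_norml => /andP[a2 a2'].
rewrite -(ler_pM2r h0) mul0r; lra.
Qed.

(** A positive second derivative would make [f1], which vanishes at [c], positive just to the right,
    and by the mean value theorem [f] would exceed [f c] there. *)
Lemma max_second f f1 c d eta : 0 < eta -> (forall y, `|y - c| < eta -> f y <= f c) ->
  (forall y, `|y - c| < eta -> D1 f y (f1 y)) -> D1 f1 c d -> d <= 0.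
Proof.
move=> eta0 fmax df df1; rewrite leNgt; apply/negP => d0.
have d20 : 0 < d / 2 by rewrite divr_gt0.
have [u u0 hu] := D1_eps df1 d20.
have f1c : f1 c = 0 by apply: (max_first eta0 fmax); apply: df; rewrite subrr normr0.
pose h := Num.min eta u / 2.
have m0 : 0 < Num.min eta u by rewrite lt_min eta0.
have h0 : 0 < h by rewrite divr_gt0.
have hm : h < Num.min eta u by rewrite /h; lra.
move: hm; rewrite lt_min => /andP[h1 h2].
have cch : c < c + h by rewrite ltrDl.
have near_c x : c <= x <= c + h -> `|x - c| < eta.
  by move=> /andP[p1 p2]; rewrite ger0_norm ?subr_ge0//; lra.
have [||xi] := @MVT _ f f1 c (c + h) cch.
- by move=> x; rewrite in_itv/= => /andP[p1 p2]; apply: df; apply: near_c; rewrite !ltW.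
- by apply: within_cc => x xI; apply: dcont (df x _); exact: near_c.
rewrite in_itv/= => /andP[p1 p2].
have := fmax (c + h); rewrite (_ : c + h - c = h); last by ring.
rewrite gtr0_norm// => /(_ h1) fch E.
have := hu (xi - c); rewrite gtr0_norm ?subr_gt0//.
have xiu : xi - c < u by lra.
move=> /(_ xiu); rewrite (_ : c + (xi - c) = xi) ?f1c; last by ring.
rewrite ler_norml => /andP[q1 q2].
have q0 : 0 < d / 2 * (xi - c) by rewrite mulr_gt0// subr_gt0.
have q3 : 0 < f1 xi by lra.
have : 0 < f1 xi * h by rewrite mulr_gt0.
lra.
Qed.

Variables (n0 : R -> R) (n : R -> R -> R).
Hypothesis sol : kompaneets_solution n0 n.

(** [F1] to [F5] are the optimality conditions at a maximum, with [p = t - tau0] and the equation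
    inserted for the time derivatives. With [D = ny - nx], the quadratic part of the flux
    contributes [- 2 kap D]. The other terms cost at most [D], the barrier [e < D], and
    [kap (x - y) < p D <= S D]; the condition [2 + S <= kap] makes this impossible. *)
Lemma doubling_arith (p S kap e x y l nx ny dnx dny nxx nyx : R) :
  0 < p -> p <= S -> 0 < e -> 0 < y -> y <= x -> x <= 1 / 2 -> 0 <= nx -> l <= 0 -> 2 + S <= kap ->
  - p * dnx - kap = 0 -> p * dny + kap + e * y^-1 = 0 ->
  - p * nxx <= 0 -> p * nyx - e * (y ^+ 2)^-1 <= 0 ->
  0 < p * (ny - nx) - kap * (x - y) - e * (S - l) ->
  0 <= ny - nx + p * (y ^+ 2 * nyx + (y ^+ 2 + 2 * ny) * dny + (2 * y - 2) * ny
       - (x ^+ 2 * nxx + (x ^+ 2 + 2 * nx) * dnx + (2 * x - 2) * nx)) -> False.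
Proof.
move=> p0 pS e0 y0 yx x2 nx0 l0 kS F1 F3 F2 F4 W0 F5.
have S0 : 0 < S by exact: lt_le_trans pS.
have kap0 : 0 <= kap by move: kS S0; clear; lra.
have [D nyE] : exists D, ny = nx + D by exists (ny - nx); ring.
have DE : nx + D - nx = D by ring.
have [q qE q0] : exists2 q, e * y^-1 = q & 0 <= q.
  by exists (e * y^-1) => //; rewrite divr_ge0// ltW.
rewrite qE in F3.
rewrite nyE DE in W0 F5.
have kxy : 0 <= kap * (x - y) by rewrite mulr_ge0// subr_ge0.
have eL : 0 < e * (S - l) by apply: mulr_gt0 => //; move: S0 l0; clear; lra.
have E1 : p * dnx = - kap by move: F1; clear; lra.
have E2 : p * dny = - kap - q by move: F3; clear; lra.
have pD : kap * (x - y) + e * (S - l) < p * D by move: W0; clear; lra.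
have D0 : 0 < D by rewrite -(pmulr_rgt0 _ p0); move: pD kxy eL; clear; lra.
move: F5.
have -> : D + p * (y ^+ 2 * nyx + (y ^+ 2 + 2 * (nx + D)) * dny + (2 * y - 2) * (nx + D) -
    (x ^+ 2 * nxx + (x ^+ 2 + 2 * nx) * dnx + (2 * x - 2) * nx)) =
   D + y ^+ 2 * (p * nyx) - x ^+ 2 * (p * nxx) + (y ^+ 2 + 2 * (nx + D)) * (p * dny)
   - (x ^+ 2 + 2 * nx) * (p * dnx) + p * ((2 * y - 2) * (nx + D) - (2 * x - 2) * nx) by ring.
rewrite E1 E2 => F5.
have G1 : y ^+ 2 * (p * nyx) <= e.
  have y20 : 0 < y ^+ 2 by exact: exprn_gt0.
  have -> : e = y ^+ 2 * (e * (y ^+ 2)^-1) by field; rewrite gt_eqF.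
  by rewrite ler_pM2l// -subr_le0.
have G2 : 0 <= x ^+ 2 * (p * nxx).
  by apply: mulr_ge0; [exact: sqr_ge0|move: F2; clear; lra].
have G3 : 0 <= (y ^+ 2 + 2 * (nx + D)) * q.
  have ny0 : 0 <= nx + D by rewrite addr_ge0// ltW.
  by apply: mulr_ge0; [rewrite addr_ge0 ?sqr_ge0 ?mulr_ge0|].
have G4 : p * ((2 * y - 2) * (nx + D) - (2 * x - 2) * nx) <= 0.
  rewrite pmulr_rle0//.
  have -> : (2 * y - 2) * (nx + D) - (2 * x - 2) * nx =
     - (2 * ((x - y) * nx) + 2 * ((1 - y) * D)) by ring.
  have xy0 : 0 <= (x - y) * nx by rewrite mulr_ge0// subr_ge0.
  have yD0 : 0 <= (1 - y) * D.
    by apply: mulr_ge0; [move: yx x2; clear; lra|exact: ltW].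
  by move: xy0 yD0; clear; lra.
have G5 : kap * (x - y) * (x + y) <= kap * (x - y).
  by apply: ler_piMr => //; move: yx x2; clear; lra.
have G6 : p * D <= S * D by rewrite ler_wpM2r// ltW.
have G7 : (2 + S) * D <= kap * D by rewrite ler_wpM2r// ltW.
(* The constant part [e * S] of the barrier exists for this bound; without it the cost [e] of the
   logarithm in the diffusion term could not be compared with [D]. *)
have G9 : e < D.
  rewrite -(ltr_pM2l S0); apply: lt_le_trans G6; apply: le_lt_trans pD.
  have : e * S <= e * (S - l) by rewrite ler_wpM2l ?(ltW e0)//; move: l0; clear; lra.
  by move: kxy; clear; lra.
have : 0 <= D + e + kap * (x - y) * (x + y) - 2 * (kap * D).
  by move: F5 G1 G2 G3 G4; clear; lra.
by move: G5 G6 G7 G9 pD eL D0 kxy; clear; lra.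
Qed.

Section doubling.
Variables (b tau0 T kap M L1 e : R).
Hypotheses (b0 : 0 < b) (b1 : b <= 1 / 2) (tau00 : 0 < tau0) (tauT : tau0 < T).
Hypothesis nM : forall x t, 0 < x -> 0 <= t <= T -> n x t <= M.
Hypothesis nL : forall x t, b / 2 <= x <= b -> tau0 <= t <= T -> `|dx n x t| <= L1.
Hypotheses (kap1 : (T - tau0) * (L1 + 2 * M / b) <= kap) (kap2 : 2 + (T - tau0) <= kap).
Hypothesis e0 : 0 < e.

Let S := T - tau0.
(* Doubling of variables for a one-sided Lipschitz bound. The term with [ln y]
   is a barrier: nothing is prescribed at the boundary [y = 0]. *)
Let W x y t : R := (t - tau0) * (n y t - n x t) - kap * (x - y) - e * (S - ln y).

Let S0 : 0 < S. Proof. by rewrite /S subr_gt0. Qed.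
Let kap0 : 0 <= kap. Proof. move: kap2 S0; rewrite /S; lra. Qed.
Let ln_b y : 0 < y -> y <= b -> ln y <= 0.
Proof. by move=> y0 yb; apply: ln_le0; move: b1; lra. Qed.

(** This keeps a positive maximum off the face [x = b]. For [y >= b / 2] the interior bound on
    [dx n] applies; for smaller [y] the distance [b - y] is at least [b / 2] and the sup bound is
    enough. *)
Let bdry y t : 0 < y -> y <= b -> tau0 <= t <= T ->
  (t - tau0) * (n y t - n b t) <= kap * (b - y).
Proof.
have B0 := b0; have B1 := b1; have TAU0 := tau00; have TAUT := tauT; have EE0 := e0; have SS0 := S0.
move=> y0 yb /andP[t1 t2]; have t0 : 0 < t by lra.
have tI : tau0 <= t <= T by rewrite t1.
have tI' : 0 <= t <= T by rewrite t2 ltW.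
have nb := n_ge0 sol b0 (ltW t0); have ny := n_ge0 sol y0 (ltW t0).
have M0 : 0 <= M by apply: le_trans nb (nM b0 tI').
have bb : b / 2 <= b <= b by lra.
have L0 : 0 <= L1 by apply: le_trans (nL bb tI).
have key : n y t - n b t <= (L1 + 2 * M / b) * (b - y).
  have [yb2|yb2] := leP (b / 2) y.
    have := @mono_of_derive R (fun x => n x t) (fun x => dx n x t) (- L1) y b yb.
    have h1 x : y <= x <= b -> D1 (fun x => n x t) x (dx n x t).
      by move=> /andP[x1 x2]; apply: (n_dx sol) => //; lra.
    have h2 x : y <= x <= b -> - L1 <= dx n x t.
      move=> /andP[x1 x2]; have xb : b / 2 <= x <= b by lra.
      by have := nL xb tI; rewrite ler_norml => /andP[].
    move=> /(_ h1 h2) h3.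
    have : 0 <= 2 * M / b * (b - y) by rewrite !mulr_ge0 ?invr_ge0 ?(ltW b0)// subr_ge0.
    lra.
  have h1 : n y t <= M by exact: nM.
  have h2 : M <= 2 * M / b * (b - y).
    have -> : 2 * M / b * (b - y) = M * (2 * (b - y) / b) by field; rewrite gt_eqF.
    rewrite ler_peMr// ler_pdivlMr//; lra.
  have h3 : 0 <= L1 * (b - y) by rewrite mulr_ge0// subr_ge0.
  lra.
have by0 : 0 <= b - y by rewrite subr_ge0.
have st0 : 0 <= t - tau0 by rewrite subr_ge0.
apply: (le_trans (ler_wpM2l st0 key)).
rewrite mulrA ler_wpM2r//; apply: le_trans kap1.
rewrite ler_wpM2r ?lerD2r//.
by rewrite addr_ge0// !mulr_ge0// invr_ge0 ltW.
Qed.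

(* At a positive maximum of [W] the first and second order conditions in [x] and
   [y] and the sign of the left time derivative contradict the equation. *)
Let no_max x y t : 0 < y -> y <= x -> x <= b -> tau0 <= t <= T -> 0 < W x y t ->
  (forall x' y' t', 0 < y' -> y' <= x' -> x' <= b -> tau0 <= t' <= T -> W x' y' t' <= W x y t) ->
  False.
Proof.
have B0 := b0; have B1 := b1; have TAU0 := tau00; have TAUT := tauT; have EE0 := e0; have SS0 := S0.
have KAP1 := kap1; have KAP2 := kap2; have KAP0 := kap0.
move=> y0 yx xb tI W0 Wmax; have x0 : 0 < x by exact: lt_le_trans yx.
have /andP[t1 t2] := tI; have t0 : 0 < t by lra.
have lny : ln y <= 0 by apply: ln_b => //; exact: le_trans xb.
have eL : 0 < e * (S - ln y) by rewrite mulr_gt0//; lra.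
have nx := n_ge0 sol x0 (ltW t0); have ny := n_ge0 sol y0 (ltW t0).
have kxy : 0 <= kap * (x - y) by rewrite mulr_ge0// subr_ge0.
(* Positivity of [W] excludes the faces [t = tau0], [y = x] and [x = b]. The face [t = T] is not
   excluded, so in time only the left derivative is used. *)
have tt : tau0 < t.
  rewrite lt_neqAle t1 andbT; apply/eqP => E.
  move: W0; rewrite /W -E subrr mul0r; lra.
have yx' : y < x.
  rewrite lt_neqAle yx andbT; apply/eqP => E.
  move: W0; rewrite /W E !subrr !mulr0; move: eL; rewrite E; lra.
have xb' : x < b.
  rewrite lt_neqAle xb andbT; apply/eqP => E.
  have yb : y <= b by exact: le_trans xb.
  have := bdry y0 yb tI; move: W0; rewrite /W E; lra.
have st0 : 0 < t - tau0 by rewrite subr_gt0.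
have st1 : t - tau0 <= S by rewrite /S lerD2r.
pose et := Num.min (x - y) (b - x).
have et0 : 0 < et by rewrite lt_min !subr_gt0 yx'.
have inx z : `|z - x| < et -> y <= z /\ z <= b.
  by rewrite lt_min !ltr_norml => /andP[/andP[p1 p2] /andP[p3 p4]]; split; lra.
have mx z : `|z - x| < et -> W z y t <= W x y t.
  by move=> /inx[p1 p2]; exact: Wmax.
have dW z : `|z - x| < et -> D1 (fun z => W z y t) z (- (t - tau0) * dx n z t - kap).
  move=> /inx[p1 p2]; have z0 : 0 < z by exact: lt_le_trans p1.
  rewrite /W; apply: deq; first by repeat first [dstep|exact: (n_dx sol)].
  by rewrite /=; ring.
have xx : `|x - x| < et by rewrite subrr normr0.
have F1 := max_first et0 mx (dW x xx).
have dW2 : D1 (fun z => - (t - tau0) * dx n z t - kap) x (- (t - tau0) * dxx n x t).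
  apply: deq; first by repeat first [dstep|exact: (n_dxx sol)].
  by rewrite /=; ring.
have F2 := max_second et0 mx dW dW2.
pose eu := Num.min y (x - y).
have eu0 : 0 < eu by rewrite lt_min subr_gt0 yx' y0.
have iny z : `|z - y| < eu -> 0 < z /\ z <= x.
  by rewrite lt_min !ltr_norml => /andP[/andP[p1 p2] /andP[p3 p4]]; split; lra.
have my z : `|z - y| < eu -> W x z t <= W x y t.
  by move=> /iny[p1 p2]; exact: Wmax.
have dV z : `|z - y| < eu -> D1 (fun z => W x z t) z ((t - tau0) * dx n z t + kap + e * z^-1).
  move=> /iny[p1 p2]; rewrite /W; apply: deq.
    by repeat first [dstep|exact: (n_dx sol)|apply: (dln p1)].
  by rewrite /=; ring.
have yy : `|y - y| < eu by rewrite subrr normr0.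
have F3 := max_first eu0 my (dV y yy).
have dV2 : D1 (fun z => (t - tau0) * dx n z t + kap + e * z^-1) y
   ((t - tau0) * dxx n y t - e * (y ^+ 2)^-1).
  apply: deq; first by repeat first [dstep|exact: (n_dxx sol)|by rewrite gt_eqF].
  by rewrite /=; ring.
have F4 := max_second eu0 my dV dV2.
have mt z : t - (t - tau0) < z <= t -> W x y z <= W x y t.
  rewrite subKr => /andP[p1 p2]; apply: (Wmax x y z y0 yx xb).
  by rewrite (ltW p1) (le_trans p2 t2).
have dT : D1 (fun z => W x y z) t ((n y t - n x t) + (t - tau0) * (dt n y t - dt n x t)).
  rewrite /W; apply: deq; first by repeat first [dstep|exact: (n_dt sol)].
  by rewrite /=; ring.
have F5 := left_max st0 mt dT.
rewrite !(n_pde sol)// in F5.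
exact: (doubling_arith st0 st1 e0 y0 yx (le_trans xb b1) nx lny kap2 F1 F3 F2 F4 W0 F5).
Qed.

Lemma doubling_le x y t : 0 < y -> y <= x -> x <= b -> tau0 <= t <= T ->
  (t - tau0) * (n y t - n x t) - kap * (x - y) <= e * (S - ln y).
Proof.
have B0 := b0; have B1 := b1; have TAU0 := tau00; have TAUT := tauT; have EE0 := e0; have SS0 := S0.
have KAP0 := kap0.
move=> y0 yx xb tI; rewrite leNgt; apply/negP => Wpos.
have M0 : 0 <= M.
  have tI' : 0 <= t <= T by case/andP: tI => p1 p2; rewrite p2 andbT; lra.
  by apply: le_trans (nM y0 tI'); apply: (n_ge0 sol) => //; case/andP: tI'.
(* Below [dl] the logarithmic barrier exceeds [S * M], the largest value of the other terms, so a
   positive supremum is attained with [y >= dl]. *)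
pose dl := Num.min y (expR (- (S * M / e))).
have dl0 : 0 < dl by rewrite lt_min y0 expR_gt0.
have dly : dl <= y by rewrite ge_min lexx.
have Wsmall x' y' t' : 0 < y' -> y' < dl -> y' <= x' -> x' <= b -> tau0 <= t' <= T -> W x' y' t' <= 0.
  move=> y'0 y'd y'x' x'b /andP[p1 p2].
  have t'0 : 0 <= t' by lra.
  have x'0 : 0 < x' by exact: lt_le_trans y'x'.
  have nx := n_ge0 sol x'0 t'0.
  have ny : n y' t' <= M by apply: nM => //; rewrite t'0.
  have q1 : (t' - tau0) * (n y' t' - n x' t') <= S * M.
    apply: (@le_trans _ _ ((t' - tau0) * M)); first by rewrite ler_wpM2l ?subr_ge0//; lra.
    by rewrite ler_wpM2r// /S lerD2r.
  have q2 : 0 <= kap * (x' - y') by rewrite mulr_ge0// subr_ge0.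
  have q3 : ln y' <= - (S * M / e).
    rewrite -[X in _ <= X]expRK ler_ln ?posrE ?expR_gt0//.
    by apply: ltW; apply: (lt_le_trans y'd); rewrite ge_min lexx orbT.
  have q4 : S * M <= e * (S - ln y').
    apply: (@le_trans _ _ (e * (S * M / e))); first by
      rewrite (_ : e * (S * M / e) = S * M)//; field; rewrite gt_eqF.
    by rewrite ler_wpM2l ?(ltW e0)//; move: S0; lra.
  rewrite /W; lra.
(* The triangle [dl <= y <= x <= b] is parametrized by a box through [x = y + s (b - y)], which
   makes compactness a matter of products of segments. *)
pose K := `[dl, b] `*` `[0, 1] `*` `[tau0, T] : set (R * R * R).
have cK : compact K by apply: compact_setX; [apply: compact_setX|]; exact: segment_compact.
pose X (p : R * R * R) := p.1.1 + p.1.2 * (b - p.1.1).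
pose V (p : R * R * R) := W (X p) p.1.1 p.2.
have Kin p : K p -> [/\ 0 < p.1.1, dl <= p.1.1, p.1.1 <= X p, X p <= b & tau0 <= p.2 <= T].
  move=> [[/=]]; rewrite !in_itv/= => /andP[p1 p2] /andP[p3 p4] p5.
  have q1 : 0 <= p.1.2 * (b - p.1.1) by rewrite mulr_ge0// subr_ge0.
  have q2 : p.1.2 * (b - p.1.1) <= b - p.1.1 by rewrite ler_piMl// subr_ge0.
  split => //; rewrite /X; lra.
have cV : {within K, continuous V}.
  apply: continuous_in_subspaceT => p /set_mem /Kin[p0 pd pX Xb /andP[pt1 pt2]].
  have t0 : 0 < p.2 by lra.
  have X0 : 0 < X p by lra.
  have c1 : q.1.1 @[q --> p] --> p.1.1.
    by apply: (@continuous_comp _ _ _ fst fst); exact: cvg_fst.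
  have c2 : q.1.2 @[q --> p] --> p.1.2.
    by apply: (@continuous_comp _ _ _ fst snd); [exact: cvg_fst|exact: cvg_snd].
  have c3 : q.2 @[q --> p] --> p.2 by exact: cvg_snd.
  have cX : X q @[q --> p] --> X p.
    by apply: cvgD => //; apply: cvgM => //; apply: cvgB => //; exact: cvg_cst.
  have cn1 : n q.1.1 q.2 @[q --> p] --> n p.1.1 p.2.
    exact: (@continuous2_cvg (R * R * R) R R R (nbhs p) _ (fun q => q.1.1) (fun q => q.2) n
      p.1.1 p.2 (n_jc sol p0 t0) c1 c3).
  have cn2 : n (X q) q.2 @[q --> p] --> n (X p) p.2.
    exact: (@continuous2_cvg (R * R * R) R R R (nbhs p) _ X (fun q => q.2) n
      (X p) p.2 (n_jc sol X0 t0) cX c3).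
  apply: cvgB; [apply: cvgB|].
  - by apply: cvgM; [apply: cvgB => //; exact: cvg_cst|exact: cvgB].
  - by apply: cvgM; [exact: cvg_cst|exact: cvgB].
  - apply: cvgM; first exact: cvg_cst.
    apply: cvgB; first exact: cvg_cst.
    by apply: (@continuous_comp _ _ _ (fun q : R * R * R => q.1.1) (@ln R)) => //;
      exact: continuous_ln.
have repr x' y' t' : dl <= y' -> y' <= x' -> x' <= b -> tau0 <= t' <= T ->
    exists2 p, K p & V p = W x' y' t'.
  move=> h1 h2 h3 h4; have [yb|yb] := ltP y' b.
    exists (y', (x' - y') / (b - y'), t').
      split; last by rewrite /= in_itv.
      split; rewrite /= in_itv/=; first by rewrite h1 ltW.
      by rewrite divr_ge0 ?subr_ge0 ?(ltW yb)//= ler_pdivrMr ?subr_gt0// mul1r lerD2r.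
    rewrite /V /X /= divfK; last by rewrite gt_eqF// subr_gt0.
    by rewrite (_ : y' + (x' - y') = x')//; ring.
  have Ey : y' = b by apply/eqP; rewrite eq_le yb andbT; exact: le_trans h3.
  have Ex : x' = b by apply/eqP; rewrite eq_le h3 -Ey.
  exists (b, 0, t').
    split; last by rewrite /= in_itv.
    by split; rewrite /= in_itv/= ?lexx ?ler01// -Ey h1.
  by rewrite /V /X /= mul0r addr0 Ex Ey.
have [p0 Kp0 Vp0] := repr x y t dly yx xb tI.
have [c /set_mem cK' cmax] := compact_EVT_max (ex_intro _ p0 Kp0) cK cV.
have [q0 qd qX Xb qt] := Kin c cK'.
have Vc : 0 < V c.
  by apply: lt_le_trans (cmax p0 (mem_set Kp0)); rewrite Vp0 /W; lra.
apply: (@no_max (X c) c.1.1 c.2) => // x' y' t' y'0 y'x' x'b t'I.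
have [yd|yd] := leP dl y'.
  have [p Kp Vp] := repr x' y' t' yd y'x' x'b t'I.
  by rewrite -Vp; apply: cmax; exact: mem_set.
by apply: le_trans (ltW Vc); exact: Wsmall.
Qed.

End doubling.

(** An Oleinik-type estimate: let the barrier parameter [e] tend to 0 in [doubling_le]. The slope
    [kap / (t - tau0)] does not depend on [e], and [b = 1 / 2] is the largest value that the
    doubling argument admits. *)
Lemma oleinik t : 0 < t -> exists C b, [/\ 0 <= C, 0 < b &
  forall x y, 0 < y -> y <= x -> x <= b -> n y t - n x t <= C * (x - y)].
Proof.
move=> t0; pose tau0 := t / 2.
have tau00 : 0 < tau0 by rewrite divr_gt0.
have taut : tau0 < t by rewrite /tau0; lra.
pose b : R := 1 / 2.
have b0 : 0 < b by rewrite divr_gt0.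
have [M M0 nM] := n_bounded sol t.
have b20 : 0 < b / 2 by rewrite divr_gt0.
have [L1 nL] := rect_bound b t b20 tau00 (dx_jc sol).
pose kap := Num.max ((t - tau0) * (L1 + 2 * M / b)) (2 + (t - tau0)).
have kap1 : (t - tau0) * (L1 + 2 * M / b) <= kap by rewrite le_max lexx.
have kap2 : 2 + (t - tau0) <= kap by rewrite le_max lexx orbT.
have st : 0 < t - tau0 by rewrite subr_gt0.
have kap0 : 0 <= kap by lra.
exists (kap / (t - tau0)), b; split => //; first by rewrite divr_ge0// ltW.
move=> x y y0 yx xb.
have tt : tau0 <= t <= t by rewrite lexx ltW.
have lny : ln y <= 0 by apply: ln_le0; rewrite /b in xb; lra.
suff h : (t - tau0) * (n y t - n x t) - kap * (x - y) <= 0.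
  rewrite mulrAC ler_pdivlMr//; lra.
apply: le_of_small => e e0; rewrite add0r.
have P : 0 < t - tau0 - ln y by lra.
have e1 : 0 < e / (t - tau0 - ln y) by rewrite divr_gt0.
have := doubling_le b0 (lexx b) tau00 taut nM nL kap1 kap2 e1 y0 yx xb tt.
by rewrite divfK// gt_eqF.
Qed.

(** By [oleinik] the function [n x t + C * x] is nondecreasing near 0, and it is bounded below by
    0. *)
Lemma trace_cvg t : 0 < t -> n x t @[x --> 0^'+] --> trace0 n t.
Proof.
move=> t0; have [C [b [C0 b0 hC]]] := oleinik t0.
suff : cvg (n x t @[x --> 0^'+]) by [].
have h : cvg ((n x t + C * x) @[x --> 0^'+]).
  apply: (@nondecreasing_at_right_is_cvgr _ (fun x => n x t + C * x) 0).
  - near=> z => x y; rewrite !in_itv/= => /andP[x0 xz] /andP[y0 yz] xy.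
    have zb : z <= b by near: z; apply: nbhs_right_le.
    have := hC y x x0 xy; move=> /(_ _).
    have -> : y <= b by apply: ltW; exact: lt_le_trans zb.
    move=> /(_ isT); lra.
  - near=> z; exists 0 => _ [x + <-]; rewrite /= in_itv/= => /andP[x0 _].
    by rewrite addr_ge0 ?(n_ge0 sol) ?(ltW t0)// mulr_ge0// ltW.
have h2 : C * x @[x --> (0 : R)^'+] --> C * 0.
  by apply: cvgMr; apply: cvg_at_right_filter; exact: cvg_id.
have -> : (fun x => n x t) = (fun x => (n x t + C * x) - C * x).
  by apply/funext => x; ring.
by apply: is_cvgB => //; apply/cvg_ex; exists (C * 0).
Unshelve. all: by end_near. Qed.

End Trace.

(** * The outflow at [x = 0] and the exact mass balance *)

Section MassBalance.
Variable R : realType.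
Local Notation mu := (@lebesgue_measure R).
Local Notation mR := (@measurable _ (measurableTypeR R)).
Local Notation H := (@halfline R).
Implicit Types (x y t s a b c d e k T h tau : R) (f g : R -> R).

Lemma FTC_cc f F a b : a <= b -> (forall x, a <= x <= b -> D1 F x (f x)) ->
  (forall x, a <= x <= b -> {for x, continuous f}) -> ID `[a, b] f = F b - F a.
Proof.
rewrite le_eqVlt => /predU1P[<- _ _|ab dF cf].
  by rewrite subrr /ID set_itv1 Rintegral_set1.
have aI : a <= a <= b by rewrite lexx ltW.
have bI : a <= b <= b by rewrite lexx ltW.
rewrite /ID /Rintegral (@continuous_FTC2 _ f F) //.
- exact: within_cc.
- split.
  + by move=> x; rewrite in_itv/= => /andP[ax xb]; have [] := dF x ltac:(by rewrite !ltW).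
  + by apply: cvg_at_right_filter; apply: dcont; exact: dF.
  + by apply: cvg_at_left_filter; apply: dcont; exact: dF.
- move=> x; rewrite in_itv/= => /andP[ax xb].
  by apply: derive1_is_derive; apply: dF; rewrite !ltW.
Qed.

Variables (n0 : R -> R) (n : R -> R -> R).
Hypothesis sol : kompaneets_solution n0 n.

Lemma lip_cont f C t : 0 < t -> 0 < C ->
  (forall s, 0 < s -> s <= 2 * t -> `|f s - f t| <= C * L1d n s t) -> {for t, continuous f}.
Proof.
move=> t0 C0 hf; apply/cvgrPdist_lt => e e0.
have [d d0 hd] := L1d_cont sol (ltW t0) (divr_gt0 e0 C0).
near=> s.
have sdt : `|s - t| < Num.min d t.
  near: s; have dt0 : 0 < Num.min d t by rewrite lt_min d0 t0.
  by have := @nbhsx_ballx R R t _ dt0; apply: filterS => s; rewrite /ball/= distrC.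
move: (sdt); rewrite lt_min => /andP[sd].
rewrite ltr_norml => /andP[s1 s2'].
have s0 : 0 < s by lra.
rewrite distrC; apply: (@le_lt_trans _ _ (C * L1d n s t)).
  by apply: hf => //; lra.
by rewrite mulrC -ltr_pdivlMr//; apply: hd => //; exact: ltW.
Unshelve. all: by end_near. Qed.

Definition outflow (n : R -> R -> R) k t : R := Jk k (loss n (fun=> 1) k t).

Lemma loss1E k t x : loss n (fun=> 1) k t x = 2 * pc k x * (k * x ^+ 2)^-1 * qc k x ^+ 2 * n x t ^+ 2.
Proof. by rewrite /loss mul1r. Qed.

Lemma loss_weight k x : 1 < k -> k^-1 <= x <= k ->
  0 <= 2 * pc k x * (k * x ^+ 2)^-1 /\
  0 <= 2 * pc k x * (k * x ^+ 2)^-1 * qc k x ^+ 2 <= 2 * pc k x * (k * x ^+ 2)^-1.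
Proof.
move=> k1 kx; have x0 := x_gt0 k1 kx; have k0 := lt_trans ltr01 k1.
have /andP[p0 p1] := pc01 k1 kx; have q01 := qc01 k1 kx.
have h : 0 <= 2 * pc k x * (k * x ^+ 2)^-1.
  by rewrite !mulr_ge0// invr_ge0 mulr_ge0 ?sqr_ge0// ltW.
by split => //; apply: mul01 => //; exact: sqr01.
Qed.

(** The lower half of [psi1], apart from [qc k ^+ 2], is thus an exact derivative; its integral over
    [[1 / k, k]] is close to 1 and concentrates at 0. So [outflow] tests [n^2] against an
    approximate identity at [x = 0]. *)
Lemma pc2_d k x : 0 < k -> 0 < x -> D1 (fun x => pc k x ^+ 2) x (2 * pc k x * (k * x ^+ 2)^-1).
Proof.
move=> k0 x0; have kn : k != 0 by rewrite gt_eqF.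
have xn : x != 0 by rewrite gt_eqF.
rewrite /pc; apply: deq; first by repeat first [dstep|by rewrite mulf_neq0].
by rewrite /=; field; rewrite kn xn.
Qed.

Lemma pc2_cpos k : 0 < k -> cpos (fun x => 2 * pc k x * (k * x ^+ 2)^-1).
Proof.
move=> k0; have cp := pc_cpos k0.
by repeat first [cstep | assumption | move=> x x0; rewrite mulf_neq0 ?expf_neq0 ?gt_eqF//].
Qed.

Lemma pc2_int k a b : 0 < k -> 0 < a -> a <= b ->
  ID `[a, b] (fun x => 2 * pc k x * (k * x ^+ 2)^-1) = pc k b ^+ 2 - pc k a ^+ 2.
Proof.
move=> k0 a0 ab; apply: (FTC (F := fun x => pc k x ^+ 2) a0 ab); last exact: pc2_cpos.
by move=> x x0; exact: pc2_d.
Qed.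

Lemma pc_inv k : 0 < k -> pc k k^-1 = 0.
Proof. by move=> k0; rewrite /pc divff ?gt_eqF// invr1 subrr. Qed.

Lemma outflow_ge0 k t : 1 < k -> 0 <= outflow n k t.
Proof.
move=> k1; apply: ID_ge0 => x /=; rewrite in_itv/= => kx.
have [_ /andP[h _]] := loss_weight k1 kx.
by rewrite loss1E mulr_ge0// sqr_ge0.
Qed.

Lemma loss1_cpos k t : 1 < k -> 0 < t -> cpos (loss n (fun=> 1) k t).
Proof.
move=> k1 t0; have k0 := lt_trans ltr01 k1.
by have [] := cut_cpos sol k0 t0 (@cpos_cst R 1).
Qed.

Lemma outflow_le k t M : 1 < k -> 0 < t -> (forall x, 0 < x -> n x t <= M) ->
  outflow n k t <= M ^+ 2.
Proof.
move=> k1 t0 nM; have k0 := lt_trans ltr01 k1.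
have kV := kinv_gt0 k1; have kk := ltW (kinv_lt k1).
have cw := pc2_cpos k0.
apply: (@le_trans _ _ (ID `[k^-1, k] (fun x => M ^+ 2 * (2 * pc k x * (k * x ^+ 2)^-1)))).
  apply: IDle; [exact: measurable_itv|exact: itg_Jk (loss1_cpos k1 t0)| |].
    by apply: itg_Jk => //; apply: cposM => //; exact: cpos_cst.
  move=> x /=; rewrite in_itv/= => kx; have x0 := x_gt0 k1 kx.
  have [h0 /andP[h1 h2]] := loss_weight k1 kx.
  rewrite loss1E mulrC; apply: ler_pM => //; first exact: sqr_ge0.
  have n1 := n_ge0 sol x0 (ltW t0); have n2 := nM _ x0.
  by rewrite ler_pXn2r ?nnegrE//; exact: le_trans n2.
rewrite IDZ; [|exact: measurable_itv|exact: itg_Jk].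
rewrite pc2_int// pc_inv// expr0n/= subr0.
have kx : k^-1 <= k <= k by rewrite lexx kk.
have /andP[p0 p1] := sqr01 (pc01 k1 kx).
by rewrite ler_piMr// sqr_ge0.
Qed.

Lemma outflow_cont k t : 1 < k -> 0 < t -> {for t, continuous (outflow n k)}.
Proof.
move=> k1 t0; have k0 := lt_trans ltr01 k1; have t0' := ltW t0.
have [M M0 nM] := n_bounded sol (2 * t).
have C0 : 0 < 4 * k * M by rewrite !mulr_gt0.
apply: (lip_cont t0 C0) => s s0 s2t.
rewrite /outflow /Jk -IDB; [|exact: measurable_itv|exact: itg_Jk (loss1_cpos k1 s0)
  |exact: itg_Jk (loss1_cpos k1 t0)].
rewrite /L1d -IDZ; [|exact: mH|by apply: (itg_absd sol) => //; exact: ltW].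
have cd : cpos (fun x => loss n (fun=> 1) k s x - loss n (fun=> 1) k t x).
  by apply: cposD; [exact: loss1_cpos|apply: cposN; exact: loss1_cpos].
apply: ID_cc_abs => //; [exact: kinv_gt0|exact: itg_Jk| | |].
- by apply: itgZ; [exact: mH|by apply: (itg_absd sol) => //; exact: ltW].
- by move=> x _; rewrite mulr_ge0// ltW.
move=> x kx; have x0 := x_gt0 k1 kx.
have [h0 /andP[h1 h2]] := loss_weight k1 kx.
have p01 := pc01 k1 kx.
have w1 : 2 * pc k x * (k * x ^+ 2)^-1 * qc k x ^+ 2 <= 2 * k.
  apply: (le_trans h2).
  have -> : 2 * pc k x * (k * x ^+ 2)^-1 = 2 * k * (pc k x * ((k * x)^-1 * (k * x)^-1)).
    by field; rewrite !gt_eqF.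
  rewrite ler_piMr ?mulr_ge0 ?(ltW k0)//.
  have al := al01 k1 kx.
  have /andP[_ //] : 0 <= pc k x * ((k * x)^-1 * (k * x)^-1) <= 1.
  by apply: prod01 => //; exact: prod01.
rewrite !loss1E -mulrBr normrM ger0_norm//.
have -> : 4 * k * M * `|n x s - n x t| = 2 * k * (2 * M * `|n x s - n x t|) by ring.
apply: ler_pM => //.
rewrite subr_sqr mulrC normrM ler_wpM2r//.
have ns := n_ge0 sol x0 (ltW s0); have nt := n_ge0 sol x0 t0'.
rewrite ger0_norm ?addr_ge0//.
have -> : 2 * M = M + M by ring.
by apply: lerD; apply: nM => //; rewrite ?(ltW s0) ?t0'//=; lra.
Qed.

Lemma outflow_cvg t e : 0 < t -> 0 < e ->
  exists2 K, 1 < K & forall k, K <= k -> `|outflow n k t - trace0 n t ^+ 2| <= e.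
Proof.
move=> t0 e0; have t0' := ltW t0.
have [M M0 nM'] := n_bounded sol t.
have nM x : 0 < x -> n x t <= M by move=> x0; apply: nM' => //; rewrite t0' lexx.
set v := trace0 n t.
have v0 : 0 <= v ^+ 2 by exact: sqr_ge0.
have e2 : 0 < e / 2 by rewrite divr_gt0.
have [dl dl0 hdl] : exists2 dl, 0 < dl & forall x, 0 < x -> x <= dl -> `|n x t ^+ 2 - v ^+ 2| <= e / 2.
  have h : n x t ^+ 2 @[x --> 0^'+] --> v ^+ 2.
    rewrite expr2; under eq_fun do rewrite expr2.
    by apply: cvgM; exact: (trace_cvg sol).
  move/cvgrPdist_le : h => /(_ _ e2)[u /= u0 hu].
  exists (u / 2); first by rewrite divr_gt0.
  move=> x x0 xu; rewrite distrC; apply: (hu x) => //=.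
  by rewrite /ball_/= sub0r normrN gtr0_norm//; lra.
have m0 := mass_ge0 sol t0'.
(* [K1] controls the part [x > dl] of the upper bound, where the weight is at most [2 / (k dl^2)]
   and [n^2 <= M n]. [K2] controls the loss in the lower bound, where [qc] and [pc] at [dl] differ
   from 1 by [dl / k] and [1 / (k dl)]. *)
pose K1 := 2 * M * mass n t / dl ^+ 2 / (e / 2).
pose K2 := v ^+ 2 * (2 * dl + 2 / dl) / (e / 2).
have K1p : 0 <= K1.
  by rewrite /K1; apply: divr_ge0; [apply: divr_ge0; [rewrite !mulr_ge0// ltW|exact: sqr_ge0]|exact: ltW].
have K2p : 0 <= K2.
  rewrite /K2; apply: divr_ge0; last exact: ltW.
  by apply: mulr_ge0 => //; apply: addr_ge0; [apply: mulr_ge0|apply: divr_ge0]; rewrite ?(ltW dl0).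
exists (2 + K1 + K2 + dl + dl^-1).
  have : 0 < dl^-1 by rewrite invr_gt0.
  lra.
move=> k hk.
have dlV : 0 < dl^-1 by rewrite invr_gt0.
have k1 : 1 < k by lra.
have k0 := lt_trans ltr01 k1.
have kdl : k^-1 <= dl.
  by rewrite -[dl]invrK lef_pV2 ?posrE//; lra.
have kdl2 : dl <= k by lra.
have kV := kinv_gt0 k1; have kk := ltW (kinv_lt k1).
have cn := n_cpos sol t0; have cw := pc2_cpos k0; have cl := loss1_cpos k1 t0.
have mab a b : mR `[a, b] by exact: measurable_itv.
have den0 : 0 < k * dl ^+ 2 by rewrite mulr_gt0// exprn_gt0.
have cc0 : 0 <= 2 * M / (k * dl ^+ 2).
  by apply: divr_ge0; [rewrite mulr_ge0// ltW|exact: ltW].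
have up : outflow n k t <= v ^+ 2 + e.
  have i1 : itg `[k^-1, k] (fun x => (v ^+ 2 + e / 2) * (2 * pc k x * (k * x ^+ 2)^-1)).
    by apply: itg_Jk => //; apply: cposM => //; exact: cpos_cst.
  have i2 : itg `[k^-1, k] (fun x => 2 * M / (k * dl ^+ 2) * n x t).
    by apply: itg_Jk => //; repeat first [cstep|assumption].
  apply: (@le_trans _ _ (ID `[k^-1, k] (fun x => (v ^+ 2 + e / 2) * (2 * pc k x * (k * x ^+ 2)^-1)
      + 2 * M / (k * dl ^+ 2) * n x t))).
    apply: IDle => //; [exact: itg_Jk|exact: itgD|].
    move=> x /=; rewrite in_itv/= => kx; have x0 := x_gt0 k1 kx.
    have [h0 /andP[h1 h2]] := loss_weight k1 kx.
    have nn := n_ge0 sol x0 t0'; have nx := nM _ x0.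
    have p01 := pc01 k1 kx.
    have c0 : 0 <= 2 * M / (k * dl ^+ 2) * n x t.
      exact: mulr_ge0 cc0 nn.
    have c1 : 0 <= (v ^+ 2 + e / 2) * (2 * pc k x * (k * x ^+ 2)^-1).
      by rewrite mulr_ge0// addr_ge0// ltW.
    rewrite loss1E; have [xd|dx] := leP x dl.
      have := hdl _ x0 xd; rewrite ler_norml => /andP[_ h3].
      have h4 : n x t ^+ 2 <= v ^+ 2 + e / 2 by move: h3; clear; lra.
      by have := ler_pM h1 (sqr_ge0 _) h2 h4; move: c0; clear; lra.
    have h5 : 2 * pc k x * (k * x ^+ 2)^-1 <= 2 / (k * dl ^+ 2).
      have -> : 2 * pc k x * (k * x ^+ 2)^-1 = (2 * (k * x ^+ 2)^-1) * pc k x by ring.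
      apply: (@le_trans _ _ (2 * (k * x ^+ 2)^-1)).
        rewrite ler_piMr//; last by case/andP: p01.
        by rewrite mulr_ge0// invr_ge0 mulr_ge0 ?sqr_ge0// ltW.
      rewrite ler_wpM2l// lef_pV2 ?posrE ?mulr_gt0 ?exprn_gt0//.
      by rewrite ler_wpM2l ?(ltW k0)// ler_pXn2r ?nnegrE ?(ltW dl0) ?(ltW x0)// ltW.
    have h6 : n x t ^+ 2 <= M * n x t by rewrite expr2 ler_wpM2r.
    have := ler_pM h1 (sqr_ge0 _) (le_trans h2 h5) h6.
    have -> : 2 / (k * dl ^+ 2) * (M * n x t) = 2 * M / (k * dl ^+ 2) * n x t by ring.
    by move: c1; clear; lra.
  rewrite IDD// IDZ//; last by apply: itg_Jk.
  rewrite pc2_int// pc_inv// expr0n/= subr0.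
  have kx : k^-1 <= k <= k by rewrite lexx kk.
  have /andP[p0 p1] := sqr01 (pc01 k1 kx).
  have u1 : (v ^+ 2 + e / 2) * pc k k ^+ 2 <= v ^+ 2 + e / 2.
    by rewrite ler_piMr// addr_ge0// ltW.
  have c0 : 0 <= 2 * M / (k * dl ^+ 2).
    exact: cc0.
  have u2 : ID `[k^-1, k] (fun x => 2 * M / (k * dl ^+ 2) * n x t) <= 2 * M / (k * dl ^+ 2) * mass n t.
    rewrite /mass -IDZ; [|exact: mH|exact: (n_itg sol)].
    apply: ID_cc_le => //.
      by apply: itgZ; [exact: mH|exact: (n_itg sol)].
    by move=> x x0; rewrite mulr_ge0// (n_ge0 sol).
  have u3 : 2 * M / (k * dl ^+ 2) * mass n t <= e / 2.
    have -> : 2 * M / (k * dl ^+ 2) * mass n t = (K1 / k) * (e / 2).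
      by rewrite /K1; field; rewrite !gt_eqF.
    by rewrite ler_piMl ?(ltW e2)// ler_pdivrMr// mul1r; move: hk K2p dl0 dlV; clear; lra.
  by move: u1 u2 u3; clear; lra.
have lo : v ^+ 2 - e <= outflow n k t.
  (* If [v^2 <= e / 2] the lower bound follows from nonnegativity; otherwise [v^2 - e / 2] is
     positive and may be multiplied by lower bounds of the weight. *)
  have [ve|ve] := leP (v ^+ 2) (e / 2).
    by apply: le_trans (outflow_ge0 t k1); lra.
  pose q := 1 - dl / k.
  have q01 : 0 <= q <= 1.
    have d0 : 0 <= dl / k by rewrite divr_ge0// ltW.
    have d1 : dl / k <= 1 by rewrite ler_pdivrMr// mul1r.
    by move: d0 d1; clear=> *; rewrite /q; apply/andP; split; lra.
  have /andP[q0 q1] := q01.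
  have i1 : itg `[k^-1, dl] (fun x => ((v ^+ 2 - e / 2) * q ^+ 2) * (2 * pc k x * (k * x ^+ 2)^-1)).
    by apply: itg_cpos => //; apply: cposM => //; exact: cpos_cst.
  have sub : `[k^-1, dl]%classic `<=` `[k^-1, k]%classic.
    move=> x /=; rewrite !in_itv/= => /andP[-> h]; exact: le_trans kdl2.
  apply: (@le_trans _ _ (ID `[k^-1, dl] (loss n (fun=> 1) k t))); last first.
    apply: ID_subset => //; first exact: itg_Jk.
    move=> x /=; rewrite in_itv/= => kx.
    have [_ /andP[h _]] := loss_weight k1 kx.
    by rewrite loss1E mulr_ge0// sqr_ge0.
  apply: (@le_trans _ _ (ID `[k^-1, dl] (fun x => ((v ^+ 2 - e / 2) * q ^+ 2) * (2 * pc k x * (k * x ^+ 2)^-1)))); last first.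
    apply: IDle => //; first exact: itg_cpos.
    move=> x /=; rewrite in_itv/= => kx'; have kx : k^-1 <= x <= k.
      by case/andP: kx' => -> h; exact: le_trans kdl2.
    have x0 := x_gt0 k1 kx; have xd : x <= dl by case/andP: kx'.
    have [h0 _] := loss_weight k1 kx.
    have := hdl _ x0 xd; rewrite ler_norml => /andP[h3 _].
    have qx : q <= qc k x by rewrite /q /qc lerD2l lerN2 ler_wpM2r// ltW// invr_gt0.
    have qx2 : q ^+ 2 <= qc k x ^+ 2.
      by rewrite ler_pXn2r ?nnegrE//; exact: le_trans qx.
    rewrite loss1E.
    have -> : 2 * pc k x * (k * x ^+ 2)^-1 * qc k x ^+ 2 * n x t ^+ 2 =
      (n x t ^+ 2 * qc k x ^+ 2) * (2 * pc k x * (k * x ^+ 2)^-1) by ring.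
    by rewrite ler_wpM2r//; apply: ler_pM; rewrite ?sqr_ge0//; move: ve h3; clear; lra.
  rewrite IDZ//; last by apply: itg_cpos.
  rewrite pc2_int// pc_inv// expr0n/= subr0.
  pose r := (k * dl)^-1.
  have r0 : 0 <= r by rewrite invr_ge0 mulr_ge0// ltW.
  have d0 : 0 <= dl / k by rewrite divr_ge0// ltW.
  have L : 1 - 2 * (dl / k) - 2 * r <= q ^+ 2 * pc k dl ^+ 2.
    rewrite /q /pc -/r; set u := dl / k in d0 *.
    have -> : (1 - u) ^+ 2 * (1 - r) ^+ 2 = 1 - 2 * u - 2 * r +
        ((u - r) ^+ 2 + 6 * (u * r) - 2 * (u * r) * (u + r) + (u * r) ^+ 2) by ring.
    have ur : u + r <= 2.
      have u1 : u <= 1 by rewrite /u ler_pdivrMr// mul1r.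
      have r1 : r <= 1.
        by rewrite /r invf_le1 ?mulr_gt0// -ler_pdivrMl// mulr1.
      lra.
    have h1 : 0 <= u * r by rewrite mulr_ge0.
    have h2 := sqr_ge0 (u - r); have h3 := sqr_ge0 (u * r).
    have h4 : (u * r) * (u + r) <= (u * r) * 2 by rewrite ler_wpM2l.
    lra.
  have L1 : (v ^+ 2 - e / 2) * (1 - 2 * (dl / k) - 2 * r) <= (v ^+ 2 - e / 2) * q ^+ 2 * pc k dl ^+ 2.
    by rewrite -mulrA ler_wpM2l// subr_ge0 ltW.
  apply: le_trans L1.
  have L2 : v ^+ 2 * (2 * (dl / k) + 2 * r) <= e / 2.
    have -> : v ^+ 2 * (2 * (dl / k) + 2 * r) = (K2 / k) * (e / 2).
      by rewrite /K2 /r; field; rewrite !gt_eqF.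
    by rewrite ler_piMl ?(ltW e2)// ler_pdivrMr// mul1r; move: hk K1p dl0 dlV; clear; lra.
  have L3 : 0 <= e / 2 * (2 * (dl / k) + 2 * r).
    by rewrite mulr_ge0 ?(ltW e2)// addr_ge0// mulr_ge0.
  lra.
by rewrite ler_norml; lra.
Qed.

Lemma mass_cut k t : 1 < k -> 0 <= t ->
  `|Jk k (fun x => 1 * psi k x * n x t) - mass n t| <= 4 * eps n k t.
Proof.
move=> k1 t0.
have -> : Jk k (fun x => 1 * psi k x * n x t) = Jk k (fun x => psi k x * n x t).
  by apply: IDeq => x _; rewrite mul1r.
rewrite -[X in X * eps _ _ _]mulr1; apply: (cut_approx sol) => //; first exact: (n_mfun sol).
by move=> x x0; rewrite mul1r ger0_norm// (n_ge0 sol).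
Qed.

(** With [phi = 1] the weak form says that the cutoff mass changes by [Fk - outflow] up to [eps].
    Subtracting [r] removes [Fk], and as [k] grows the time integral of [outflow] converges by
    domination with [M ^+ 2]. *)
Lemma mass_balance s t : 0 < s -> s < t ->
  itg `[s, t] (fun tau => trace0 n tau ^+ 2) /\
  mass n t - mass n s = - ID `[s, t] (fun tau => trace0 n tau ^+ 2).
Proof.
move=> s0 st; have t0 : 0 < t by exact: lt_trans st.
have [r [C C0 [dr hr]]] := no_influx sol s0 st.
have [M M0 nM] := n_bounded sol t.
have mst : mR `[s, t] by exact: measurable_itv.
have I_s : s <= s <= t by rewrite lexx ltW.
have I_t : s <= t <= t by rewrite lexx ltW.
pose kj (j : nat) : R := j.+2%:R.
have kj1 j : 1 < kj j by rewrite ltr1n.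
have ocont k tau : 1 < k -> 0 < tau -> {for tau, continuous (outflow n k)}.
  exact: outflow_cont.
have mo j : measurable_fun `[s, t] (outflow n (kj j)).
  apply: itg_mfun; apply: itg_cpos => // tau tau0; exact: ocont.
have kbig K : exists J : nat, forall j, (J <= j)%N -> K <= kj j.
  exists (Num.truncn K) => j Jj; apply: (@le_trans _ _ (Num.truncn K).+1%:R).
    by apply: ltW; exact: truncnS_gt.
  by rewrite ler_nat; apply: leqW.
have co tau : `[s, t]%classic tau -> outflow n (kj j) tau @[j --> \oo] --> trace0 n tau ^+ 2.
  rewrite /= in_itv/= => /andP[h1 _]; have tau0 : 0 < tau by exact: lt_le_trans h1.
  apply/cvgrPdist_le => e e0; have [K K1 hK] := outflow_cvg tau0 e0.
  have [J hJ] := kbig K; exists J => // j /= Jj; rewrite distrC; apply: hK.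
  exact: hJ.
have ic : itg `[s, t] (fun=> M ^+ 2) by apply: itg_cpos => //; exact: cpos_cst.
have bo j tau : `[s, t]%classic tau -> `|outflow n (kj j) tau| <= M ^+ 2.
  rewrite /= in_itv/= => /andP[h1 h2]; have tau0 : 0 < tau by exact: lt_le_trans h1.
  rewrite ger0_norm ?outflow_ge0//; apply: outflow_le => // x x0; apply: nM => //.
  by rewrite h2 ltW.
have [itr ctr] := DCT mst mo co ic bo.
split => //.
have cm : ID `[s, t] (outflow n (kj j)) @[j --> \oo] --> - (mass n t - mass n s).
  apply/cvgrPdist_le => e e0.
  (* Four endpoint errors of [4 eps], two from the mass and two from [r], make 16; [54 + C] is the
     error per unit time. *)
  pose L := 16 + (54 + C) * (t - s).
  have ts : 0 < t - s by rewrite subr_gt0.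
  have CC : 0 <= 54 + C by rewrite addr_ge0.
  have L0 : 0 < L by have := mulr_ge0 CC (ltW ts); rewrite /L; lra.
  have [K K1 hK] := eps_unif sol t (divr_gt0 e0 L0).
  have [J hJ] := kbig K; exists J => // j /= Jj.
  have k1 := kj1 j; set k := kj j in k1 *.
  have Kk : K <= k by exact: hJ.
  have k0 := lt_trans ltr01 k1.
  have hk tau : s <= tau <= t -> 0 <= eps n k tau <= e / L.
    move=> /andP[h1 h2]; rewrite (eps_ge0 sol) ?hK//=; last by apply: le_trans h1; exact: ltW.
    by rewrite h2 andbT; apply: le_trans h1; exact: ltW.
  have [G dG] := primitive s0 (fun tau ptau => ocont k tau k1 ptau).
  have IG : ID `[s, t] (outflow n k) = G t - G s.
    apply: FTC_cc; first exact: ltW.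
      by move=> x /andP[sx _]; exact: dG.
    by move=> x /andP[sx _]; apply: ocont => //; exact: lt_le_trans sx.
  (* Cutoff mass, minus the inflow, plus the accumulated outflow [G]: a quantity that is conserved
     up to [eps]. *)
  pose h tau := Jk k (fun x => 1 * psi k x * n x tau) - r k tau + G tau.
  have dh tau : s <= tau <= t -> exists2 d, D1 h tau d & `|d| <= (54 + C) * (e / L).
    move=> stau; have tau0 : 0 < tau by case/andP: stau => h1 _; exact: lt_le_trans h1.
    have [d hd hde] := dr k tau k1 stau.
    have [e1 he1 hd1] := weak_form sol k1 tau0 (fun x _ => dcst (1 : R) x)
      (fun x _ => dcst (0 : R) x) (@cpos_cst R 0) (@ler01 R)
      (fun x _ => ltac:(by rewrite normr1)) (fun x _ => ltac:(by rewrite mulr0 normr0)).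
    exists (Fk n k tau - d + e1).
      have := dadd (dadd hd1 (dopp hd)) (dG tau ltac:(by case/andP: stau)).
      move=> /deq; apply.
      have -> : Jk k (fun x => psi k x * Lop n (fun=> 0) (fun=> 0) tau x * n x tau) = 0.
        rewrite /Jk (@IDeq _ _ _ (fun=> 0)); last by move=> x _; rewrite /Lop; ring.
        by rewrite /ID Rintegral_cst ?mul0r//; exact: measurable_itv.
      by rewrite /Fk /outflow; ring.
    apply: (le_trans (ler_normD _ _)).
    have /andP[E0 E1] := hk tau stau.
    have a1 : `|Fk n k tau - d| <= C * (e / L).
      by rewrite distrC; apply: (le_trans hde); rewrite ler_wpM2l.
    have a2 : 54 * 1 * eps n k tau <= 54 * (e / L) by rewrite mulr1 ler_wpM2l.
    rewrite mulrDl; have := le_trans he1 a2; lra.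
  pose dd tau := if pselect (s <= tau <= t) is left h then sval (cid2 (dh tau h)) else 0.
  have hdd tau : s <= tau <= t -> D1 h tau (dd tau) /\ `|dd tau| <= (54 + C) * (e / L).
    by move=> st'; rewrite /dd; case: pselect => // p; case: cid2.
  have b1 := @mono_of_derive R h dd (- ((54 + C) * (e / L))) s t (ltW st)
    (fun x px => (hdd x px).1)
    (fun x px => ltac:(by have := (hdd x px).2; rewrite ler_norml => /andP[])).
  have b2 := @mono_of_derive_le R h dd ((54 + C) * (e / L)) s t (ltW st)
    (fun x px => (hdd x px).1)
    (fun x px => ltac:(by have := (hdd x px).2; rewrite ler_norml => /andP[])).
  have c1 := mass_cut k1 (ltW t0); have c2 := mass_cut k1 (ltW s0).
  have c3 := hr k s k1 I_s; have c4 := hr k t k1 I_t.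
  have /andP[es0 es1] := hk s I_s; have /andP[et0 et1] := hk t I_t.
  have EE : (16 + (54 + C) * (t - s)) * (e / L) = e by rewrite -/L mulrC divfK// gt_eqF.
  rewrite IG; move: c1 c2 c3 c4 b1 b2; rewrite /h !ler_norml.
  move=> /andP[c1 c1'] /andP[c2 c2'] /andP[c3 c3'] /andP[c4 c4'] b1 b2.
  by move: c1 c1' c2 c2' c3 c3' c4 c4' b1 b2 es1 et1 EE; clear=> *; apply/andP; split; lra.
by have <- := cvg_unique _ cm ctr; rewrite ?opprK.
Qed.

End MassBalance.

(** * Equilibria, a smooth positive part, and the pointwise contraction estimate *)

Section BoseEinstein.
Variable R : realType.
Local Notation mu := (@lebesgue_measure R).
Local Notation mR := (@measurable _ (measurableTypeR R)).
Local Notation H := (@halfline R).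
Implicit Types (x y t s a b c d e k T h tau u m th : R) (f g : R -> R).

(** A common integrable majorant of all equilibria with nonnegative parameter. The exponent is half
    of that in [BE_half]: the other half absorbs the factor [x] in [BE_gexp] and the factor [x^3] in
    [x2BE_gexp]. *)
Definition gexp x : R := expR (- (x / 4)).

Lemma gexp_cont : continuous gexp.
Proof. by move=> x; apply: dcont (dexp (dopp (dmul (did x) (dcst _ x)))). Qed.

Lemma gexp_cpos : cpos gexp.
Proof. by move=> x _; exact: gexp_cont. Qed.

Lemma gexp_gt0 x : 0 < gexp x.
Proof. exact: expR_gt0. Qed.

Lemma gexp_itg : itg H gexp.
Proof.
have d x : D1 (fun x => - 4 * gexp x) x (gexp x).
  rewrite /gexp; apply: deq; first by repeat dstep.
  by rewrite /=; field.
have cy : (- 4 * gexp x) @[x --> +oo] --> (- 4 * 0 : R).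
  apply: cvgMr; rewrite /gexp.
  have := @cvgr_expR R; apply: cvg_comp.
  by apply: gt0_cvgMly; [rewrite invr_gt0|exact: cvg_id].
have h : (\int[mu]_(x in `[(0%R : R), +oo[) (gexp x)%:E =
    (- 4 * 0 : R)%R%:E - (- 4 * gexp 0)%R%:E)%E.
  apply: (@ge0_continuous_FTC2y R gexp (fun x => - 4 * gexp x) 0 (- 4 * 0) _ _ cy).
  - by move=> x _; exact/ltW/gexp_gt0.
  - by apply: continuous_subspaceT; exact: gexp_cont.
  - by move=> x _; have [] := d x.
  - by apply: cvg_at_right_filter; exact: dcont (d 0).
  - by move=> x _; apply: derive1_is_derive; exact: d.
have mg : measurable_fun `[(0 : R), +oo[ (EFin \o gexp).
  apply/measurable_EFinP; apply: measurable_funTS.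
  by apply: continuous_measurable_fun; exact: gexp_cont.
have i0 : itg `[(0 : R), +oo[ gexp.
  apply/integrableP; split => //.
  under eq_integral => x _ do rewrite /= ger0_norm ?(ltW (gexp_gt0 x))//.
  by rewrite h -EFinB ltry.
apply: itgS i0; [exact: measurable_itv|exact: mH|].
by move=> x /Hpos /ltW; rewrite /= in_itv/= andbT.
Qed.

Lemma BE_den th x : 0 <= th -> 0 < x -> 0 < expR (x + th) - 1.
Proof. by move=> m0 x0; rewrite subr_gt0 expR_gt1 ltr_wpDr. Qed.

Lemma BE_gt0 th x : 0 <= th -> 0 < x -> 0 < BE th x.
Proof. by move=> m0 x0; rewrite /BE divr_gt0 ?BE_den// exprn_gt0. Qed.

(** With [E = expR (x / 2)], the denominator divided by [E] is at least [E - E^-1], which is at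
    least [x / 2] because [E >= 1 + x / 2]. *)
Lemma BE_half th x : 0 <= th -> 0 < x -> BE th x <= 2 * x * expR (- (x / 2)).
Proof.
move=> m0 x0; rewrite /BE ler_pdivrMr ?BE_den//.
have h0 : 0 < x / 2 by rewrite divr_gt0.
set E := expR (x / 2); have E1 : 1 + x / 2 <= E by exact: expR_ge1Dx.
have EE : E ^+ 2 <= expR (x + th).
  by rewrite expr2 -expRD ler_expR; lra.
have E0 : 0 < E by exact: expR_gt0.
rewrite expRN -/E.
have -> : 2 * x * E^-1 * (expR (x + th) - 1) = 2 * x * ((expR (x + th) - 1) / E) by ring.
have : x / 2 <= (expR (x + th) - 1) / E.
  rewrite ler_pdivlMr//; nra.
nra.
Qed.

Lemma BE_gexp th x : 0 <= th -> 0 < x -> BE th x <= 8 * gexp x.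
Proof.
move=> m0 x0; have h := BE_half m0 x0.
have E : expR (- (x / 2)) = gexp x * gexp x by rewrite /gexp -expRD; congr expR; field.
have g0 := gexp_gt0 x.
have y4 : 0 <= x / 4 by rewrite divr_ge0// ltW.
have h4 := @y_expN R _ y4; apply: (le_trans h); rewrite E.
have -> : 2 * x * (gexp x * gexp x) = 8 * (x / 4 * gexp x) * gexp x by field.
by rewrite ler_wpM2r ?(ltW g0)//; move: h4; rewrite -/(gexp x); lra.
Qed.

Lemma x2BE_gexp : exists2 K : R, 0 <= K &
  forall th x, 0 <= th -> 0 < x -> x ^+ 2 * BE th x <= K * gexp x.
Proof.
exists (2 * 12 ^+ 3); first by rewrite mulr_ge0// exprn_ge0.
move=> th x m0 x0; have h := BE_half m0 x0.
have E : expR (- (x / 2)) = gexp x * gexp x by rewrite /gexp -expRD; congr expR; field.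
have g0 := gexp_gt0 x.
have y12 : 0 <= x / 12 by rewrite divr_ge0// ltW.
have h12 := @y_expN R _ y12.
have E3 : gexp x = expR (- (x / 12)) ^+ 3.
  by rewrite /gexp !exprS expr0 mulr1 -!expRD; congr expR; field.
have h3 : (x / 12 * expR (- (x / 12))) ^+ 3 <= 1.
  by rewrite exprn_ile1// mulr_ge0// expR_ge0.
apply: (@le_trans _ _ (x ^+ 2 * (2 * x * expR (- (x / 2))))).
  by rewrite ler_wpM2l// sqr_ge0.
rewrite E; have -> : x ^+ 2 * (2 * x * (gexp x * gexp x)) =
  2 * x ^+ 3 * gexp x * gexp x by ring.
have xE : x ^+ 3 = 12 ^+ 3 * (x / 12) ^+ 3 by rewrite -exprMn mulrC mulfVK.
rewrite ler_wpM2r ?(ltW g0)// -mulrA ler_pM2l// xE -mulrA ler_piMr ?exprn_ge0//.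
by move: h3; rewrite exprMn -E3.
Qed.

Lemma BE_le8 th x : 0 <= th -> 0 < x -> BE th x <= 8.
Proof.
move=> m0 x0; have h := BE_gexp m0 x0; apply: (le_trans h).
have : gexp x <= 1 by rewrite /gexp expR_le1 oppr_le0 divr_ge0// ltW.
lra.
Qed.

Definition BE1 th x : R :=
  2 * x / (expR (x + th) - 1) - x ^+ 2 * expR (x + th) / (expR (x + th) - 1) ^+ 2.

Lemma BE_d th x : 0 <= th -> 0 < x -> D1 (BE th) x (BE1 th x).
Proof.
move=> m0 x0; have h := BE_den m0 x0; have hn : expR (x + th) - 1 != 0 by rewrite gt_eqF.
rewrite /BE; apply: deq; first by repeat first [dstep|by []].
by rewrite /BE1 /=; field.
Qed.

Lemma BE1_cpos th : 0 <= th -> cpos (BE1 th).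
Proof.
move=> m0; rewrite /BE1.
by repeat first [cstep | move=> x x0; rewrite ?expf_neq0// gt_eqF// ?BE_den].
Qed.

Lemma BE_cpos th : 0 <= th -> cpos (BE th).
Proof. by move=> m0 x x0; apply: dcont; exact: BE_d. Qed.

Lemma BE_flux th x : 0 <= th -> 0 < x ->
  x ^+ 2 * BE1 th x + (x ^+ 2 - 2 * x) * BE th x + BE th x ^+ 2 = 0.
Proof.
move=> m0 x0; have h := BE_den m0 x0; have hn : expR (x + th) - 1 != 0 by rewrite gt_eqF.
by rewrite /BE /BE1; field.
Qed.

Lemma BE_itg th : 0 <= th -> itg H (BE th).
Proof.
move=> m0; apply: (@itg_le _ _ _ (fun x => 8 * gexp x)); first exact: mH.
- by apply: cpos_mfun; exact: BE_cpos.
- by apply: itgZ; [exact: mH|exact: gexp_itg].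
- move=> x /Hpos x0; rewrite ger0_norm ?(ltW (BE_gt0 m0 x0))//.
  exact: BE_gexp.
Qed.

(** [Sp d] is a smooth convex approximation of the positive part, from above and within [d]. What
    the contraction needs are [Sp2_u2] and [Sp1_neg]: the concave error [u^2 Sp''] and the
    contribution of negative [u] are both of order [d]. *)
Definition rt d u : R := Num.sqrt (u ^+ 2 + d ^+ 2).
Definition Sp d u : R := (u + rt d u) / 2.
Definition Sp1 d u : R := (1 + u / rt d u) / 2.
Definition Sp2 d u : R := d ^+ 2 / (2 * rt d u ^+ 3).
Definition pp u : R := Num.max 0 u.

Lemma sq_le x y : 0 <= x -> 0 <= y -> x ^+ 2 <= y ^+ 2 -> x <= y.
Proof. by move=> x0 y0; rewrite ler_pXn2r ?nnegrE. Qed.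

Section Sp.
Variables (d u : R).
Hypothesis d0 : 0 < d.

Lemma rt_arg : 0 < u ^+ 2 + d ^+ 2.
Proof. by rewrite ltr_wpDl ?sqr_ge0// exprn_gt0. Qed.
Lemma rt_gt0 : 0 < rt d u.
Proof. by rewrite /rt sqrtr_gt0 rt_arg. Qed.
Lemma rt_sqr : rt d u ^+ 2 = u ^+ 2 + d ^+ 2.
Proof. by rewrite /rt sqr_sqrtr// ltW// rt_arg. Qed.
Lemma rt_bounds : [/\ `|u| <= rt d u, d <= rt d u & rt d u <= `|u| + d].
Proof.
have r0 := rt_gt0; have r2 := rt_sqr; have D0 := d0.
have u0 : 0 <= `|u| by [].
have uu : `|u| ^+ 2 = u ^+ 2 by rewrite real_normK// num_real.
split.
- by apply: sq_le => //; [exact: ltW|rewrite r2 uu lerDl sqr_ge0].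
- by apply: sq_le; [exact: ltW|exact: ltW|rewrite r2 lerDr sqr_ge0].
- apply: sq_le; [exact: ltW|by rewrite addr_ge0// ltW|rewrite r2 sqrrD uu].
  have : 0 <= `|u| * d by rewrite mulr_ge0// ltW.
  rewrite mulr2n; lra.
Qed.

Lemma Sp_bounds : pp u <= Sp d u <= pp u + d.
Proof.
have [r1 r2 r3] := rt_bounds; have D0 := d0.
rewrite /Sp /pp; have [h|h] := leP 0 u.
  by move: r1 r3; rewrite ger0_norm// => r1 r3; apply/andP; split; lra.
by move: r1 r3; rewrite ltr0_norm// => r1 r3; apply/andP; split; lra.
Qed.

Lemma Sp1_01 : 0 <= Sp1 d u <= 1.
Proof.
have [r1 r2 r3] := rt_bounds; have r0 := rt_gt0.
have : `|u / rt d u| <= 1.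
  by rewrite normrM normfV (gtr0_norm r0) ler_pdivrMr// mul1r.
by rewrite ler_norml /Sp1 => /andP[h1 h2]; apply/andP; split; lra.
Qed.

Lemma Sp2_ge0 : 0 <= Sp2 d u.
Proof. by rewrite /Sp2 divr_ge0 ?sqr_ge0// mulr_ge0// exprn_ge0// ltW// rt_gt0. Qed.

Lemma Sp2_u2 : u ^+ 2 * Sp2 d u <= d.
Proof.
have [r1 r2 r3] := rt_bounds; have r0 := rt_gt0; have rs := rt_sqr; have D0 := d0.
rewrite /Sp2; set r := rt d u in r1 r2 r3 r0 rs *.
have -> : u ^+ 2 * (d ^+ 2 / (2 * r ^+ 3)) = ((u ^+ 2 / r ^+ 2) * (d / r)) * (d / 2).
  by field; rewrite gt_eqF.
have a1 : 0 <= u ^+ 2 / r ^+ 2 <= 1.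
  rewrite divr_ge0 ?sqr_ge0//= ler_pdivrMr ?exprn_gt0// mul1r rs lerDl; exact: sqr_ge0.
have a2 : 0 <= d / r <= 1 by rewrite divr_ge0 ?(ltW D0) ?(ltW r0)//= ler_pdivrMr// mul1r.
have /andP[p0 p1] := prod01 a1 a2.
have d20 : 0 <= d / 2 by rewrite divr_ge0// ltW.
have := ler_wpM2r d20 p1; lra.
Qed.

Lemma Sp1_neg : u <= 0 -> `|Sp1 d u * u| <= d.
Proof.
move=> u0; have [r1 r2 r3] := rt_bounds; have r0 := rt_gt0; have D0 := d0.
have /andP[s0 s1] := Sp1_01.
rewrite normrM ger0_norm// ler0_norm//.
move: r1 r3; rewrite ler0_norm// => r1 r3.
have -> : Sp1 d u * - u = (rt d u + u) * (- u / rt d u) / 2.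
  by rewrite /Sp1; field; rewrite gt_eqF.
have a1 : 0 <= - u / rt d u <= 1.
  by rewrite divr_ge0 ?(ltW r0) ?oppr_ge0//= ler_pdivrMr// mul1r.
have a0 : 0 <= rt d u + u by lra.
have /andP[p0 p1] := mul01 a0 a1.
lra.
Qed.

End Sp.

Lemma Sp_d f d x a : 0 < d -> D1 f x a -> D1 (fun y => Sp d (f y)) x (Sp1 d (f x) * a).
Proof.
move=> d0 fa; have h := rt_arg (f x) d0; have r0 := rt_gt0 (f x) d0.
rewrite /Sp /rt; apply: deq; first by repeat first [dstep|exact: fa|by []].
rewrite /Sp1 /rt /=; set r := Num.sqrt _.
have rn : r != 0 by rewrite /r gt_eqF.
by field.
Qed.

Lemma Sp1_d f d x a : 0 < d -> D1 f x a -> D1 (fun y => Sp1 d (f y)) x (Sp2 d (f x) * a).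
Proof.
move=> d0 fa; have h := rt_arg (f x) d0; have r0 := rt_gt0 (f x) d0.
have rn : rt d (f x) != 0 by rewrite gt_eqF.
have rs := rt_sqr (f x) d0.
rewrite /Sp1 /rt; apply: deq; first by repeat first [dstep|exact: fa|by []].
rewrite /Sp2 /= -/(rt d (f x)).
set r := rt d (f x) in rn rs *.
have -> : d ^+ 2 = r ^+ 2 - f x ^+ 2 by rewrite rs; ring.
by field.
Qed.

Variables (n0 : R -> R) (n : R -> R -> R).
Hypothesis sol : kompaneets_solution n0 n.

Definition deficit (n : R -> R -> R) th t : R := ID H (fun x => pp (BE th x - n x t)).

Lemma pp_ge0 u : 0 <= pp u. Proof. by rewrite le_max lexx. Qed.

Lemma pp_le u m : u <= m -> 0 <= m -> pp u <= m.
Proof. by move=> um m0; rewrite ge_max m0 um. Qed.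

Lemma deficit_pt th x t : 0 <= th -> 0 < x -> 0 <= t ->
  0 <= pp (BE th x - n x t) <= BE th x.
Proof.
move=> m0 x0 t0; rewrite pp_ge0/=; apply: pp_le; last exact: ltW (BE_gt0 m0 x0).
by rewrite gerBl (n_ge0 sol).
Qed.

Lemma deficit_mfun th t : 0 <= th -> 0 <= t -> measurable_fun H (fun x => pp (BE th x - n x t)).
Proof.
move=> m0 t0; apply: measurable_maxr; first exact: measurable_cst.
apply: measurable_funB; [|exact: (n_mfun sol)].
by apply: cpos_mfun; exact: BE_cpos.
Qed.

Lemma deficit_itg th t : 0 <= th -> 0 <= t -> itg H (fun x => pp (BE th x - n x t)).
Proof.
move=> m0 t0; apply: (itg_le mH (deficit_mfun m0 t0) (BE_itg m0)).
by move=> x /Hpos x0; have /andP[h1 h2] := deficit_pt m0 x0 t0; rewrite ger0_norm.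
Qed.

Lemma rho_gexp_small e : 0 < e -> exists2 k, 1 < k & ID H (fun x => rho k x * gexp x) < e.
Proof.
move=> e0.
have h1 (j : nat) : measurable_fun H (fun x => rho j.+1%:R x * gexp x).
  by apply: measurable_funM; [exact: rho_meas|apply: cpos_mfun; exact: gexp_cpos].
have h2 x : H x -> rho j.+1%:R x * gexp x @[j --> \oo] --> (0 : R).
  move=> /Hpos x0; rewrite -[X in _ --> X](mul0r (gexp x)).
  by apply: cvgMl; exact: rho_cvg.
have h3 (j : nat) x : H x -> `|rho j.+1%:R x * gexp x| <= gexp x.
  move=> /Hpos x0; rewrite ger0_norm ?mulr_ge0 ?rho_ge0// ?(ltW (gexp_gt0 _))//.
  by rewrite ler_piMl ?rho_le1// ltW// gexp_gt0.
have [_] := DCT mH h1 h2 gexp_itg h3.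
have -> : ID H (fun=> 0 : R) = 0.
  by rewrite /ID Rintegral_cst ?mul0r//; exact: mH.
move=> /cvgrPdist_lt /(_ e e0)[J _ hJ].
exists J.+2%:R; first by rewrite ltr1n.
have := hJ J.+1 (leqnSn J); rewrite /= sub0r normrN; apply: le_lt_trans.
exact: ler_norm.
Qed.

Lemma itg_rhog k : 0 < k -> itg H (fun x => rho k x * gexp x).
Proof.
move=> k0; apply: (itg_le mH _ gexp_itg).
  by apply: measurable_funM; [exact: rho_meas|apply: cpos_mfun; exact: gexp_cpos].
move=> x /Hpos x0; rewrite ger0_norm ?mulr_ge0 ?rho_ge0// ?(ltW (gexp_gt0 _))//.
by rewrite ler_piMl ?rho_le1// ltW// gexp_gt0.
Qed.

(** The point is that [K] depends on none of [k], [d], [M], [th]: the first error vanishes with [k]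
    whatever the size of [n], and the second, which grows with [k] and [M], carries the factor [d].
    The sum 608 + 2 K is 288 from [T1] and 320 + 2 K from [T2]. *)
Lemma contraction_pt : exists2 K : R, 0 <= K & forall k d M th x t,
  1 < k -> 0 < d -> d <= 1 -> 0 <= th -> 0 < t ->
  k^-1 <= x <= k -> (forall x, 0 < x -> n x t <= M) -> 0 <= M ->
  let u := BE th x - n x t in
  let Ck := k ^+ 2 + 2 * k + 8 + M in
  (x ^+ 2 * psi2 k x + 2 * x * psi1 k x) * Sp d u
   + psi1 k x * x ^+ 2 * (Sp1 d u * BE1 th x)
   - psi1 k x * (- Sp1 d u) * ((x ^+ 2 - 2 * x) * n x t + n x t ^+ 2)
   - psi k x * (- (Sp2 d u * (BE1 th x - dx n x t))) * flux n x t
  <= K * (rho k x * gexp x) + d * (36 + 4 * k * Ck + Ck ^+ 2 * k ^+ 2).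
Proof.
have [K K0 hK] := x2BE_gexp; exists (608 + 2 * K).
  exact: addr_ge0 (ler0n _ _) (mulr_ge0 (ler0n _ _) K0).
move=> k d M th x t k1 d0 d1 m0 t0 kx nM M0; cbv zeta.
set u := BE th x - n x t; set Ck := k ^+ 2 + 2 * k + 8 + M; have k0 := lt_trans ltr01 k1.
have x0 := x_gt0 k1 kx; have nn := n_ge0 sol x0 (ltW t0).
have xn : x != 0 by rewrite gt_eqF.
have r0 := rho_ge0 k0 x0; have g0 := gexp_gt0 x; have r1 := rho_le1 k x.
have mg := BE_gexp m0 x0; have xmg := hK th x m0 x0.
have m8 := BE_le8 m0 x0; have mp := BE_gt0 m0 x0.
have fl := BE_flux m0 x0.
have /andP[S0 S1] := Sp1_01 u d0.
have /andP[P0 P1] := Sp_bounds u d0; have S2 := Sp2_ge0 u d0; have S2u := Sp2_u2 u d0.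
have /andP[p0 p1] := psi01 k1 kx.
set m := BE th x in u fl mg xmg m8 mp S0 S1 P0 P1 S2 S2u *.
pose c := x ^+ 2 - 2 * x + m + n x t.
have E : (x ^+ 2 * psi2 k x + 2 * x * psi1 k x) * Sp d u
   + psi1 k x * x ^+ 2 * (Sp1 d u * BE1 th x)
   - psi1 k x * (- Sp1 d u) * ((x ^+ 2 - 2 * x) * n x t + n x t ^+ 2)
   - psi k x * (- (Sp2 d u * (BE1 th x - dx n x t))) * flux n x t =
   (x ^+ 2 * psi2 k x + 2 * x * psi1 k x) * Sp d u
   - psi1 k x * (Sp1 d u * u) * c
   - psi k x * Sp2 d u * ((BE1 th x - dx n x t) * (x ^+ 2 * (BE1 th x - dx n x t) + c * u)).
  (* Subtracting the vanishing flux of the equilibrium factors the difference of fluxes as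
     [x^2 u_x + c u], with [c = x^2 - 2 x + m + n]. *)
  rewrite -[RHS]addr0 -(mulr0 (psi1 k x * Sp1 d u + psi k x * Sp2 d u * (BE1 th x - dx n x t))) -fl.
  by rewrite /flux /c /u; ring.
rewrite {}E.
have nMx := nM _ x0.
have xk : x <= k by case/andP: kx.
have kx1 : 1 <= k * x by rewrite -ler_pdivrMl// mulr1; case/andP: kx.
have x2k : x ^+ 2 <= k ^+ 2 by rewrite ler_pXn2r ?nnegrE ?(ltW x0) ?(ltW k0).
have x20 : 0 <= x ^+ 2 by exact: sqr_ge0.
have cC : `|c| <= Ck.
  rewrite ler_norml /c /Ck; apply/andP; split.
    by move: x20 mp nn xk (sqr_ge0 k) M0; clear; lra.
  by move: x0 m8 nMx x2k k0; clear; lra.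
have Ck0 : 0 <= Ck by exact: le_trans (normr_ge0 c) cC.
have c2 : c ^+ 2 <= Ck ^+ 2.
  have -> : c ^+ 2 = `|c| ^+ 2 by rewrite real_normK// num_real.
  by rewrite ler_pXn2r ?nnegrE.
(* completing the square *)
have T3 : - psi k x * Sp2 d u * ((BE1 th x - dx n x t) * (x ^+ 2 * (BE1 th x - dx n x t) + c * u))
    <= d * (Ck ^+ 2 * k ^+ 2).
  set v := BE1 th x - dx n x t.
  have sq : 0 <= (x * v + c * u / (2 * x)) ^+ 2 by exact: sqr_ge0.
  have q1 : - (v * (x ^+ 2 * v + c * u)) <= (c * u / (2 * x)) ^+ 2.
    rewrite -subr_ge0 opprK addrC; apply: le_trans sq _; rewrite le_eqVlt.
    by apply/orP; left; apply/eqP; field.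
  have pS : 0 <= psi k x * Sp2 d u by rewrite mulr_ge0.
  have q2 := ler_wpM2l pS q1.
  rewrite mulNr mulNr -mulrN; apply: le_trans q2 _.
  have -> : psi k x * Sp2 d u * (c * u / (2 * x)) ^+ 2 =
     psi k x * ((u ^+ 2 * Sp2 d u) * (c ^+ 2 * (4 * x ^+ 2)^-1)) by field.
  have i0 : 0 <= (4 * x ^+ 2)^-1 by rewrite invr_ge0 mulr_ge0.
  have i1 : (4 * x ^+ 2)^-1 <= k ^+ 2.
    have k2x2 : 1 <= k ^+ 2 * x ^+ 2 by rewrite -exprMn exprn_ege1.
    rewrite -div1r ler_pdivrMr ?mulr_gt0 ?exprn_gt0//.
    by move: k2x2; clear; lra.
  have w1 : c ^+ 2 * (4 * x ^+ 2)^-1 <= Ck ^+ 2 * k ^+ 2.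
    by apply: ler_pM => //; exact: sqr_ge0.
  have w0 : 0 <= c ^+ 2 * (4 * x ^+ 2)^-1 by rewrite mulr_ge0// sqr_ge0.
  have w2 : (u ^+ 2 * Sp2 d u) * (c ^+ 2 * (4 * x ^+ 2)^-1) <= d * (Ck ^+ 2 * k ^+ 2).
    by apply: ler_pM => //; rewrite mulr_ge0// sqr_ge0.
  have w3 := mulr_ge0 (mulr_ge0 (sqr_ge0 u) S2) w0.
  by apply: le_trans w2; rewrite ler_piMl.
have ppm : pp u <= m by apply: pp_le; [rewrite /u gerBl|exact: ltW].
have b1 := xpsi1_rho k1 kx; have b2 := x2psi2_rho k1 kx.
have rg0 : 0 <= rho k x * gexp x by rewrite mulr_ge0// ltW.
have T1 : (x ^+ 2 * psi2 k x + 2 * x * psi1 k x) * Sp d u <= 288 * (rho k x * gexp x) + d * 36.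
  have a1 : `|x ^+ 2 * psi2 k x + 2 * x * psi1 k x| <= 36 * rho k x.
    apply: (le_trans (ler_normD _ _)).
    by rewrite -mulrA [`|2 * _|]normrM normr_nat; move: b1 b2; clear; lra.
  have a2 : (x ^+ 2 * psi2 k x + 2 * x * psi1 k x) * Sp d u <= 36 * rho k x * (m + d).
    apply: le_trans (ler_norm _) _; rewrite normrM; apply: ler_pM => //.
    rewrite ger0_norm; last by apply: le_trans P0; exact: pp_ge0.
    by apply: le_trans P1 _; rewrite lerD2r.
  have a3 : rho k x * m <= rho k x * (8 * gexp x) by rewrite ler_wpM2l.
  have a4 : rho k x * d <= 1 * d by rewrite ler_wpM2r// ltW.
  apply: (le_trans a2); move: a3 a4; clear; lra.
have T2 : - psi1 k x * (Sp1 d u * u) * c <= (320 + 2 * K) * (rho k x * gexp x) + d * (4 * k * Ck).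
  have dk : 0 <= d * (4 * k * Ck) by rewrite !mulr_ge0// ltW.
  have Krg := mulr_ge0 K0 rg0.
  (* Where [n] exceeds the equilibrium the term is of order [d]. Elsewhere [n <= m], and the
     exponential decay of [m] replaces any bound on [n]. *)
  have [u0|u0] := leP u 0.
    have a1 := Sp1_neg d0 u0.
    have a2 : `|psi1 k x| <= 4 * k.
      have -> : psi1 k x = x * psi1 k x * x^-1 by field.
      rewrite normrM; apply: ler_pM => //; first by move: b1 r1; clear; lra.
      by rewrite normfV (gtr0_norm x0) -div1r ler_pdivrMr.
    have a3 : - psi1 k x * (Sp1 d u * u) * c <= 4 * k * d * Ck.
      apply: le_trans (ler_norm _) _; rewrite normrM [`|_ * (_ * u)|]normrM normrN.
      by apply: ler_pM => //; exact: ler_pM.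
    by apply: (le_trans a3); move: rg0 Krg; clear; lra.
  have nm : n x t <= m by move: u0; rewrite /u subr_gt0 => /ltW.
  have um : u <= m by rewrite /u gerBl.
  have Su0 : 0 <= Sp1 d u * u by rewrite mulr_ge0// ltW.
  have Sum : Sp1 d u * u <= m by apply: le_trans um; rewrite ler_piMl// ltW.
  (* The two halves of [psi1] need opposite bounds on [c]: near 0 only its negative part matters,
     which is at most [2 x]; near infinity only its positive part, at most [x^2 + 2 m]. *)
  pose A := 2 * pc k x * (k * x ^+ 2)^-1 * qc k x ^+ 2.
  pose B := 2 * pc k x ^+ 2 * qc k x / k.
  have EAB : psi1 k x = A - B by [].
  have p01 := pc01 k1 kx; have q01 := qc01 k1 kx.
  have al := al01 k1 kx; have ab := albe_rho k1 kx.
  have be := be01 k1 kx; have kV := kV_rho k1 kx.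
  have xA : 0 <= x * A <= 4 * rho k x.
    have -> : x * A = 2 * (k * x)^-1 * (pc k x * qc k x ^+ 2).
      by rewrite /A; field; rewrite !gt_eqF.
    have al0 : 0 <= 2 * (k * x)^-1 by rewrite mulr_ge0//; case/andP: al.
    have /andP[v0 v1] := mul01 al0 (prod01 p01 (sqr01 q01)).
    rewrite v0/=; apply: (le_trans v1); case/andP: be => be0 _; move: ab be0; clear; lra.
  have A0 : 0 <= A by rewrite -(pmulr_rge0 _ x0); case/andP: xA.
  have B01 : 0 <= B <= 2 * k^-1.
    have -> : B = 2 * k^-1 * (pc k x ^+ 2 * qc k x) by rewrite /B; ring.
    apply: mul01; first by rewrite mulr_ge0// invr_ge0 ltW.
    by apply: prod01 => //; exact: sqr01.
  have /andP[B0 B1] := B01.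
  have cA : - (A * (Sp1 d u * u) * c) <= 8 * rho k x * m.
    have c2x : - c <= 2 * x by rewrite /c; move: x20 mp nn; clear; lra.
    have AS : 0 <= A * (Sp1 d u * u) by rewrite mulr_ge0.
    rewrite -mulrN; apply: (le_trans (ler_wpM2l AS c2x)).
    have -> : A * (Sp1 d u * u) * (2 * x) = 2 * (x * A) * (Sp1 d u * u) by ring.
    apply: ler_pM => //; first by rewrite mulr_ge0//; case/andP: xA.
    by case/andP: xA => _; clear; lra.
  have cB : B * (Sp1 d u * u) * c <= 2 * rho k x * m * (x ^+ 2 + 2 * m).
    have cle : c <= x ^+ 2 + 2 * m by rewrite /c; move: x0 nm; clear; lra.
    have xm0 : 0 <= x ^+ 2 + 2 * m by rewrite addr_ge0// mulr_ge0// ltW.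
    apply: (@le_trans _ _ (B * (Sp1 d u * u) * (x ^+ 2 + 2 * m))).
      by rewrite ler_wpM2l// mulr_ge0.
    have B2 : B <= 2 * rho k x by apply: (le_trans B1); rewrite ler_pM2l.
    by apply: ler_wpM2r => //; exact: ler_pM.
  have mm : m * m <= 8 * (8 * gexp x) by apply: ler_pM => //; exact: ltW.
  have mx : m * (x ^+ 2 + 2 * m) <= (K + 128) * gexp x by move: mm xmg; clear; lra.
  have mx2 := ler_wpM2l (mulr_ge0 (ler0n _ 2) r0) mx.
  have mg2 := ler_wpM2l (mulr_ge0 (ler0n _ 8) r0) mg.
  rewrite EAB mulNr mulNr mulrBl mulrBl opprB.
  by move: cA cB mx2 mg2 dk; clear; lra.
by move: T1 T2 T3; clear; lra.
Qed.

End BoseEinstein.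

(** * Monotonicity in time of the deficit below an equilibrium *)

Section Contraction.
Variable R : realType.
Local Notation mu := (@lebesgue_measure R).
Local Notation mR := (@measurable _ (measurableTypeR R)).
Local Notation H := (@halfline R).
Implicit Types (x y t s a b c d e k T h tau u m th : R) (f g : R -> R).
Variables (n0 : R -> R) (n : R -> R -> R).
Hypothesis sol : kompaneets_solution n0 n.

Lemma ID_cst_cc c a b : a <= b -> ID `[a, b] (fun=> c) = c * (b - a).
Proof.
move=> ab; rewrite (@FTC_cc R (fun=> c) (fun x => c * x)) ?mulrBr//.
- move=> x _; apply: deq; first by repeat dstep.
  by rewrite /=; ring.
- by move=> x _; exact: cvg_cst.
Qed.

Lemma BE_dt th x t : 0 < x -> 0 < t -> D1 (fun tau => BE th x - n x tau) t (- dt n x t).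
Proof.
move=> x0 t0; apply: deq; first by repeat first [dstep|exact: (n_dt sol)].
by rewrite add0r.
Qed.

Lemma BE_dx th x t : 0 <= th -> 0 < x -> 0 < t ->
  D1 (fun y => BE th y - n y t) x (BE1 th x - dx n x t).
Proof. by move=> m0 x0 t0; apply: dadd; [exact: BE_d|apply: dopp; exact: (n_dx sol)]. Qed.

Lemma contraction_cut : exists2 K : R, 0 <= K & forall k d M th t,
  1 < k -> 0 < d -> d <= 1 -> 0 <= th -> 0 < t ->
  (forall x, 0 < x -> n x t <= M) -> 0 <= M ->
  exists2 D, D1 (fun tau => Jk k (fun x => psi k x * Sp d (BE th x - n x tau))) t D &
   D <= K * ID H (fun x => rho k x * gexp x)
     + d * (36 + 4 * k * (k ^+ 2 + 2 * k + 8 + M) + (k ^+ 2 + 2 * k + 8 + M) ^+ 2 * k ^+ 2) * k.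
Proof.
have [K K0 hK] := contraction_pt sol; exists K => // k d M th t k1 d0 d1 m0 t0 nM M0.
have k0 := lt_trans ltr01 k1.
pose E x t := Sp d (BE th x - n x t).
pose G x t := - Sp1 d (BE th x - n x t).
pose Ex x t := Sp1 d (BE th x - n x t) * BE1 th x.
pose Gx x t := - (Sp2 d (BE th x - n x t) * (BE1 th x - dx n x t)).
have E1 x s : 0 < x -> 0 < s -> D1 (E x) s (G x s * dt n x s).
  move=> x0 s0; apply: deq (Sp_d d0 (BE_dt th x0 s0)) _.
  by rewrite /G; ring.
have E2 x s : 0 < x -> 0 < s -> D1 (fun y => E y s) x (G x s * dx n x s + Ex x s).
  move=> x0 s0; apply: deq (Sp_d d0 (BE_dx m0 x0 s0)) _.
  by rewrite /G /Ex; ring.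
have E3 x s : 0 < x -> 0 < s -> D1 (fun y => G y s) x (Gx x s).
  by move=> x0 s0; apply: dopp; exact: Sp1_d d0 (BE_dx m0 x0 s0).
have E4 x s : 0 < x -> 0 < s -> `|G x s| <= 1.
  by move=> _ _; rewrite /G normrN; have /andP[h1 h2] := Sp1_01 (BE th x - n x s) d0; rewrite ger0_norm.
have cB1 := BE1_cpos m0; have cB := BE_cpos m0.
have E5 s : 0 < s -> cpos (fun x => Ex x s).
  move=> s0; rewrite /Ex; apply: cposM => // x x0.
  exact: dcont (Sp1_d d0 (BE_dx m0 x0 s0)).
have E6 s : 0 < s -> cpos (fun x => Gx x s).
  move=> s0; rewrite /Gx /Sp2 /rt.
  have cn := n_cpos sol s0; have cdx := dx_cpos sol s0.
  repeat first [cstep | assumption].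
  move=> x x0; rewrite mulf_neq0// expf_neq0// gt_eqF//.
  exact: (rt_gt0 (BE th x - n x s) d0).
have [pa p1a] := psi_a k0; have [pb p1b] := psi_b k0.
have hD := entropy_derive sol (kinv_gt0 k1) (kinv_lt k1) t0 (fun x px => psi_d k0 px)
  (fun x px => psi1_d k0 px) (psi2_cpos k0) pa pb p1a p1b E1 E2 E3 E4 E5 E6.
have cE : cpos (fun x => E x t) by move=> x x0; exact: dcont (E2 x t x0 t0).
have cG : cpos (fun x => G x t) by move=> x x0; exact: dcont (E3 x t x0 t0).
have cEx := E5 t t0; have cGx := E6 t t0.
eexists; first exact: hD.
set D := d * _.
have cn := n_cpos sol t0; have cp := psi_cpos k0; have cp1 := psi1_cpos k0; have cp2 := psi2_cpos k0.
have cfl := flux_cpos sol t0.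
have mab : mR `[k^-1, k] by exact: measurable_itv.
have sub : `[k^-1, k]%classic `<=` H by apply: ccH; exact: kinv_gt0.
have irg : itg `[k^-1, k] (fun x => rho k x * gexp x) by apply: itgS (itg_rhog k0) => //; exact: mH.
have i1 : itg `[k^-1, k] (fun x => K * (rho k x * gexp x)) by exact: itgZ.
have i2 : itg `[k^-1, k] (fun=> D) by apply: itg_Jk => //; exact: cpos_cst.
have D0 : 0 <= D.
  have C0 : 0 <= k ^+ 2 + 2 * k + 8 + M by rewrite !addr_ge0 ?sqr_ge0// mulr_ge0// ltW.
  have k2 := sqr_ge0 k; have k0' := ltW k0.
  rewrite /D; apply: mulr_ge0; first exact: ltW.
  by apply: addr_ge0; [apply: addr_ge0 => //; apply: mulr_ge0 => //; exact: mulr_ge0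
     |apply: mulr_ge0 => //; exact: sqr_ge0].
apply: (@le_trans _ _ (ID `[k^-1, k] (fun x => K * (rho k x * gexp x) + D))).
  apply: IDle => //.
  - exact: itg_Jk (entropy_integrand_cpos cp cp1 cp2 cE cEx cG cn cfl cGx).
  - exact: itgD.
  - move=> x /=; rewrite in_itv/= => kx.
      exact: hK.
rewrite IDD// ID_cst_cc; last exact: ltW (kinv_lt k1).
rewrite IDZ//; apply: lerD.
  apply: ler_wpM2l; first by [].
  apply: ID_subset => //; first exact: mH.
    exact: itg_rhog.
  by move=> x /Hpos x0; rewrite mulr_ge0 ?rho_ge0// ltW// gexp_gt0.
by apply: ler_wpM2l => //; rewrite lerBlDr lerDl ltW// kinv_gt0.
Qed.

Lemma pp_cpos f : cpos f -> cpos (fun x => pp (f x)).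
Proof.
by move=> cf x x0; apply: continuous_max; [exact: cvg_cst|exact: cf].
Qed.

(** Order of limits: [k] is chosen first, making the integral of [rho k * gexp] small, and only then
    [d], against constants that grow with [k] and with the sup bound up to time [t]. *)
Lemma deficit_mono th s t : 0 <= th -> 0 < s -> s <= t -> deficit n th t <= deficit n th s.
Proof.
move=> m0 s0 st; have t0 : 0 < t by exact: lt_le_trans st.
have [M M0' nM] := n_bounded sol t; have M0 := ltW M0'.
apply: le_of_small => e e0.
have [K K0 hK] := contraction_cut.
pose C := 64 + K * (t - s).
have ts : 0 <= t - s by rewrite subr_ge0.
have C0 : 0 < C by rewrite /C; have := mulr_ge0 K0 ts; lra.
have e2 : 0 < e / 2 by rewrite divr_gt0.
have [k k1 hk] := rho_gexp_small (divr_gt0 e2 C0).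
have k0 := lt_trans ltr01 k1.
set a := ID H _ in hk.
pose Dk := (36 + 4 * k * (k ^+ 2 + 2 * k + 8 + M) + (k ^+ 2 + 2 * k + 8 + M) ^+ 2 * k ^+ 2) * k.
have Dk0 : 0 <= Dk.
  have M1 : 0 <= k ^+ 2 + 2 * k + 8 + M by rewrite !addr_ge0 ?sqr_ge0// mulr_ge0// ltW.
  have k2 := sqr_ge0 k; have k0' := ltW k0.
  rewrite /Dk; apply: mulr_ge0 => //.
  by apply: addr_ge0; [apply: addr_ge0 => //; apply: mulr_ge0 => //; exact: mulr_ge0
     |apply: mulr_ge0 => //; exact: sqr_ge0].
pose L := k + Dk * (t - s).
have L0 : 0 < L by rewrite /L ltr_wpDr// mulr_ge0.
(* [L] adds the cost [k] of replacing [pp] by [Sp d] at time [s] to the cost [Dk * (t - s)] of the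
   derivative bound. *)
pose d := Num.min 1 (e / 2 / L).
have d0 : 0 < d by rewrite lt_min ltr01 divr_gt0.
have d1 : d <= 1 by rewrite ge_min lexx.
have dL : d * L <= e / 2 by rewrite -ler_pdivlMr// ge_min lexx orbT.
pose h tau := Jk k (fun x => psi k x * Sp d (BE th x - n x tau)).
have dh tau : s <= tau <= t -> exists2 D, D1 h tau D & D <= K * a + d * Dk.
  move=> /andP[h1 h2]; have tau0 : 0 < tau by exact: lt_le_trans h1.
  have nMt x : 0 < x -> n x tau <= M by move=> x0; apply: nM => //; rewrite h2 ltW.
  have [D hD DD] := hK k d M th tau k1 d0 d1 m0 tau0 nMt M0.
  by exists D => //; apply: (le_trans DD); rewrite /Dk /a mulrA lexx.
pose dd tau := if pselect (s <= tau <= t) is left p then sval (cid2 (dh tau p)) else 0.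
have hdd tau : s <= tau <= t -> D1 h tau (dd tau) /\ dd tau <= K * a + d * Dk.
  by move=> st'; rewrite /dd; case: pselect => // p; case: cid2.
have b2 := @mono_of_derive_le R h dd (K * a + d * Dk) s t st
    (fun x px => (hdd x px).1) (fun x px => (hdd x px).2).
have mab : mR `[k^-1, k] by exact: measurable_itv.
have cpp tau : 0 < tau -> cpos (fun x => psi k x * pp (BE th x - n x tau)).
  move=> tau0; have cn := n_cpos sol tau0; have cp := psi_cpos k0; have cB := BE_cpos m0.
  by apply: cposM => //; apply: pp_cpos; repeat first [cstep|assumption].
have cSp tau : 0 < tau -> cpos (fun x => psi k x * Sp d (BE th x - n x tau)).
  move=> tau0; have cp := psi_cpos k0; apply: cposM => // x x0.
  exact: dcont (Sp_d d0 (BE_dx m0 x0 tau0)).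
have cut tau : 0 < tau ->
  `|Jk k (fun x => psi k x * pp (BE th x - n x tau)) - deficit n th tau| <= 32 * a.
  move=> tau0; have tau0' := ltW tau0.
  have := @cut_approx_gen R (fun x => pp (BE th x - n x tau)) (fun x => 8 * gexp x) k k1
   (deficit_mfun sol m0 tau0') (itgZ 8 mH (@gexp_itg R)).
  move=> cc; apply: (le_trans (cc _)).
    move=> x x0; have /andP[p1 p2] := deficit_pt sol m0 x0 tau0'.
    by rewrite ger0_norm//; apply: (le_trans p2); exact: BE_gexp.
  rewrite (@IDeq _ _ _ (fun x => 8 * (rho k x * gexp x))); last by move=> x _; ring.
  rewrite IDZ; [rewrite -/a|exact: mH|exact: itg_rhog].
  by clear; lra.
have up tau : 0 < tau -> Jk k (fun x => psi k x * pp (BE th x - n x tau)) <= h tau.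
  move=> tau0; apply: IDle => //; [exact: itg_Jk (cpp _ tau0)|exact: itg_Jk (cSp _ tau0)|].
  move=> x /=; rewrite in_itv/= => kx; have /andP[p0 p1] := psi01 k1 kx.
  by rewrite ler_wpM2l//; have /andP[] := Sp_bounds (BE th x - n x tau) d0.
have lo tau : 0 < tau -> h tau <= Jk k (fun x => psi k x * pp (BE th x - n x tau)) + d * k.
  move=> tau0.
  have ic : itg `[k^-1, k] (fun=> d) by apply: itg_Jk => //; exact: cpos_cst.
  have ip := itg_Jk k1 (cpp _ tau0).
  apply: (@le_trans _ _ (ID `[k^-1, k] (fun x => psi k x * pp (BE th x - n x tau) + d))).
    apply: IDle => //; [exact: itg_Jk (cSp _ tau0)|exact: itgD|].
    move=> x /=; rewrite in_itv/= => kx; have /andP[p0 p1] := psi01 k1 kx.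
    have /andP[q1 q2] := Sp_bounds (BE th x - n x tau) d0.
    apply: (le_trans (ler_wpM2l p0 q2)); rewrite mulrDr lerD2l.
    by rewrite ler_piMl// ltW.
  rewrite IDD// ID_cst_cc; last exact: ltW (kinv_lt k1).
  rewrite lerD2l ler_wpM2l ?(ltW d0)// lerBlDr lerDl ltW// kinv_gt0//.
have c1 := cut t t0; have c2 := cut s s0.
move: c1 c2; rewrite !ler_norml => /andP[c1 _] /andP[_ c2].
have u1 := up t t0; have u2 := lo s s0.
have hk2 : C * a <= e / 2 by rewrite mulrC -ler_pdivlMr// ltW.
have a0 : 0 <= a.
  by apply: ID_ge0 => x /Hpos x0; rewrite mulr_ge0 ?rho_ge0// ltW// gexp_gt0.
by move: b2 dL hk2 c1 c2 u1 u2; rewrite /L /C; clear; lra.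
Qed.

End Contraction.

(** * The entropy, its dissipation, and a weight that yields tightness *)

Section Entropy.
Variable R : realType.
Local Notation mu := (@lebesgue_measure R).
Local Notation mR := (@measurable _ (measurableTypeR R)).
Local Notation H := (@halfline R).
Implicit Types (x y t s a b c d e k T h tau u m th : R) (f g : R -> R).

Definition Af x : R := expR x / (1 + expR x).
Definition Gam x : R := (1 + expR x) / x ^+ 2.
Definition Bf x : R := x ^+ 2 * expR x / (1 + expR x) ^+ 2.
Definition Af1 x : R := expR x / (1 + expR x) ^+ 2.
Definition Gam1 x : R := expR x / x ^+ 2 - 2 * (1 + expR x) / x ^+ 3.
Definition Bf1 x : R := 2 * x * expR x / (1 + expR x) ^+ 2 + x ^+ 2 * expR x / (1 + expR x) ^+ 2
   - 2 * x ^+ 2 * expR x ^+ 2 / (1 + expR x) ^+ 3.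

(* The entropy density [Phi] has [n]-derivative [wf = z / (1 + z)], where
   [z = n e^x / (n + x^2)] is the fugacity [e^(- mu)] of the equilibrium through
   [(x, n)]; along a solution the total [x]-derivative of [wf] is [flux] times a
   positive factor. *)
Definition Phi x r : R := Af x * r - Bf x * ln (1 + Gam x * r).
Definition Phix x r : R := Af1 x * r - Bf1 x * ln (1 + Gam x * r)
   - Bf x * (Gam1 x * r) / (1 + Gam x * r).
Definition Qf x r : R := x ^+ 2 + r + r * expR x.
Definition wf x r : R := expR x * r / Qf x r.

Section pointwise.
Variables (x r : R).
Hypotheses (x0 : 0 < x) (r0 : 0 <= r).

Lemma onepE_gt0 : 0 < 1 + expR x.
Proof. by rewrite ltr_wpDl// expR_gt0. Qed.

Lemma Gam_gt0 : 0 < Gam x.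
Proof. by rewrite /Gam divr_gt0 ?onepE_gt0// exprn_gt0. Qed.

Lemma ln_arg : 0 < 1 + Gam x * r.
Proof. by rewrite ltr_wpDr// mulr_ge0// ltW// Gam_gt0. Qed.

Lemma ln_Gam : 0 <= ln (1 + Gam x * r) <= Gam x * r.
Proof.
have g0 : 0 <= Gam x * r by rewrite mulr_ge0// ltW// Gam_gt0.
rewrite ln_ge0 ?lerDl//= le_ln1Dx//; exact: lt_le_trans g0.
Qed.

Lemma Qf_gt0 : 0 < Qf x r.
Proof. by rewrite /Qf -addrA ltr_wpDr ?exprn_gt0// addr_ge0// mulr_ge0// expR_ge0. Qed.

Lemma Bf_Gam : Bf x * Gam x = Af x.
Proof.
have h := onepE_gt0; rewrite /Bf /Gam /Af; field.
by rewrite !gt_eqF.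
Qed.

Lemma Bf_ge0 : 0 <= Bf x.
Proof. by rewrite /Bf divr_ge0 ?sqr_ge0// mulr_ge0 ?sqr_ge0// expR_ge0. Qed.

Lemma Af01 : 0 <= Af x <= 1.
Proof.
have h := onepE_gt0; have E0 := expR_ge0 x.
by rewrite /Af divr_ge0 ?(ltW h)//= ler_pdivrMr// mul1r lerDr.
Qed.

Lemma Phi_bounds : 0 <= Phi x r <= r.
Proof.
have /andP[l0 l1] := ln_Gam; have b0 := Bf_ge0; have /andP[a0 a1] := Af01.
have := ler_wpM2l b0 l1; rewrite mulrA Bf_Gam => h.
have h2 : 0 <= Bf x * ln (1 + Gam x * r) by rewrite mulr_ge0.
have h3 : Af x * r <= r by rewrite ler_piMl.
by rewrite /Phi; apply/andP; split; lra.
Qed.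

Lemma wf01 : 0 <= wf x r <= 1.
Proof.
have q0 := Qf_gt0; have E0 := expR_ge0 x.
apply/andP; split; first by rewrite /wf; apply: divr_ge0; [exact: mulr_ge0|exact: ltW].
have x2 := sqr_ge0 x; rewrite /wf ler_pdivrMr// mul1r /Qf [r * _]mulrC lerDr.
exact: addr_ge0.
Qed.

(** The logarithmic derivatives of [Bf] and [Gam] are at most [1 + 2 / x] in size, and
    [Bf * Gam = Af <= 1]. The singularity [1 / x] is harmless because [Phix] is tested against
    [x^2 psi1]. *)
Lemma Phix_bound : `|Phix x r| <= (3 + 4 / x) * r.
Proof.
have /andP[l0 l1] := ln_Gam; have b0 := Bf_ge0; have /andP[a0 a1] := Af01.
have h := onepE_gt0; have E0 := expR_gt0 x; have g0 := Gam_gt0; have la := ln_arg.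
set E := expR x in h E0 *.
have xn : x != 0 by rewrite gt_eqF.
have En : 1 + E != 0 by rewrite gt_eqF.
have xi : 0 <= 2 / x by rewrite divr_ge0// ltW.
have A1 : 0 <= Af1 x <= 1.
  rewrite /Af1 -/E divr_ge0 ?sqr_ge0 ?(ltW E0)//= ler_pdivrMr ?exprn_gt0// mul1r.
  have := sqr_ge0 E; rewrite sqrrD expr1n mul1r mulr2n; lra.
have B1 : `|Bf1 x| <= (1 + 2 / x) * Bf x.
  have -> : Bf1 x = (2 / x + (1 - 2 * Af x)) * Bf x.
    by rewrite /Bf1 /Bf /Af -/E; field; rewrite xn En.
  rewrite normrM (ger0_norm b0) ler_wpM2r// (le_trans (ler_normD _ _))//.
  rewrite (ger0_norm xi) addrC lerD2r ler_norml; lra.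
have G1 : `|Gam1 x| <= (1 + 2 / x) * Gam x.
  have -> : Gam1 x = (Af x - 2 / x) * Gam x.
    by rewrite /Gam1 /Gam /Af -/E; field; rewrite xn En.
  rewrite normrM (gtr0_norm g0) ler_wpM2r ?(ltW g0)// (le_trans (ler_normB _ _))//.
  by rewrite (ger0_norm xi) (ger0_norm a0) lerD2r.
have T1 : `|Af1 x * r| <= r.
  by case/andP: A1 => A10 A11; rewrite ger0_norm ?mulr_ge0// ler_piMl.
have xi1 : 0 <= 1 + 2 / x by lra.
have T2 : `|Bf1 x * ln (1 + Gam x * r)| <= (1 + 2 / x) * r.
  rewrite normrM (ger0_norm l0).
  have := ler_pM (normr_ge0 _) l0 B1 l1.
  have -> : (1 + 2 / x) * Bf x * (Gam x * r) = (1 + 2 / x) * ((Bf x * Gam x) * r) by ring.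
  rewrite Bf_Gam => h1; apply: (le_trans h1).
  by rewrite ler_wpM2l// ler_piMl.
have T3 : `|Bf x * (Gam1 x * r) / (1 + Gam x * r)| <= (1 + 2 / x) * r.
  rewrite normrM normfV (gtr0_norm la) ler_pdivrMr//.
  rewrite normrM (ger0_norm b0) normrM (ger0_norm r0).
  apply: (@le_trans _ _ (Bf x * ((1 + 2 / x) * Gam x * r))).
    by rewrite ler_wpM2l// ler_wpM2r.
  have -> : Bf x * ((1 + 2 / x) * Gam x * r) = (1 + 2 / x) * ((Bf x * Gam x) * r) by ring.
  rewrite Bf_Gam.
  have gr : 0 <= Gam x * r by rewrite mulr_ge0// ltW.
  have q1 : Af x * r <= r by rewrite ler_piMl.
  have q2 : r <= r * (1 + Gam x * r) by rewrite ler_peMr// lerDl.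
  have := ler_wpM2l xi1 (le_trans q1 q2); lra.
rewrite /Phix; apply: (le_trans (ler_normB _ _)).
apply: (le_trans (lerD (ler_normB _ _) (lexx _))).
have -> : (3 + 4 / x) * r = r + (1 + 2 / x) * r + (1 + 2 / x) * r by field.
by apply: lerD => //; exact: lerD.
Qed.

End pointwise.

Lemma phiw_d x : 0 < x ->
  D1 (fun x => 1 - (Num.sqrt (1 + x))^-1) x ((2 * Num.sqrt (1 + x) ^+ 3)^-1).
Proof.
move=> x0; have s0 : 0 < 1 + x by rewrite ltr_wpDr// ltW.
have r0 : 0 < Num.sqrt (1 + x) by rewrite sqrtr_gt0.
have rn : Num.sqrt (1 + x) != 0 by rewrite gt_eqF.
apply: deq; first by repeat first [dstep|by []].
by rewrite /=; field.
Qed.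

Lemma phiw1_d x : 0 < x ->
  D1 (fun x => (2 * Num.sqrt (1 + x) ^+ 3)^-1) x (- 3 / (4 * Num.sqrt (1 + x) ^+ 5)).
Proof.
move=> x0; have s0 : 0 < 1 + x by rewrite ltr_wpDr// ltW.
have r0 : 0 < Num.sqrt (1 + x) by rewrite sqrtr_gt0.
have rn : Num.sqrt (1 + x) != 0 by rewrite gt_eqF.
apply: deq; first by repeat first [dstep|by []|by rewrite mulf_neq0 ?expf_neq0].
by rewrite /=; field.
Qed.

(* Since [x^2 phiw1 x] is unbounded, the drift of [phiw]-weighted mass controls
   the photons at large energy. *)
Definition phiw x : R := 1 - (Num.sqrt (1 + x))^-1.
Definition phiw1 x : R := (2 * Num.sqrt (1 + x) ^+ 3)^-1.
Definition phiw2 x : R := - 3 / (4 * Num.sqrt (1 + x) ^+ 5).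

Lemma sq1 x : 0 < x -> 1 <= Num.sqrt (1 + x) /\ Num.sqrt (1 + x) ^+ 2 = 1 + x.
Proof.
move=> x0; split; last by rewrite sqr_sqrtr//; lra.
by rewrite -[X in X <= _]sqrtr1 ler_wsqrtr//; lra.
Qed.

Lemma phiw01 x : 0 < x -> 0 <= phiw x <= 1.
Proof.
move=> x0; have [s1 _] := sq1 x0; have s0 : 0 < Num.sqrt (1 + x) by exact: lt_le_trans s1.
have : 0 < (Num.sqrt (1 + x))^-1 by rewrite invr_gt0.
have : (Num.sqrt (1 + x))^-1 <= 1 by rewrite invf_le1.
rewrite /phiw => h1 h2; apply/andP; split; lra.
Qed.

Lemma phiw1_gt0 x : 0 < x -> 0 < phiw1 x.
Proof.
move=> x0; have [s1 _] := sq1 x0; have s0 : 0 < Num.sqrt (1 + x) by exact: lt_le_trans s1.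
by rewrite /phiw1 invr_gt0 mulr_gt0// exprn_gt0.
Qed.

Lemma xphiw1 x : 0 < x -> 0 <= x * phiw1 x <= 1 / 2.
Proof.
move=> x0; have [s1 s2] := sq1 x0; have s0 : 0 < Num.sqrt (1 + x) by exact: lt_le_trans s1.
rewrite mulr_ge0 ?(ltW x0) ?(ltW (phiw1_gt0 x0))//=.
rewrite /phiw1 exprS s2 ler_pdivrMr; last by rewrite !mulr_gt0//; lra.
have : 0 <= (Num.sqrt (1 + x) - 1) * (1 + x) by rewrite mulr_ge0//; lra.
lra.
Qed.

Lemma phiw2_cpos : cpos phiw2.
Proof.
rewrite /phiw2; repeat cstep.
move=> x x0; have [s1 _] := sq1 x0; rewrite mulf_neq0 ?expf_neq0// gt_eqF//.
exact: lt_le_trans s1.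
Qed.

Lemma phiw2_le0 x : 0 < x -> phiw2 x <= 0.
Proof.
move=> x0; have [s1 _] := sq1 x0; have s0 : 0 < Num.sqrt (1 + x) by exact: lt_le_trans s1.
by rewrite /phiw2 mulNr oppr_le0 divr_ge0// mulr_ge0// exprn_ge0// ltW.
Qed.

Variables (n0 : R -> R) (n : R -> R -> R).
Hypothesis sol : kompaneets_solution n0 n.

Definition dissip (n : R -> R -> R) t x : R := expR x * flux n x t ^+ 2 / Qf x (n x t) ^+ 2.
Definition Dk (n : R -> R -> R) k t : R := Jk k (fun x => psi k x * dissip n t x).
Definition tight (n : R -> R -> R) t x : R := phiw1 x * ((x ^+ 2 + n x t) * n x t).
Definition tauk (n : R -> R -> R) k t : R := Jk k (fun x => psi k x * tight n t x).
Definition Ent (n : R -> R -> R) t : R := ID H (fun x => Phi x (n x t)).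
Definition Entk (n : R -> R -> R) k t : R := Jk k (fun x => psi k x * Phi x (n x t)).

Lemma Phi_d1 x t : 0 < x -> 0 < t -> D1 (fun s => Phi x (n x s)) t (wf x (n x t) * dt n x t).
Proof.
move=> x0 t0; have r0 := n_ge0 sol x0 (ltW t0).
have la := ln_arg x0 r0; have q0 := Qf_gt0 x0 r0; have h := onepE_gt0 x.
rewrite /Phi; apply: deq; first by repeat first [dstep|exact: (n_dt sol)|by []].
rewrite /=; have xn : x != 0 by rewrite gt_eqF.
have En : 1 + expR x != 0 by rewrite gt_eqF.
have Ln : 1 + Gam x * n x t != 0 by rewrite gt_eqF.
move: Ln; rewrite /wf /Qf /Af /Bf /Gam => Ln.
have Qn : x ^+ 2 + n x t + n x t * expR x != 0 by move: q0; rewrite /Qf => q0; rewrite gt_eqF.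
field.
by rewrite Qn xn En.
Qed.

Lemma Phi_d2 x t : 0 < x -> 0 < t ->
  D1 (fun y => Phi y (n y t)) x (wf x (n x t) * dx n x t + Phix x (n x t)).
Proof.
move=> x0 t0; have r0 := n_ge0 sol x0 (ltW t0).
have la := ln_arg x0 r0; have q0 := Qf_gt0 x0 r0; have h := onepE_gt0 x.
have xn : x != 0 by rewrite gt_eqF.
have En : 1 + expR x != 0 by rewrite gt_eqF.
have Ln : 1 + Gam x * n x t != 0 by rewrite gt_eqF.
have dA : D1 Af x (Af1 x).
  rewrite /Af; apply: deq; first by repeat first [dstep|by []].
  by rewrite /Af1 /=; field.
have dB : D1 Bf x (Bf1 x).
  rewrite /Bf; apply: deq; first by repeat first [dstep|by rewrite expf_neq0].
  by rewrite /Bf1 /=; field.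
have dG : D1 Gam x (Gam1 x).
  rewrite /Gam; apply: deq; first by repeat first [dstep|by rewrite expf_neq0].
  by rewrite /Gam1 /=; field.
rewrite /Phi; apply: deq; first by repeat first [dstep|exact: dA|exact: dB|exact: dG|exact: (n_dx sol)|by []].
have -> : wf x (n x t) = Af x - Bf x * Gam x / (1 + Gam x * n x t).
  move: Ln; rewrite /wf /Qf /Af /Bf /Gam => Ln.
  have Qn : x ^+ 2 + n x t + n x t * expR x != 0 by move: q0; rewrite /Qf => q0; rewrite gt_eqF.
  field; rewrite xn En andbT.
  by have -> : x ^+ 2 + (1 + expR x) * n x t = x ^+ 2 + n x t + n x t * expR x by ring.
by rewrite /Phix /=; field.
Qed.

Lemma wf_dx x t : 0 < x -> 0 < t ->
  D1 (fun y => wf y (n y t)) x (expR x * flux n x t / Qf x (n x t) ^+ 2).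
Proof.
move=> x0 t0; have r0 := n_ge0 sol x0 (ltW t0); have q0 := Qf_gt0 x0 r0.
have Qn : Qf x (n x t) != 0 by rewrite gt_eqF.
move: Qn; rewrite /wf /Qf => Qn.
apply: deq; first by repeat first [dstep|exact: (n_dx sol)|by []].
by rewrite /flux /=; field.
Qed.

Lemma wfx_cpos t : 0 < t -> cpos (fun x => expR x * flux n x t / Qf x (n x t) ^+ 2).
Proof.
move=> t0; have cn := n_cpos sol t0; have cf := flux_cpos sol t0; rewrite /Qf.
repeat first [cstep|assumption].
by move=> x x0; rewrite expf_neq0// gt_eqF//; exact: Qf_gt0 x0 (n_ge0 sol x0 (ltW t0)).
Qed.

Lemma Phix_cpos t : 0 < t -> cpos (fun x => Phix x (n x t)).
Proof.
move=> t0; have cn := n_cpos sol t0.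
have hp x : 0 < x -> 0 < 1 + Gam x * n x t.
  by move=> x0; exact: ln_arg x0 (n_ge0 sol x0 (ltW t0)).
have cG : cpos Gam.
  rewrite /Gam; repeat cstep.
  by move=> x x0; rewrite expf_neq0// gt_eqF.
have cB : cpos Bf.
  rewrite /Bf; repeat cstep.
  by move=> x x0; rewrite expf_neq0// gt_eqF// onepE_gt0.
have cB1 : cpos Bf1.
  by rewrite /Bf1; repeat first [cstep|move=> x x0; rewrite expf_neq0// gt_eqF// onepE_gt0].
have cG1 : cpos Gam1.
  by rewrite /Gam1; repeat first [cstep|move=> x x0; rewrite expf_neq0// gt_eqF].
have cA1 : cpos Af1.
  by rewrite /Af1; repeat first [cstep|move=> x x0; rewrite expf_neq0// gt_eqF// onepE_gt0].
rewrite /Phix.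
by repeat first [cstep|assumption|move=> x x0; rewrite gt_eqF// hp].
Qed.

(** The derivative of [wf] times the flux is exactly [dissip], which produces [- Dk]. Everything
    else carries a derivative of [psi k]. The constant 66 is 36 + 22 + 8 from [T1], [T2] and [T3];
    of the four copies of [Fk], three come from [T2] and one from [T3]. *)
Lemma entropy_cut k t : 1 < k -> 0 < t ->
  exists2 D, D1 (Entk n k) t D & D <= 66 * eps n k t + 4 * Fk n k t - Dk n k t.
Proof.
move=> k1 t0; have k0 := lt_trans ltr01 k1; have t0' := ltW t0.
have E4 x s : 0 < x -> 0 < s -> `|wf x (n x s)| <= 1.
  move=> x0 s0; have /andP[h1 h2] := wf01 x0 (n_ge0 sol x0 (ltW s0)).
  by rewrite ger0_norm.
have [pa p1a] := psi_a k0; have [pb p1b] := psi_b k0.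
have hD := @entropy_derive R n0 n sol (psi k) (psi1 k) (psi2 k) (fun x t => Phi x (n x t))
  (fun x t => wf x (n x t)) (fun x t => Phix x (n x t))
  (fun x t => expR x * flux n x t / Qf x (n x t) ^+ 2) k^-1 k 1 t
  (kinv_gt0 k1) (kinv_lt k1) t0 (fun x px => psi_d k0 px)
  (fun x px => psi1_d k0 px) (psi2_cpos k0) pa pb p1a p1b Phi_d1 Phi_d2 wf_dx E4 Phix_cpos wfx_cpos.
eexists; first exact: hD.
have cE : cpos (fun x => Phi x (n x t)) by move=> x x0; exact: dcont (Phi_d2 x0 t0).
have cw : cpos (fun x => wf x (n x t)) by move=> x x0; exact: dcont (wf_dx x0 t0).
have cEx := Phix_cpos t0; have cGx := wfx_cpos t0.
have cn := n_cpos sol t0; have cp := psi_cpos k0; have cp1 := psi1_cpos k0; have cp2 := psi2_cpos k0.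
have cfl := flux_cpos sol t0.
have mab : mR `[k^-1, k] by exact: measurable_itv.
have sub : `[k^-1, k]%classic `<=` H by apply: ccH; exact: kinv_gt0.
have cds : cpos (fun x => psi k x * dissip n t x).
  apply: cposM => //; rewrite /dissip /Qf; repeat first [cstep|assumption].
  by move=> x x0; rewrite expf_neq0// gt_eqF//; exact: Qf_gt0 x0 (n_ge0 sol x0 t0').
have cg := (cut_cpos sol k0 t0 (@cpos_cst R 1)).2.
have i1 : itg `[k^-1, k] (fun x => rho k x * n x t).
  by apply: itgS (itg_rhon sol k0 t0') => //; exact: mH.
have i2 : itg `[k^-1, k] (fun x => 66 * (rho k x * n x t)) by exact: itgZ.
have i3 : itg `[k^-1, k] (fun x => 4 * gain n (fun=> 1) k t x) by apply: itgZ => //; exact: itg_Jk.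
have i4 : itg `[k^-1, k] (fun x => psi k x * dissip n t x) by exact: itg_Jk.
apply: (@le_trans _ _ (ID `[k^-1, k] (fun x => 66 * (rho k x * n x t) + 4 * gain n (fun=> 1) k t x
     - psi k x * dissip n t x))); last first.
  rewrite IDB//; last exact: itgD.
  rewrite IDD// !IDZ//; last exact: itg_Jk.
  rewrite lerD2r lerD2r ler_wpM2l//; apply: ID_subset => //; first exact: mH.
    exact: (itg_rhon sol).
  by move=> x /Hpos x0; rewrite mulr_ge0 ?rho_ge0// (n_ge0 sol).
apply: IDle => //.
- exact: itg_Jk (entropy_integrand_cpos cp cp1 cp2 cE cEx cw cn cfl cGx).
- by apply: itgB => //; exact: itgD.
move=> x /=; rewrite in_itv/= => kx.
have x0 := x_gt0 k1 kx; have r0 := n_ge0 sol x0 t0'; have xn : x != 0 by rewrite gt_eqF.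
have rh := rho_ge0 k0 x0.
have /andP[F0 F1] := Phi_bounds x0 r0; have /andP[w0 w1] := wf01 x0 r0.
have Fx := Phix_bound x0 r0.
have b1 := xpsi1_rho k1 kx; have b2 := x2psi2_rho k1 kx; have kV := kV_rho k1 kx.
have p01 := pc01 k1 kx; have q01 := qc01 k1 kx.
pose A := 2 * pc k x * (k * x ^+ 2)^-1 * qc k x ^+ 2.
pose B := 2 * pc k x ^+ 2 * qc k x / k.
have EAB : psi1 k x = A - B by [].
have A0 : 0 <= A.
  have -> : A = 2 * (k * x ^+ 2)^-1 * (pc k x * qc k x ^+ 2) by rewrite /A; ring.
  have /andP[v0 _] := prod01 p01 (sqr01 q01).
  have kx2 : 0 <= (k * x ^+ 2)^-1 by rewrite invr_ge0; apply: mulr_ge0; [exact: ltW|exact: sqr_ge0].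
  by apply: mulr_ge0 => //; exact: mulr_ge0.
have Ax2 : A * x ^+ 2 <= 2 * rho k x.
  have -> : A * x ^+ 2 = 2 * k^-1 * (pc k x * qc k x ^+ 2).
    by rewrite /A; field; rewrite !gt_eqF.
  have kk : 0 <= 2 * k^-1 by rewrite mulr_ge0// invr_ge0 ltW.
  have /andP[_ v1] := mul01 kk (prod01 p01 (sqr01 q01)).
  lra.
have B0 : 0 <= B.
  have -> : B = 2 * k^-1 * (pc k x ^+ 2 * qc k x) by rewrite /B; ring.
  have /andP[v0 _] := prod01 (sqr01 p01) q01.
  by apply: mulr_ge0 => //; apply: mulr_ge0 => //; rewrite invr_ge0 ltW.
have gE : gain n (fun=> 1) k t x = B * x ^+ 2 * n x t + B * n x t ^+ 2.
  by rewrite /gain /B; ring.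
have x20 := sqr_ge0 x; have n20 := sqr_ge0 (n x t).
have Bx0 : 0 <= B * x ^+ 2 * n x t by apply: mulr_ge0 => //; exact: mulr_ge0.
have Bn0 : 0 <= B * n x t ^+ 2 by exact: mulr_ge0.
have T1 : (x ^+ 2 * psi2 k x + 2 * x * psi1 k x) * Phi x (n x t) <= 36 * rho k x * n x t.
  apply: le_trans (ler_norm _) _; rewrite normrM (ger0_norm F0); apply: ler_pM => //.
  apply: (le_trans (ler_normD _ _)).
  by rewrite -mulrA [`|2 * _|]normrM normr_nat; lra.
(* The lower half of [psi1] times [x^2] is at most [2 rho]; the upper half times [x^2 n] is part of
   the inflow density; and [4 / x] combines with [x^2 psi1] into the bounded [x psi1]. *)
have T2 : psi1 k x * x ^+ 2 * Phix x (n x t) <= 22 * rho k x * n x t + 3 * (B * x ^+ 2 * n x t).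
  have xA : `|psi1 k x| * x ^+ 2 <= 2 * rho k x + B * x ^+ 2.
    apply: (@le_trans _ _ ((A + B) * x ^+ 2)).
      by rewrite ler_wpM2r// EAB (le_trans (ler_normB _ _))// (ger0_norm A0) (ger0_norm B0).
    lra.
  apply: le_trans (ler_norm _) _; rewrite normrM [`|psi1 k x * _|]normrM (ger0_norm x20).
  apply: (@le_trans _ _ (`|psi1 k x| * x ^+ 2 * ((3 + 4 / x) * n x t))).
    by rewrite ler_wpM2l//; exact: mulr_ge0.
  have -> : `|psi1 k x| * x ^+ 2 * ((3 + 4 / x) * n x t) =
     3 * ((`|psi1 k x| * x ^+ 2) * n x t) + 4 * ((x * `|psi1 k x|) * n x t) by field.
  have q1 := ler_wpM2r r0 xA.
  have q2 : x * `|psi1 k x| * n x t <= 4 * rho k x * n x t.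
    have -> : x * `|psi1 k x| = `|x * psi1 k x| by rewrite normrM (gtr0_norm x0).
    exact: ler_wpM2r.
  lra.
have T3 : - psi1 k x * wf x (n x t) * ((x ^+ 2 - 2 * x) * n x t + n x t ^+ 2) <=
    8 * rho k x * n x t + (B * x ^+ 2 * n x t + B * n x t ^+ 2).
  have -> : - psi1 k x * wf x (n x t) * ((x ^+ 2 - 2 * x) * n x t + n x t ^+ 2) =
    wf x (n x t) * (B * x ^+ 2 * n x t + B * n x t ^+ 2) - wf x (n x t) * A * (x ^+ 2 * n x t + n x t ^+ 2)
    + wf x (n x t) * (2 * (x * psi1 k x) * n x t) by rewrite EAB; ring.
  have q1 : wf x (n x t) * (B * x ^+ 2 * n x t + B * n x t ^+ 2) <= B * x ^+ 2 * n x t + B * n x t ^+ 2.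
    by rewrite ler_piMl// addr_ge0.
  have q2 : 0 <= wf x (n x t) * A * (x ^+ 2 * n x t + n x t ^+ 2).
    by apply: mulr_ge0; [exact: mulr_ge0|apply: addr_ge0 => //; exact: mulr_ge0].
  have q3 : wf x (n x t) * (2 * (x * psi1 k x) * n x t) <= 1 * (8 * rho k x * n x t).
    apply: le_trans (ler_norm _) _; rewrite normrM; apply: ler_pM => //; first by rewrite ger0_norm.
    rewrite normrM (ger0_norm r0) ler_wpM2r// normrM normr_nat; lra.
  lra.
have T4 : psi k x * (expR x * flux n x t / Qf x (n x t) ^+ 2) * flux n x t = psi k x * dissip n t x.
  by rewrite /dissip; ring.
rewrite gE -T4.
lra.
Qed.

Lemma phiw_loss k t : 1 < k -> 0 < t -> 0 <= Jk k (loss n phiw k t).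
Proof.
move=> k1 t0; apply: ID_ge0 => x /=; rewrite in_itv/= => kx.
have x0 := x_gt0 k1 kx; have [_ /andP[h _]] := loss_weight k1 kx.
have /andP[f0 _] := phiw01 x0.
by rewrite /loss; apply: mulr_ge0; [exact: mulr_ge0|exact: sqr_ge0].
Qed.

Definition Tk (n : R -> R -> R) k t : R := Jk k (fun x => phiw x * psi k x * n x t).

Lemma phiw_cpos : cpos phiw.
Proof. by move=> x x0; exact: dcont (phiw_d x0). Qed.
Lemma phiw1_cpos : cpos phiw1.
Proof. by move=> x x0; exact: dcont (phiw1_d x0). Qed.

(** Concavity of [phiw] discards the diffusion term, [4 x phiw1 <= 2] gives the multiple of the
    mass, and the remaining drift [- (x^2 + n) phiw1] is [- tight] after multiplication by [n]. The
    outflow has the favourable sign. *)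
Lemma weight_cut k t : 1 < k -> 0 < t ->
  exists2 D, D1 (Tk n k) t D & D <= 2 * mass n t + 54 * eps n k t + Fk n k t - tauk n k t.
Proof.
move=> k1 t0; have k0 := lt_trans ltr01 k1; have t0' := ltW t0.
have p1 x : 0 < x -> `|phiw x| <= 1 by move=> x0; have /andP[h1 h2] := phiw01 x0; rewrite ger0_norm.
have p2 x : 0 < x -> `|x * phiw1 x| <= 1.
  by move=> x0; have /andP[h1 h2] := xphiw1 x0; rewrite ger0_norm//; lra.
have [e he hd] := weak_form sol k1 t0 phiw_d phiw1_d phiw2_cpos (@ler01 R) p1 p2.
exists (Jk k (fun x => psi k x * Lop n phiw1 phiw2 t x * n x t) -
        Jk k (loss n phiw k t) + Jk k (gain n phiw k t) + e) => //.
have l0 := phiw_loss k1 t0.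
have cn := n_cpos sol t0; have cp := psi_cpos k0; have cf := phiw_cpos; have cf1 := phiw1_cpos.
have cL := Lop_cpos sol t0 phiw1_cpos phiw2_cpos.
have [_ cg] := cut_cpos sol k0 t0 cf.
have [_ cg1] := cut_cpos sol k0 t0 (@cpos_cst R 1).
have mab : mR `[k^-1, k] by exact: measurable_itv.
have g1 : Jk k (gain n phiw k t) <= Fk n k t.
  apply: IDle => //; [exact: itg_Jk|exact: itg_Jk|].
  move=> x /=; rewrite in_itv/= => kx; have x0 := x_gt0 k1 kx.
  have /andP[f0 f1] := phiw01 x0; have nn := n_ge0 sol x0 t0'.
  have p01 := pc01 k1 kx; have q01 := qc01 k1 kx.
  have B0 : 0 <= 2 * pc k x ^+ 2 * qc k x / k.
    have -> : 2 * pc k x ^+ 2 * qc k x / k = 2 * k^-1 * (pc k x ^+ 2 * qc k x) by ring.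
    have /andP[v0 _] := prod01 (sqr01 p01) q01.
    by apply: mulr_ge0 => //; apply: mulr_ge0 => //; rewrite invr_ge0 ltW.
  rewrite /gain; apply: ler_wpM2r; last exact: ler_wpM2r.
  by apply: mulr_ge0 => //; apply: addr_ge0 => //; exact: sqr_ge0.
have cti : cpos (fun x => psi k x * tight n t x).
  by rewrite /tight; repeat first [cstep|assumption].
have L1 : Jk k (fun x => psi k x * Lop n phiw1 phiw2 t x * n x t) <= 2 * mass n t - tauk n k t.
  have i1 : itg `[k^-1, k] (fun x => 2 * n x t).
    by apply: itg_Jk => //; repeat first [cstep|assumption].
  apply: (@le_trans _ _ (ID `[k^-1, k] (fun x => 2 * n x t - psi k x * tight n t x))).
    apply: IDle => //.
    - by apply: itg_Jk => //; repeat first [cstep|assumption].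
    - by apply: itgB => //; exact: itg_Jk.
    move=> x /=; rewrite in_itv/= => kx; have x0 := x_gt0 k1 kx.
    have nn := n_ge0 sol x0 t0'; have /andP[s0 s1] := psi01 k1 kx.
    have /andP[x1 x2] := xphiw1 x0; have f2 := phiw2_le0 x0.
    have h1 : psi k x * (x ^+ 2 * phiw2 x) * n x t <= 0.
      have : 0 <= psi k x * (x ^+ 2 * - phiw2 x) * n x t.
        apply: mulr_ge0 => //; apply: mulr_ge0 => //; apply: mulr_ge0; first exact: sqr_ge0.
        by rewrite oppr_ge0.
      lra.
    have h2 : psi k x * (x * phiw1 x) * n x t <= 1 * (1 / 2) * n x t.
      by rewrite ler_wpM2r//; exact: ler_pM.
    rewrite /Lop /tight; lra.
  rewrite IDB//; last exact: itg_Jk.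
  rewrite lerD2r IDZ//; last by apply: itg_Jk.
  rewrite ler_wpM2l//; apply: ID_cc_le => //; [exact: kinv_gt0|exact: itg_Jk|exact: (n_itg sol)|].
  by move=> x x0; exact: (n_ge0 sol).
move: he; rewrite mulr1 ler_norml => /andP[_ he].
lra.
Qed.

End Entropy.

(** * Times of small dissipation in a unit interval *)

Section GoodTimes.
Variable R : realType.
Local Notation mu := (@lebesgue_measure R).
Local Notation mR := (@measurable _ (measurableTypeR R)).
Local Notation H := (@halfline R).
Implicit Types (x y t s a b c d e k T h tau u m th A K : R) (f g : R -> R).
Variables (n0 : R -> R) (n : R -> R -> R).
Hypothesis sol : kompaneets_solution n0 n.

Lemma mass_mono s t : 0 < s -> s <= t -> mass n t <= mass n s.
Proof.
move=> s0; rewrite le_eqVlt => /predU1P[->//|st].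
have [_ h] := mass_balance sol s0 st.
have : 0 <= ID `[s, t] (fun tau => trace0 n tau ^+ 2) by apply: ID_ge0 => u _; exact: sqr_ge0.
lra.
Qed.

Lemma Phi_cpos t : 0 < t -> cpos (fun x => Phi x (n x t)).
Proof. by move=> t0 x x0; exact: dcont (Phi_d2 sol x0 t0). Qed.

Lemma Phi_le t x : 0 < t -> 0 < x -> 0 <= Phi x (n x t) <= n x t.
Proof. by move=> t0 x0; exact: Phi_bounds x0 (n_ge0 sol x0 (ltW t0)). Qed.

Lemma Entk_Ent k t : 1 < k -> 0 < t -> `|Entk n k t - Ent n t| <= 4 * eps n k t.
Proof.
move=> k1 t0; apply: (@cut_approx_gen R (fun x => Phi x (n x t)) (fun x => n x t) k k1).
- exact: cpos_mfun (Phi_cpos t0).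
- exact: (n_itg sol (ltW t0)).
by move=> x x0; have /andP[p0 p1] := Phi_le t0 x0; rewrite ger0_norm.
Qed.

Lemma Tk_bounds k t : 1 < k -> 0 < t -> 0 <= Tk n k t <= mass n t.
Proof.
move=> k1 t0; have k0 := lt_trans ltr01 k1.
have pt x : k^-1 <= x <= k -> 0 <= phiw x * psi k x * n x t <= n x t.
  move=> kx; have x0 := x_gt0 k1 kx; have nn := n_ge0 sol x0 (ltW t0).
  by rewrite mulrC; apply: mul01 nn (prod01 (phiw01 x0) (psi01 k1 kx)).
apply/andP; split.
  by apply: ID_ge0 => x /=; rewrite in_itv/= => /pt/andP[].
apply: ID_cc_le; [exact: kinv_gt0| |exact: (n_itg sol (ltW t0))| |].
- apply: itg_Jk => //; have cn := n_cpos sol t0; have cp := psi_cpos k0; have cw := @phiw_cpos R.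
  by repeat first [assumption|cstep].
- by move=> x x0; exact: (n_ge0 sol x0 (ltW t0)).
- by move=> x /pt/andP[].
Qed.

Lemma dissip_ge0 t x : 0 <= dissip n t x.
Proof.
by apply: divr_ge0; [apply: mulr_ge0; [exact: expR_ge0|exact: sqr_ge0]|exact: sqr_ge0].
Qed.

Lemma Dk_ge0 k t : 1 < k -> 0 <= Dk n k t.
Proof.
move=> k1; apply: ID_ge0 => x /=; rewrite in_itv/= => kx; have /andP[h _] := psi01 k1 kx.
by apply: mulr_ge0 => //; exact: dissip_ge0.
Qed.

Lemma tight_ge0 t x : 0 < t -> 0 < x -> 0 <= tight n t x.
Proof.
move=> t0 x0; have nn := n_ge0 sol x0 (ltW t0).
apply: mulr_ge0; first exact: ltW (phiw1_gt0 x0).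
by apply: mulr_ge0 => //; apply: addr_ge0 => //; exact: sqr_ge0.
Qed.

Lemma tauk_ge0 k t : 1 < k -> 0 < t -> 0 <= tauk n k t.
Proof.
move=> k1 t0; apply: ID_ge0 => x /=; rewrite in_itv/= => kx; have /andP[h _] := psi01 k1 kx.
by apply: mulr_ge0 => //; apply: tight_ge0 => //; exact: x_gt0 k1 kx.
Qed.

Lemma Ent_ge0 t : 0 < t -> 0 <= Ent n t.
Proof. by move=> t0; apply: ID_ge0 => x /Hpos x0; have /andP[] := Phi_le t0 x0. Qed.

(* A mean value argument for [A * entropy + phiw-weighted mass]; the possible
   inflow from infinity enters both with a sign and cancels against [r]. *)
Lemma good_time a A e K : 0 < a -> 0 < A -> 0 < e ->
  exists k xi, [/\ K <= k, 1 < k, a <= xi <= a + 1, eps n k xi <= e &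
    A * Dk n k xi + tauk n k xi <= 3 * mass n a + A * (Ent n a - Ent n (a + 1)) + 1].
Proof.
move=> a0 A0 e0; have aT : a < a + 2 by lra.
have [r [C C0 [dr br]]] := no_influx sol a0 aT.
(* The coefficient of [eps] in the derivative of [Z] is [A (66 + 4 C) + 54 + C]; the endpoints add
   [40 A + 8]. Derivative and endpoint errors then cost at most 1/2 each, the final 1 in the
   statement. *)
pose L := A * (106 + 4 * C) + 62 + C.
have AC : 0 <= A * C by exact: mulr_ge0 (ltW A0) C0.
have L0 : 0 < L by rewrite /L; lra.
have e'0 : 0 < Num.min e (2 * L)^-1 by rewrite lt_min e0 invr_gt0 mulr_gt0.
have [K1 K11 hK] := eps_unif sol (a + 1) e'0.
pose k := Num.max K K1.
have kK : K <= k by rewrite le_max lexx.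
have kK1 : K1 <= k by rewrite le_max lexx orbT.
have k1 : 1 < k by exact: lt_le_trans kK1.
have inI tau : a <= tau <= a + 1 -> a <= tau <= a + 2.
  by move=> /andP[h1 h2]; apply/andP; split => //; lra.
have pos tau : a <= tau <= a + 1 -> 0 < tau by move=> /andP[h _]; exact: lt_le_trans h.
have he tau : a <= tau <= a + 1 -> [/\ 0 <= eps n k tau, eps n k tau <= e & L * eps n k tau <= 1 / 2].
  move=> h; have p := ltW (pos _ h); have q : 0 <= tau <= a + 1 by rewrite p; case/andP: h.
  have := hK k tau kK1 q; rewrite le_min => /andP[h1 h2]; split => //.
    by apply: (eps_ge0 sol) => //; exact: lt_trans k1.
  have := ler_wpM2l (ltW L0) h2; have -> : L * (2 * L)^-1 = 1 / 2 by field; rewrite gt_eqF.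
  by [].
(* Of the three masses, two come from the drift in [weight_cut] and one from the range of [Tk],
   which lies between 0 and the mass. *)
pose Bd := 3 * mass n a + A * (Ent n a - Ent n (a + 1)) + 1.
have [[xi hxi hb]|hn] := pselect (exists2 xi, a <= xi <= a + 1 & A * Dk n k xi + tauk n k xi <= Bd).
  by exists k, xi; split => //; case: (he _ hxi).
have big tau : a <= tau <= a + 1 -> Bd < A * Dk n k tau + tauk n k tau.
  by move=> h; rewrite ltNge; apply/negP => h'; apply: hn; exists tau.
pose Z t := A * (Entk n k t - 4 * r k t) + (Tk n k t - r k t).
have dZ tau : a <= tau <= a + 1 -> exists2 D, D1 Z tau D &
    D <= 2 * mass n a + 1 / 2 - Bd.
  move=> htau; have [d dd hd] := dr k tau k1 (inI _ htau).
  have [D dD hD] := entropy_cut sol k1 (pos _ htau).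
  have [W dW hW] := weight_cut sol k1 (pos _ htau).
  exists (A * (D - 4 * d) + (W - d)).
    apply: dadd; last by apply: dadd => //; exact: dopp.
    apply: deq; first apply: (dmul (dcst A tau)).
      by apply: dadd; [exact: dD|apply: dopp; apply: (dmul (dcst 4 tau)); exact: dd].
    by rewrite /=; ring.
  have [e1 e2 e3] := he _ htau; have b1 := big _ htau.
  have m1 : mass n tau <= mass n a by apply: mass_mono a0 _; case/andP: htau.
  move: hd; rewrite ler_norml => /andP[hd1 hd2].
  have h1 : D - 4 * d <= (66 + 4 * C) * eps n k tau - Dk n k tau by lra.
  have h2 := ler_wpM2l (ltW A0) h1.
  have h3 : 0 <= A * eps n k tau by exact: mulr_ge0 (ltW A0) e1.
  move: e3; rewrite /L => e3; lra.
pose dd tau := if pselect (a <= tau <= a + 1) is left p then sval (cid2 (dZ tau p)) else 0.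
have hdd tau : a <= tau <= a + 1 -> D1 Z tau (dd tau) /\ dd tau <= 2 * mass n a + 1 / 2 - Bd.
  by move=> h; rewrite /dd; case: pselect => // p; case: cid2.
have aa : a <= a + 1 by lra.
have := @mono_of_derive_le R Z dd _ a (a + 1) aa
  (fun x px => (hdd x px).1) (fun x px => (hdd x px).2).
have -> : a + 1 - a = 1 by ring.
rewrite mulr1.
have I0 : a <= a <= a + 1 by rewrite lexx aa.
have I1 : a <= a + 1 <= a + 1 by rewrite lexx aa.
have /andP[t1 t2] := Tk_bounds k1 (pos _ I0).
have /andP[t3 t4] := Tk_bounds k1 (pos _ I1).
have := Entk_Ent k1 (pos _ I0); have := Entk_Ent k1 (pos _ I1).
have := br k _ k1 (inI _ I0); have := br k _ k1 (inI _ I1).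
have [e1 _ e3] := he _ I0; have [e1' _ e3'] := he _ I1.
rewrite !ler_norml => /andP[r1 r1'] /andP[r2 r2'] /andP[u1 u1'] /andP[u2 u2'].
have h1 : Ent n (a + 1) - 20 * eps n k (a + 1) <= Entk n k (a + 1) - 4 * r k (a + 1).
  by move: r1 r1' u1 u1' e1'; clear; lra.
have h2 : Entk n k a - 4 * r k a <= Ent n a + 20 * eps n k a.
  by move: r2 r2' u2 u2' e1; clear; lra.
have := ler_wpM2l (ltW A0) h1; have := ler_wpM2l (ltW A0) h2.
have g1 : 0 <= A * C * eps n k a by exact: mulr_ge0.
have g2 : 0 <= A * C * eps n k (a + 1) by exact: mulr_ge0.
have g3 : 0 <= A * eps n k a by exact: mulr_ge0 (ltW A0) e1.
have g4 : 0 <= A * eps n k (a + 1) by exact: mulr_ge0 (ltW A0) e1'.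
have g5 := mulr_ge0 C0 e1; have g6 := mulr_ge0 C0 e1'.
rewrite /Z /Bd; move: e3 e3'; rewrite /L.
by move: g1 g2 g3 g4 g5 g6 t1 t2 t3 r1 r1' r2 r2' e1 e1'; clear; lra.
Qed.

End GoodTimes.

(** * A tight sequence of times along which the fugacity function becomes constant *)

Section GoodSequence.
Variable R : realType.
Local Notation mu := (@lebesgue_measure R).
Local Notation mR := (@measurable _ (measurableTypeR R)).
Local Notation H := (@halfline R).
Implicit Types (x y t s a b c d e k T h tau u m th A K B L lam : R) (f g : R -> R).
Variables (n0 : R -> R) (n : R -> R -> R).
Hypothesis sol : kompaneets_solution n0 n.

(** The entropy is nonnegative, so it cannot drop by more than [e / C] on every unit interval after
    [T]. On an interval with a smaller drop, [good_time] with [A = (e / C)^-1] bounds [A * Dk] by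
    [C = 3 * mass n 1 + 2], that is, [Dk] by [e]. *)
Lemma good_point T e : 1 <= T -> 0 < e ->
  exists k xi, [/\ T <= k, 1 < k & T <= xi] /\
    [/\ eps n k xi <= e, Dk n k xi <= e & tauk n k xi <= 3 * mass n 1 + 2].
Proof.
move=> T1 e0; have T0 : 0 < T by exact: lt_le_trans T1.
have m1 := mass_ge0 sol (@ler01 R).
have [C C_eq] : exists C, C = 3 * mass n 1 + 2 by eexists.
have C0 : 0 < C by lra.
have h0 : 0 < e / C by rewrite divr_gt0.
pose a i : R := T + i%:R.
have a_ge i : T <= a i by rewrite /a lerDl.
have a_gt0 i : 0 < a i by exact: lt_le_trans (a_ge i).
have [i hi] : exists i, Ent n (a i) - Ent n (a i + 1) <= e / C.
  apply: contrapT => hn.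
  have dec i : Ent n (a i) <= Ent n T - i%:R * (e / C).
    elim: i => [|i IH]; first by rewrite /a addr0 mul0r subr0.
    have -> : a i.+1 = a i + 1 by rewrite /a -natr1 addrA.
    have : e / C < Ent n (a i) - Ent n (a i + 1).
      by rewrite ltNge; apply/negP => h; apply: hn; exists i.
    rewrite -natr1 mulrDl mul1r; lra.
  have E0 : 0 <= Ent n T / (e / C) by apply: divr_ge0; [exact: (Ent_ge0 sol T0)|exact: ltW].
  have := archi_boundP E0; set i := Num.bound _; rewrite ltr_pdivrMr// => h.
  have := Ent_ge0 sol (a_gt0 i); have := dec i; lra.
have A0 : 0 < (e / C)^-1 by rewrite invr_gt0.
have [k [xi [kT k1 /andP[x1 _] he hb]]] := good_time sol T (a_gt0 i) A0 e0.
have xi0 : 0 < xi by exact: lt_le_trans x1.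
have mm : mass n (a i) <= mass n 1 by apply: (mass_mono sol) => //; exact: le_trans (a_ge i).
have hA : (e / C)^-1 * (Ent n (a i) - Ent n (a i + 1)) <= 1 by rewrite mulrC ler_pdivrMr// mul1r.
have t0 := tauk_ge0 sol k1 xi0; have d0 := Dk_ge0 n xi k1.
exists k, xi; split; split => //; first exact: le_trans (a_ge i) x1.
  have : (e / C)^-1 * Dk n k xi <= C by lra.
  by rewrite mulrC ler_pdivrMr// mulrCA divff ?gt_eqF// mulr1.
have := mulr_ge0 (ltW A0) d0; lra.
Qed.

(** Young's inequality [|J| <= lam + J^2 / lam] in the integral of the derivative of [wf]:
    [Q >= x^2] bounds the first part, the second is the dissipation. The conditions [2 / k <= a] and
    [b <= k / 2] keep [psi k >= 1 / 16] on [[a, b]], whence the 16. *)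
Lemma wf_osc a b lam k t : 0 < a -> a <= b -> 1 < k -> 2 / k <= a -> b <= k / 2 -> 0 < lam ->
  0 < t ->
  `|wf b (n b t) - wf a (n a t)| <= lam * (expR b / a ^+ 4 * (b - a)) + 16 / lam * Dk n k t.
Proof.
move=> a0 ab k1 ka bk l0 t0; have k0 := lt_trans ltr01 k1.
have cw := wfx_cpos sol t0.
rewrite -(FTC (F := fun x => wf x (n x t)) a0 ab _ cw); last by move=> x x0; exact: (wf_dx sol).
have mab : mR `[a, b] by exact: measurable_itv.
have mk : mR `[k^-1, k] by exact: measurable_itv.
have cds : cpos (fun x => psi k x * dissip n t x).
  apply: cposM; first exact: psi_cpos.
  have cn := n_cpos sol t0; have cf := flux_cpos sol t0.
  rewrite /dissip /Qf; repeat first [cstep|assumption].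
  by move=> x x0; rewrite expf_neq0// gt_eqF//; exact: Qf_gt0 x0 (n_ge0 sol x0 (ltW t0)).
have i1 : itg `[a, b] (fun x => psi k x * dissip n t x) by exact: itg_cpos.
have i2 : itg `[a, b] (fun x => 16 / lam * (psi k x * dissip n t x)) by exact: itgZ.
have i3 : itg `[a, b] (fun=> lam * (expR b / a ^+ 4)) by apply: itg_cpos => //; exact: cpos_cst.
have ki : k^-1 <= a by apply: le_trans ka; rewrite ler_peMl ?invr_ge0 ?(ltW k0)//; lra.
have sub : `[a, b]%classic `<=` `[k^-1, k]%classic.
  move=> x /=; rewrite !in_itv/= => /andP[h1 h2]; apply/andP; split; lra.
have l16 : 0 <= 16 / lam by apply: divr_ge0 => //; exact: ltW.
apply: (@le_trans _ _ (ID `[a, b] (fun x => lam * (expR b / a ^+ 4) + 16 / lam * (psi k x * dissip n t x)))).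
  apply: IDabs_le => //; [exact: itg_cpos|exact: itgD|].
  move=> x /=; rewrite in_itv/= => /andP[ax xb].
  have x0 : 0 < x by exact: lt_le_trans ax.
  have q0 := Qf_gt0 x0 (n_ge0 sol x0 (ltW t0)).
  set Q := Qf _ _ in q0 *; set J := flux n x t.
  have psi16 : 1 / 16 <= psi k x.
    have h1 : 1 / 2 <= pc k x.
      have : (k * x)^-1 <= 1 / 2.
        rewrite -[_^-1]mul1r ler_pdivrMr ?mulr_gt0//.
        have : 2 / k * k <= x * k by rewrite ler_wpM2r ?(ltW k0)// (le_trans ka).
        rewrite mulfVK ?gt_eqF//; lra.
      rewrite /pc; lra.
    have h2 : 1 / 2 <= qc k x.
      have : x / k <= 1 / 2 by rewrite ler_pdivrMr//; lra.
      rewrite /qc; lra.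
    have p1 : (1 / 2) ^+ 2 <= pc k x ^+ 2 by rewrite ler_pXn2r// nnegrE; lra.
    have p2 : (1 / 2) ^+ 2 <= qc k x ^+ 2 by rewrite ler_pXn2r// nnegrE; lra.
    have hh : 0 <= (1 / 2 : R) ^+ 2 by exact: sqr_ge0.
    have := ler_pM hh hh p1 p2; rewrite /psi; lra.
  have ds0 := dissip_ge0 n t x.
  have : 1 / 16 * dissip n t x <= psi k x * dissip n t x by exact: ler_wpM2r.
  move=> dd.
  have d1 : 16 / lam * (1 / 16 * dissip n t x) <= 16 / lam * (psi k x * dissip n t x) by exact: ler_wpM2l.
  have E0 := expR_ge0 x.
  have xQ : x ^+ 2 <= Q.
    have nn := n_ge0 sol x0 (ltW t0).
    by rewrite /Q /Qf -addrA lerDl addr_ge0// mulr_ge0.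
  have x20 : 0 < x ^+ 2 by exact: exprn_gt0.
  have a40 : 0 < a ^+ 4 by exact: exprn_gt0.
  have aQ : a ^+ 4 <= Q ^+ 2.
    have -> : a ^+ 4 = (a ^+ 2) ^+ 2 by ring.
    rewrite ler_pXn2r// ?nnegrE ?sqr_ge0 ?(ltW q0)//; apply: le_trans xQ.
    by rewrite ler_pXn2r// nnegrE ltW.
  have eQ : expR x / Q ^+ 2 <= expR b / a ^+ 4.
    apply: ler_pM => //; first by rewrite invr_ge0 sqr_ge0.
      by rewrite ler_expR.
    by rewrite lef_pV2// posrE exprn_gt0.
  have key : `|expR x * J / Q ^+ 2| <= lam * (expR x / Q ^+ 2) + lam^-1 * dissip n t x.
    have -> : dissip n t x = (expR x / Q ^+ 2) * J ^+ 2 by rewrite /dissip -/Q -/J; ring.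
    have eq0 : 0 <= expR x / Q ^+ 2 by rewrite divr_ge0// sqr_ge0.
    have -> : expR x * J / Q ^+ 2 = (expR x / Q ^+ 2) * J by ring.
    rewrite normrM (ger0_norm eq0).
    have -> : lam * (expR x / Q ^+ 2) + lam^-1 * (expR x / Q ^+ 2 * J ^+ 2) =
       expR x / Q ^+ 2 * (lam + J ^+ 2 / lam) by ring.
    apply: ler_wpM2l => //.
    have -> : lam + J ^+ 2 / lam = (lam ^+ 2 + J ^+ 2) / lam by field; rewrite gt_eqF.
    rewrite ler_pdivlMr// -(real_normK (num_real J)).
    have := sqr_ge0 (lam - `|J|); have := sqr_ge0 `|J|; have := sqr_ge0 lam; lra.
  apply: (le_trans key); apply: lerD; first by rewrite ler_wpM2l// ltW.
  by apply: le_trans d1; rewrite le_eqVlt; apply/orP; left; apply/eqP; field; rewrite gt_eqF.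
rewrite IDD// ID_cst_cc// IDZ// -mulrA; apply: lerD => //.
apply: ler_wpM2l => //; apply: ID_subset => //; first exact: itg_Jk.
move=> x /=; rewrite in_itv/= => kx; have /andP[h _] := psi01 k1 kx.
by apply: mulr_ge0 => //; exact: dissip_ge0.
Qed.

(** Photons above the envelope [B * gexp] are either at bounded energy, where [n] itself is large,
    or at large energy, where [x^2 phiw1] is large. In both cases [del * tight] exceeds [n], which
    prevents concentration as well as escape to infinity. *)
Lemma tight_pt del : 0 < del -> exists2 B, 0 < B & forall x t, 0 < x -> 0 <= t ->
  n x t <= Num.min (n x t) (B * gexp x) + del * tight n t x.
Proof.
move=> del0.
(* For [x > L], with [q^2 = 1 + x], one has [x^2 phiw1 >= (q^2 / 2)^2 / (2 q^3) = q / 8], and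
   [q >= 8 / del]. *)
pose L := 1 + (8 / del) ^+ 2.
have L1 : 1 <= L by rewrite /L lerDl sqr_ge0.
have L0 : 0 < L by exact: lt_le_trans L1.
pose cst := del * phiw1 L * gexp L.
have c0 : 0 < cst by rewrite /cst; apply: mulr_gt0; [apply: mulr_gt0 => //; exact: phiw1_gt0|exact: gexp_gt0].
exists cst^-1; first by rewrite invr_gt0.
move=> x t x0 t0; have nn := n_ge0 sol x0 t0.
have f0 := phiw1_gt0 x0.
have x20 := sqr_ge0 x.
have [h|h] := leP (n x t) (cst^-1 * gexp x).
  rewrite lerDl /tight; apply: mulr_ge0; first exact: ltW.
  by apply: mulr_ge0; [exact: ltW|apply: mulr_ge0 => //; exact: addr_ge0].
apply: (@le_trans _ _ (del * tight n t x)); last first.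
  by rewrite lerDr mulr_ge0 ?invr_ge0 ?(ltW c0)// ltW// gexp_gt0.
suff key : 1 <= del * (phiw1 x * (x ^+ 2 + n x t)).
  have := ler_wpM2r nn key; rewrite mul1r /tight => hh; apply: (le_trans hh).
  by rewrite le_eqVlt; apply/orP; left; apply/eqP; ring.
have [s1 s2] := sq1 x0; set q := Num.sqrt (1 + x) in s1 s2.
have q0 : 0 < q by exact: lt_le_trans s1.
have E1 : phiw1 x = (2 * q ^+ 3)^-1 by [].
have [xL|Lx] := leP x L.
  have sL : q <= Num.sqrt (1 + L) by rewrite /q ler_wsqrtr// lerD2l.
  have p1 : phiw1 L <= phiw1 x.
    rewrite E1 /phiw1 lef_pV2 ?posrE; last 2 first.
    - by apply: mulr_gt0 => //; apply: exprn_gt0; exact: lt_le_trans sL.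
    - by apply: mulr_gt0 => //; exact: exprn_gt0.
    by rewrite ler_pM2l// ler_pXn2r ?nnegrE// ?(ltW q0)// (le_trans (ltW q0)).
  have p2 : gexp L <= gexp x by rewrite /gexp ler_expR; lra.
  have := ler_pM (ltW (phiw1_gt0 L0)) (ltW (gexp_gt0 L)) p1 p2 => p3.
  have p4 : cst <= del * (phiw1 x * gexp x) by rewrite /cst -mulrA; apply: ler_wpM2l => //; exact: ltW.
  have p5 : cst^-1 * gexp x <= x ^+ 2 + n x t by lra.
  have p6 := ler_wpM2l (ltW f0) p5; have p7 := ler_wpM2l (ltW del0) p6.
  apply: le_trans p7.
  have -> : del * (phiw1 x * (cst^-1 * gexp x)) = del * (phiw1 x * gexp x) / cst by ring.
  by rewrite ler_pdivlMr// mul1r.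
have xq : 1 + x = q ^+ 2 by rewrite s2.
have x1 : 1 <= x by lra.
have hq : 8 / del <= q.
  rewrite -(@ler_pXn2r _ 2) ?nnegrE//; [|by apply: divr_ge0 => //; exact: ltW|exact: ltW].
  by rewrite s2; move: Lx; rewrite /L; lra.
have q8 : 8 <= del * q by move: hq; rewrite ler_pdivrMr// mulrC.
apply: (@le_trans _ _ (del * (phiw1 x * x ^+ 2))); last first.
  by apply: ler_wpM2l; [exact: ltW|apply: ler_wpM2l; [exact: ltW|rewrite lerDl]].
rewrite E1; have q3 : 0 < 2 * q ^+ 3 by apply: mulr_gt0 => //; exact: exprn_gt0.
have -> : del * ((2 * q ^+ 3)^-1 * x ^+ 2) = del * x ^+ 2 / (2 * q ^+ 3) by ring.
rewrite ler_pdivlMr// mul1r.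
have xx : q ^+ 2 / 2 <= x by lra.
have q20 := sqr_ge0 q.
have x4 : (q ^+ 2 / 2) ^+ 2 <= x ^+ 2 by rewrite ler_pXn2r ?nnegrE//; lra.
have := ler_wpM2l (ltW del0) x4.
have q30 : 0 <= q ^+ 3 by apply: exprn_ge0; exact: ltW.
have := ler_wpM2r q30 q8.
have -> : del * q * q ^+ 3 = del * (q ^+ 2 / 2) ^+ 2 * 4 by field.
lra.
Qed.

Definition trunc B t x : R := Num.min (n x t) (B * gexp x).

Lemma trunc_bounds B t x : 0 < B -> 0 <= t -> 0 < x -> 0 <= trunc B t x <= B * gexp x.
Proof.
move=> B0 t0 x0; rewrite /trunc le_min (n_ge0 sol)//= ge_min lexx orbT andbT.
by apply: mulr_ge0; apply: ltW => //; exact: gexp_gt0.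
Qed.

Lemma gexpB_itg B : itg H (fun x => B * gexp x).
Proof. by apply: itgZ; [exact: mH|exact: gexp_itg]. Qed.

Lemma trunc_mfun B t : 0 <= t -> measurable_fun H (trunc B t).
Proof.
move=> t0; apply: measurable_minr; first exact: (n_mfun sol).
exact: itg_mfun (gexpB_itg B).
Qed.

Lemma trunc_itg B t : 0 < B -> 0 <= t -> itg H (trunc B t).
Proof.
move=> B0 t0; apply: (itg_le mH (trunc_mfun B t0) (gexpB_itg B)).
by move=> x /Hpos x0; have /andP[h1 h2] := trunc_bounds B0 t0 x0; rewrite ger0_norm.
Qed.

Lemma mass_trunc del : 0 < del -> exists2 B, 0 < B & forall k t, 1 < k -> 0 < t ->
  mass n t <= ID H (trunc B t) + del * tauk n k t + 4 * eps n k t.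
Proof.
move=> del0; have [B B0 hB] := tight_pt del0; exists B => // k t k1 t0.
have k0 := lt_trans ltr01 k1; have t0' := ltW t0.
have : `|Jk k (fun x => psi k x * n x t) - mass n t| <= 4 * eps n k t.
  apply: (@cut_approx_gen R (fun x => n x t) (fun x => n x t) k k1 (n_mfun sol t0') (n_itg sol t0')).
  by move=> x x0; rewrite ger0_norm// (n_ge0 sol).
rewrite ler_norml => /andP[h1 _].
suff : Jk k (fun x => psi k x * n x t) <= ID H (trunc B t) + del * tauk n k t by lra.
have cn := n_cpos sol t0; have cp := psi_cpos k0.
have mab : mR `[k^-1, k] by exact: measurable_itv.
have sub : `[k^-1, k]%classic `<=` H by apply: ccH; exact: kinv_gt0.
have cti : cpos (fun x => psi k x * tight n t x).
  by rewrite /tight; have cw := @phiw1_cpos R; repeat first [cstep|assumption].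
have i1 : itg `[k^-1, k] (trunc B t) by apply: itgS (trunc_itg B0 t0') => //; exact: mH.
have i2 : itg `[k^-1, k] (fun x => psi k x * tight n t x) by exact: itg_Jk.
have i3 : itg `[k^-1, k] (fun x => del * (psi k x * tight n t x)) by exact: itgZ.
apply: (@le_trans _ _ (ID `[k^-1, k] (fun x => trunc B t x + del * (psi k x * tight n t x)))).
  apply: IDle => //; first by apply: itg_Jk => //; exact: cposM.
    exact: itgD.
  move=> x /=; rewrite in_itv/= => kx; have x0 := x_gt0 k1 kx.
  have /andP[p0 p1] := psi01 k1 kx; have /andP[r0 _] := trunc_bounds B0 t0' x0.
  have := ler_wpM2l p0 (hB x t x0 t0'); rewrite -/(trunc B t x) mulrDr.
  have : psi k x * trunc B t x <= trunc B t x by rewrite ler_piMl.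
  lra.
rewrite IDD// IDZ// lerD2r; apply: ID_subset => //; [exact: mH|exact: trunc_itg|].
by move=> x /Hpos x0; have /andP[] := trunc_bounds B0 t0' x0.
Qed.

(** A single parameter sends the cutoff and the time to infinity while the errors vanish; only the
    tightness bound stays fixed. *)
Definition good k t e := [/\ e^-1 <= k, 1 < k & e^-1 <= t] /\
    [/\ eps n k t <= e, Dk n k t <= e & tauk n k t <= 3 * mass n 1 + 2].

Lemma good_weaken k t e e' : 0 < e -> e <= e' -> good k t e -> good k t e'.
Proof.
move=> e0 ee [[h1 h2 h3] [h4 h5 h6]].
have i : e'^-1 <= e^-1 by rewrite lef_pV2// posrE; exact: lt_le_trans ee.
by split; split => //; exact: le_trans ee || exact: le_trans i _.
Qed.

(** Compactness is used at the single point [x = 1], where [wf] takes values in [[0, 1]]. The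
    vanishing oscillation [wf_osc] carries the limit to every other [x] along the same
    subsequence. *)
Lemma good_limit : exists (k ts : nat -> R) c, [/\ (forall j, good (k j) (ts j) j.+1%:R^-1),
  0 <= c & forall x, 0 < x -> wf x (n x (ts j)) @[j --> \oo] --> c].
Proof.
have ex (j : nat) : exists p : R * R, good p.1 p.2 j.+1%:R^-1.
  have e0 : (0 : R) < j.+1%:R^-1 by rewrite invr_gt0.
  have j1 : (1 : R) <= j.+1%:R by rewrite ler1n.
  have [k [t [h1 h2]]] := good_point j1 e0.
  by exists (k, t); rewrite /good/= invrK.
have [p hp] := choice ex.
pose v j := wf 1 (n 1 (p j).2).
have tp (j : nat) : 0 < (p j).2.
  by have [[_ _ h] _] := hp j; apply: lt_le_trans h; rewrite invrK.
have v01 j : 0 <= v j <= 1 by apply: wf01 => //; apply: (n_ge0 sol) => //; exact: ltW.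
have bv : bounded_fun v.
  exists 1; split; first exact: num_real.
  move=> M M1 j _ /=; have /andP[h1 h2] := v01 j.
  by rewrite ger0_norm//; apply: (le_trans h2); exact: ltW.
have [phi inc cv] := bolzano_weierstrass bv.
have [c hc] : exists c, v (phi j) @[j --> \oo] --> c by exists (lim (v (phi j) @[j --> \oo])).
pose k j := (p (phi j)).1; pose ts j := (p (phi j)).2.
have hg j : good (k j) (ts j) j.+1%:R^-1.
  apply: good_weaken (hp (phi j)); first by rewrite invr_gt0.
  by rewrite lef_pV2 ?posrE// ler_nat ltnS increasing_seq_ge.
have c0 : 0 <= c.
  rewrite -(cvg_lim (@Rhausdorff R) hc); apply: limr_ge; first by apply/cvg_ex; exists c.
  by apply: nearW => j; have /andP[] := v01 (phi j).
exists k, ts, c; split => // x x0.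
pose a := Num.min x 1; pose b := Num.max x 1.
have a0 : 0 < a by rewrite lt_min x0 ltr01.
have ab : a <= b by rewrite ge_min le_max lexx.
have osc j : `|wf x (n x (ts j)) - wf 1 (n 1 (ts j))| = `|wf b (n b (ts j)) - wf a (n a (ts j))|.
  by rewrite /a /b; case: (leP x 1) => // _; rewrite distrC.
suff h0 : wf x (n x (ts j)) - wf 1 (n 1 (ts j)) @[j --> \oo] --> 0.
  have -> : (fun j => wf x (n x (ts j))) =
      (fun j => (wf x (n x (ts j)) - wf 1 (n 1 (ts j))) + v (phi j)).
    by apply/funext => j; rewrite subrK.
  by rewrite -[c]add0r; exact: cvgD.
apply/cvgrPdist_le => e e0.
pose M := expR b / a ^+ 4 * (b - a).
have M0 : 0 <= M by rewrite /M mulr_ge0 ?subr_ge0// divr_ge0 ?expR_ge0// exprn_ge0// ltW.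
have [lam l0 lamE] : exists2 lam, 0 < lam & lam = e / (2 * (M + 1)).
  by eexists; last by []; rewrite divr_gt0// mulr_gt0//; lra.
(* The first two summands give the conditions [2 / k <= a] and [b <= k / 2] of [wf_osc]; the third
   makes [16 / lam] times the dissipation at most [e / 2]. The other half of [e] is the choice of
   [lam]. *)
pose X := 2 / a + 2 * b + 32 / (lam * e).
have X0 : 0 <= X.
  have b0 : 0 < b by exact: lt_le_trans ab.
  by rewrite /X !addr_ge0// ?mulr_ge0 ?invr_ge0 ?ltW// mulr_gt0.
exists (Num.bound X) => // j /= hj.
have jX : X <= j.+1%:R.
  apply: (le_trans (ltW (archi_boundP X0))); rewrite ler_nat; exact: leq_trans hj _.
have [[kj k1 tj] [ej Dj _]] := hg j; rewrite invrK in kj; rewrite invrK in tj.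
have tj0 : 0 < ts j by exact: lt_le_trans tj.
have k0 : 0 < k j by exact: lt_trans k1.
have b0 : 0 < b by exact: lt_le_trans ab.
have xa : 0 < 2 / a by rewrite divr_gt0.
have xl : 0 < 32 / (lam * e) by rewrite divr_gt0// mulr_gt0.
have q1 : 2 / k j <= a.
  have : 2 / a <= k j by move: jX; rewrite /X; lra.
  by rewrite ler_pdivrMr// => h; rewrite ler_pdivrMr// mulrC.
have q2 : b <= k j / 2 by move: jX; rewrite /X; lra.
rewrite sub0r normrN osc; apply: (le_trans (wf_osc a0 ab k1 q1 q2 l0 tj0)).
have h1 : lam * M <= e / 2.
  have -> : lam * M = e / 2 * (M / (M + 1)) by rewrite lamE; field; rewrite gt_eqF//; lra.
  rewrite ler_piMr//; first by rewrite divr_ge0// ltW.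
  by rewrite ler_pdivrMr; lra.
have h2 : 16 / lam * Dk n (k j) (ts j) <= e / 2.
  have l16 : 0 <= 16 / lam by rewrite divr_ge0// ltW.
  apply: (le_trans (ler_wpM2l l16 Dj)).
  have : 32 / (lam * e) <= j.+1%:R by move: jX; rewrite /X; lra.
  have le0 : 0 < lam * e by exact: mulr_gt0 l0 e0.
  have lj : 0 < lam * j.+1%:R by exact: mulr_gt0 l0 (ltr0Sn _ _).
  rewrite (ler_pdivrMr _ _ le0) => h3.
  have -> : 16 / lam / j.+1%:R = 16 / (lam * j.+1%:R) by rewrite invfM mulrA.
  by rewrite (ler_pdivrMr _ _ lj); lra.
rewrite -/M; lra.
Qed.

End GoodSequence.

(** * Identification of the limit and convergence for all times *)

Section Limit.
Variable R : realType.
Local Notation mu := (@lebesgue_measure R).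
Local Notation mR := (@measurable _ (measurableTypeR R)).
Local Notation H := (@halfline R).
Implicit Types (x y t s a b c d e k T h tau u m th A K B L lam r : R) (f g : R -> R).

Lemma ID_gt0 f x : cpos f -> (forall x, 0 < x -> 0 <= f x) -> itg H f -> 0 < x -> 0 < f x ->
  0 < ID H f.
Proof.
move=> cf f0 itf x0 fx.
have fx2 : 0 < f x / 2 by rewrite divr_gt0.
have /cvgrPdist_le/(_ _ fx2)/nbhs_ballP[r /= r0 hr] := cf x x0.
pose d := Num.min (r / 2) (x / 2).
have d0 : 0 < d by rewrite lt_min !divr_gt0.
have dr : d <= r / 2 by rewrite ge_min lexx.
have dx : d <= x / 2 by rewrite ge_min lexx orbT.
have ax : 0 < x - d by lra.
have mab : mR `[x - d, x + d] by exact: measurable_itv.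
have sub := @ccH R _ (x + d) ax.
have ab : x - d <= x + d by lra.
apply: (@lt_le_trans _ _ (f x / 2 * (x + d - (x - d)))); first by apply: mulr_gt0 => //; lra.
rewrite -(ID_cst_cc _ ab); apply: (@le_trans _ _ (ID `[x - d, x + d] f)); last first.
  by apply: ID_subset => //; [exact: mH|move=> y /Hpos; exact: f0].
apply: IDle => //; first by apply: itg_cpos => //; exact: cpos_cst.
  exact: itg_cpos.
move=> y /=; rewrite in_itv/= => /andP[y1 y2].
have : `|f x - f y| <= f x / 2.
  by apply: hr; rewrite /ball/= ltr_norml; apply/andP; split; lra.
rewrite ler_norml => /andP[h1 h2]; lra.
Qed.

Lemma ID_cst0 (D : set R) f : (forall x, D x -> f x = 0) -> ID D f = 0.
Proof. by move=> h; rewrite (IDeq h) /ID /Rintegral integral0. Qed.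

(* The solution [r] of [wf x r = c]. *)
Definition prof c x : R := c * x ^+ 2 / (expR x - c * (1 + expR x)).

Lemma prof_den c x : c <= 1 / 2 -> 0 < x -> 0 < expR x - c * (1 + expR x).
Proof.
move=> c2 x0; have E1 : 1 < expR x by rewrite expR_gt1.
have h : 0 <= 1 + expR x by lra.
by have := ler_wpM2r h c2; lra.
Qed.

Lemma wf_prof x r : 0 < x -> 0 <= r ->
  0 < expR x - wf x r * (1 + expR x) /\ r = prof (wf x r) x.
Proof.
move=> x0 r0; have q0 := Qf_gt0 x0 r0; have E0 := expR_gt0 x.
have qn : Qf x r != 0 by rewrite gt_eqF.
have dE : expR x - wf x r * (1 + expR x) = expR x * x ^+ 2 / Qf x r.
  by move: qn; rewrite /wf /Qf => qn; field.
have d0 : 0 < expR x - wf x r * (1 + expR x).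
  by rewrite dE divr_gt0// mulr_gt0// exprn_gt0.
split => //; rewrite /prof dE /wf; field.
by rewrite qn !gt_eqF.
Qed.

(** With [c = z / (1 + z)] the parameter is [- ln z], and [c <= 1 / 2] means exactly that it is
    nonnegative. *)
Lemma prof_BE c x : 0 < c -> c <= 1 / 2 -> 0 < x -> prof c x = BE (ln ((1 - c) / c)) x.
Proof.
move=> c0 c2 x0; have d0 := prof_den c2 x0.
have q0 : 0 < (1 - c) / c by apply: divr_gt0; lra.
rewrite /BE expRD lnK//; move: d0; set E := expR x => d0.
have h : E * ((1 - c) / c) - 1 = (E - c * (1 + E)) / c by field; rewrite gt_eqF.
by rewrite h /prof -/E; field; rewrite !gt_eqF.
Qed.

Variables (n0 : R -> R) (n : R -> R -> R).
Hypothesis sol : kompaneets_solution n0 n.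

Section along_sequence.
Variables (ks ts : nat -> R) (c : R).
Hypothesis gs : forall j, good n (ks j) (ts j) j.+1%:R^-1.
Hypothesis wc : forall x, 0 < x -> wf x (n x (ts j)) @[j --> \oo] --> c.

Lemma ts_ge j : j.+1%:R <= ts j.
Proof. by have [[_ _ h] _] := gs j; rewrite invrK in h. Qed.

Lemma ts_gt0 j : 0 < ts j.
Proof. exact: lt_le_trans (ltr0Sn _ _) (ts_ge j). Qed.

(** Along the sequence [expR x - wf x n * (1 + expR x)] is positive; the limit
    [c (1 + expR x) <= expR x] near [x = 0] leaves only [c <= 1 / 2]. The point
    [x = ln (c / (1 - c)) / 2] contradicts any larger [c] below 1. *)
Lemma limit_le_half : c <= 1 / 2.
Proof.
have lec x : 0 < x -> c * (1 + expR x) <= expR x.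
  move=> x0; apply: (cvgr_to_le (cvgM (wc x0) (cvg_cst (1 + expR x)))).
  apply: nearW => j; have [h _] := wf_prof x0 (n_ge0 sol x0 (ltW (ts_gt0 j))).
  by rewrite -subr_ge0 ltW.
rewrite leNgt; apply/negP => ch.
have c1 : 0 < 1 - c.
  rewrite ltNge; apply/negP => h; have := lec 1 ltr01; have := expR_gt0 (1 : R) => E0.
  have : (1 - c) * expR 1 <= 0 by rewrite mulr_le0_ge0// ltW.
  lra.
have q1 : 1 < c / (1 - c) by rewrite ltr_pdivlMr//; lra.
have q0 : 0 < c / (1 - c) by exact: lt_trans q1.
have l0 : 0 < ln (c / (1 - c)) by exact: ln_gt0.
have x0 : 0 < ln (c / (1 - c)) / 2 by rewrite divr_gt0.
have := lec _ x0; set E := expR _ => h.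
have : E < c / (1 - c).
  by rewrite -[X in _ < X]lnK// /E ltr_expR; lra.
rewrite ltr_pdivlMr//; lra.
Qed.

Lemma n_prof x : 0 < x -> n x (ts j) @[j --> \oo] --> prof c x.
Proof.
move=> x0; have d0 := prof_den limit_le_half x0.
have -> : (fun j => n x (ts j)) = (fun j => prof (wf x (n x (ts j))) x).
  by apply/funext => j; have [_ {1}->] := wf_prof x0 (n_ge0 sol x0 (ltW (ts_gt0 j))).
have w := wc x0; rewrite /prof; apply: cvgM.
  by apply: cvgM => //; exact: cvg_cst.
apply: cvgV; first by rewrite gt_eqF.
by apply: cvgB; [exact: cvg_cst|apply: cvgM => //; exact: cvg_cst].
Qed.

(** Tightness reduces the mass to that of the truncation at [B * gexp], which converges by
    domination. The profile is passed as a free [m] so that the degenerate limit [c = 0], with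
    [m = 0], is covered as well. *)
Lemma mass_upper (m : R -> R) e : itg H m -> (forall x, 0 < x -> prof c x = m x) -> 0 < e ->
  exists N, forall j, (N <= j)%N -> mass n (ts j) <= ID H m + e.
Proof.
move=> im pm e0; pose C := 3 * mass n 1 + 2.
have C0 : 0 < C by have := mass_ge0 sol (@ler01 R); rewrite /C; lra.
have del0 : 0 < e / (4 * C) by rewrite divr_gt0// mulr_gt0.
have [B B0 hB] := mass_trunc sol del0.
have [ig cg] := @DCT R H (fun j => trunc n B (ts j)) (fun x => Num.min (m x) (B * gexp x))
  (fun x => B * gexp x) (@mH R) (fun j => trunc_mfun sol B (ltW (ts_gt0 j)))
  (ltac:(by move=> x /Hpos x0; rewrite -pm//;
     apply: (@cvg_comp _ _ _ (fun j => n x (ts j)) (fun y => Num.min y (B * gexp x)) _ _ _ (n_prof x0));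
     apply: (@continuous_min R R^o (fun y => y) (fun=> B * gexp x)); [exact: cvg_id|exact: cvg_cst]))
  (@gexpB_itg R B)
  (ltac:(by move=> j x /Hpos x0; have /andP[h1 h2] := trunc_bounds sol B0 (ltW (ts_gt0 j)) x0;
     rewrite ger0_norm)).
have gm : ID H (fun x => Num.min (m x) (B * gexp x)) <= ID H m.
  by apply: IDle => // [|x _]; [exact: mH|rewrite ge_min lexx].
have e4 : 0 < e / 4 by rewrite divr_gt0.
have /cvgrPdist_le/(_ _ e4)[N1 _ hN] := cg.
pose N2 := Num.bound (16 / e).
exists (maxn N1 N2) => j; rewrite geq_max => /andP[j1 j2].
have := hN j j1; rewrite ler_norml => /andP[h1 h2].
have [[_ k1 _] [ej _ tj]] := gs j.
have := hB _ _ k1 (ts_gt0 j).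
have t1 : e / (4 * C) * tauk n (ks j) (ts j) <= e / 4.
  have -> : e / 4 = e / (4 * C) * C by field; rewrite gt_eqF.
  by rewrite ler_wpM2l// ltW.
have t2 : 4 * eps n (ks j) (ts j) <= e / 4.
  have q0 : 0 <= 16 / e by apply: divr_ge0 => //; exact: ltW.
  have : 16 / e <= j.+1%:R.
    by apply: (le_trans (ltW (archi_boundP q0))); rewrite ler_nat; exact: leq_trans j2 _.
  rewrite ler_pdivrMr// => h16.
  have : j.+1%:R^-1 <= e / 16.
    by rewrite -[X in X <= _]mul1r ler_pdivrMr// mulrAC ler_pdivlMr// mul1r mulrC.
  move: ej; set w := j.+1%:R^-1; lra.
lra.
Qed.

(** Here [BE th] itself dominates, so pointwise convergence suffices without tightness. *)
Lemma deficit_seq th e : 0 <= th -> (forall x, 0 < x -> prof c x = BE th x) -> 0 < e ->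
  exists t, 0 < t /\ deficit n th t <= e.
Proof.
move=> th0 pm e0.
have ppc x : H x -> pp (BE th x - n x (ts j)) @[j --> \oo] --> (0 : R).
  move=> /Hpos x0; have h : BE th x - n x (ts j) @[j --> \oo] --> (0 : R).
    have := n_prof x0; rewrite pm// => hn; rewrite -(subrr (BE th x)).
    by apply: cvgB => //; exact: cvg_cst.
  have pp0 : pp (0 : R) = 0 by rewrite /pp maxxx.
  rewrite -[X in _ --> X]pp0.
  apply: (cvg_comp (fun j => BE th x - n x (ts j)) (@pp R) h).
  by apply: (@continuous_max R R^o (fun=> 0) (fun y => y)); [exact: cvg_cst|exact: cvg_id].
have [_ cg] := @DCT R H (fun j x => pp (BE th x - n x (ts j))) (fun=> 0)
  (BE th) (@mH R) (fun j => deficit_mfun sol th0 (ltW (ts_gt0 j))) ppc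
  (BE_itg th0)
  (ltac:(by move=> j x /Hpos x0; have /andP[h1 h2] := deficit_pt sol th0 x0 (ltW (ts_gt0 j));
     rewrite ger0_norm)).
have /cvgrPdist_le/(_ _ e0)[N1 _ hN] := cg.
exists (ts N1); split; first exact: ts_gt0.
have := hN N1 (leqnn N1); rewrite ID_cst0// sub0r normrN.
by move=> h; apply: le_trans h; exact: ler_norm.
Qed.

End along_sequence.

Lemma mass_deficit th t : 0 <= th -> 0 <= t -> ID H (BE th) - deficit n th t <= mass n t.
Proof.
move=> th0 t0; rewrite -IDB; [|exact: mH|exact: BE_itg|exact: (deficit_itg sol)].
apply: IDle; [exact: mH| |exact: (n_itg sol)|].
  by apply: itgB; [exact: mH|exact: BE_itg|exact: (deficit_itg sol)].
move=> x _; have : BE th x - n x t <= pp (BE th x - n x t) by rewrite le_max lexx orbT.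
lra.
Qed.

(** Because [|u|] is twice the positive part of [u] minus [u], convergence in [L1] reduces to the
    deficit and the mass, the two quantities that are monotone in time. *)
Lemma L1_deficit th t : 0 <= th -> 0 <= t ->
  ID H (fun x => `|n x t - BE th x|) = 2 * deficit n th t + (mass n t - ID H (BE th)).
Proof.
move=> th0 t0; have i1 := deficit_itg sol th0 t0; have i2 := n_itg sol t0; have i3 := BE_itg th0.
have i4 := itgZ 2 (@mH R) i1; have i5 := itgB (@mH R) i2 i3.
rewrite -(IDB (@mH R) i2 i3) -(IDZ 2 (@mH R) i1) -(IDD (@mH R) i4 i5).
apply: IDeq => x _; rewrite /pp; have [h|h] := leP 0 (BE th x - n x t).
  by rewrite ler0_norm; lra.
by rewrite ger0_norm; lra.
Qed.

(** The deficit below [BE 0] is strictly less than the mass of [BE 0] as soon as [n] is positive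
    somewhere, and it never increases afterwards; the gap bounds the mass from below. *)
Lemma mass_lower x s : 0 < x -> 0 < s -> 0 < n x s ->
  exists2 del, 0 < del & forall t, s <= t -> del <= mass n t.
Proof.
move=> x0 s0 nx; have z0 : 0 <= (0 : R) by [].
exists (ID H (BE 0) - deficit n 0 s); last first.
  move=> t st; have t0 : 0 < t by exact: lt_le_trans st.
  by have := mass_deficit z0 (ltW t0); have := deficit_mono sol z0 s0 st; lra.
have i1 := BE_itg z0; have i2 := deficit_itg sol z0 (ltW s0).
rewrite -(IDB (@mH R) i1 i2); apply: (@ID_gt0 _ x) => //.
- have cn := n_cpos sol s0; have cB := BE_cpos z0.
  by apply: cposD => //; apply: cposN; apply: pp_cpos; apply: cposD => //; exact: cposN.
- by move=> y y0; rewrite subr_ge0; have /andP[] := deficit_pt sol z0 y0 (ltW s0).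
- exact: itgB (@mH R) i1 i2.
by rewrite subr_gt0 /pp gt_max BE_gt0//= gtrBl.
Qed.

(** If [n] vanished at all positive times, continuity in [L1] at time 0 would force the initial data
    to vanish almost everywhere. *)
Lemma n_nontrivial : ~ {ae mu, forall x, H x -> n0 x = 0} ->
  exists x s, [/\ 0 < x, 0 < s & 0 < n x s].
Proof.
move=> nz; apply: contrapT => hn; apply: nz.
have n_eq0 x s : 0 < x -> 0 < s -> n x s = 0.
  move=> x0 s0; apply/eqP; rewrite eq_le (n_ge0 sol x0 (ltW s0)) andbT leNgt.
  by apply/negP => h; apply: hn; exists x, s.
have z0 : 0 <= (0 : R) by [].
have i0 := n_itg sol z0.
have I0 : ID H (fun x => `|n x 0|) = 0.
  apply/eqP; rewrite eq_le; apply/andP; split; last by apply: ID_ge0.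
  apply: le_of_small => e e0; rewrite add0r.
  have [d d0 hd] := L1d_cont sol z0 e0.
  have d20 : 0 < d / 2 by rewrite divr_gt0.
  have := hd (d / 2) (ltW d20); rewrite subr0 gtr0_norm// => /(_ ltac:(lra)).
  rewrite /L1d (@IDeq _ _ _ (fun x => `|n x 0|)); first exact: ltW.
  by move=> x /Hpos x0; rewrite n_eq0// sub0r normrN.
have m0 : measurable_fun H (EFin \o (fun x => n x 0)).
  by apply/measurable_EFinP; exact: itg_mfun i0.
have : (\int[mu]_(x in H) `|(EFin \o (fun x => n x 0)) x|)%E = 0%E.
  by rewrite (IDEFin (@mH R) (itg_abs (@mH R) i0)) I0.
move/(@ae_eq_integral_abs _ _ _ mu H (@mH R) _ m0); apply: filterS => x /= h Hx.
by have := h Hx; rewrite (n_init sol)//; [case|exact/Hpos].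
Qed.

Lemma limit_exists : ~ {ae mu, forall x, H x -> n0 x = 0} ->
  exists2 th, 0 <= th &
   (forall e, 0 < e -> exists T, 0 < T /\ forall t, T <= t -> deficit n th t <= e) /\
   (forall e, 0 < e -> exists T, 0 < T /\ forall t, T <= t -> `|mass n t - ID H (BE th)| <= e).
Proof.
move=> /n_nontrivial[x1 [s1 [x10 s10 nx1]]].
have [del del0 hdel] := mass_lower x10 s10 nx1.
have [ks [ts [c [gs c0 wc]]]] := good_limit sol.
have c2 := limit_le_half gs wc.
have c_gt0 : 0 < c.
  (* For [c = 0] the profile is 0, so tightness would bring the mass below [del / 2], against
     [mass_lower]. *)
  rewrite lt_neqAle c0 andbT; apply/eqP => c00.
  have d20 : 0 < del / 2 by rewrite divr_gt0.
  have i0 : itg H (fun=> (0 : R)) by apply: (itg_le (@mH R) _ (@gexp_itg R)) => // x _;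
    rewrite normr0 ltW// gexp_gt0.
  have [N hN] := mass_upper gs wc i0 (ltac:(by move=> x x0; rewrite /prof -c00 !mul0r)) d20.
  pose j := maxn N (Num.bound s1).
  have sj : s1 <= ts j.
    apply: le_trans (ts_ge gs j).
    apply: (le_trans (ltW (archi_boundP (ltW s10)))); rewrite ler_nat.
    by apply: (leq_trans (leq_maxr N _)).
  have := hN j (leq_maxl _ _); have := hdel _ sj; rewrite ID_cst0//; lra.
pose th := ln ((1 - c) / c).
have th0 : 0 <= th by apply: ln_ge0; rewrite ler_pdivlMr//; lra.
have pm x : 0 < x -> prof c x = BE th x by exact: prof_BE.
exists th => //.
have dlim e : 0 < e -> exists T, 0 < T /\ forall t, T <= t -> deficit n th t <= e.
  move=> e0; have [T [T0 hT]] := deficit_seq gs wc th0 pm e0.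
  by exists T; split => // t Tt; apply: le_trans hT; exact: (deficit_mono sol).
(* The mass is bounded from below by the deficit at the same time, and from above by its value at
   the earlier good time [ts N]. *)
split => // e e0; have [T [T0 hT]] := dlim _ e0.
have [N hN] := mass_upper gs wc (BE_itg th0) pm e0.
exists (Num.max T (ts N)); split; first by rewrite lt_max T0.
move=> t; rewrite ge_max => /andP[Tt Nt].
have t0 : 0 < t by exact: lt_le_trans Tt.
have h1 := hT t Tt; have h2 := mass_deficit th0 (ltW t0).
have h3 := hN N (leqnn N); have h4 := mass_mono sol (ts_gt0 gs N) Nt.
rewrite ler_norml; apply/andP; split; lra.
Qed.

End Limit.

(** * Uniqueness of the parameter, the total outflow, and convergence in [L1] *)

Section Conclusion.
Variable R : realType.
Local Notation mu := (@lebesgue_measure R).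
Local Notation mR := (@measurable _ (measurableTypeR R)).
Local Notation H := (@halfline R).
Implicit Types (x y t s a b c d e k T h tau u m th : R) (f g : R -> R).

Lemma BE_anti th th' x : 0 <= th -> th < th' -> 0 < x -> BE th' x < BE th x.
Proof.
move=> th0 lt x0; have th'0 : 0 <= th' by exact: ltW (le_lt_trans th0 lt).
have d0 := BE_den th0 x0; have d0' := BE_den th'0 x0.
rewrite /BE ltr_pM2l ?exprn_gt0// ltf_pV2 ?posrE//.
by rewrite ltrD2r ltr_expR ltrD2l.
Qed.

Lemma ID_BE_anti th th' : 0 <= th -> th < th' -> ID H (BE th') < ID H (BE th).
Proof.
move=> th0 lt; have th'0 : 0 <= th' by exact: ltW (le_lt_trans th0 lt).
have i := BE_itg th0; have i' := BE_itg th'0.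
rewrite -subr_gt0 -(IDB (@mH R) i i'); apply: (@ID_gt0 _ _ 1) => //.
- by apply: cposD; [exact: BE_cpos|apply: cposN; exact: BE_cpos].
- by move=> x x0; rewrite subr_ge0 ltW// BE_anti.
- exact: itgB (@mH R) i i'.
by rewrite subr_gt0 BE_anti.
Qed.

Lemma ID_BE_inj th th' : 0 <= th -> 0 <= th' -> ID H (BE th) = ID H (BE th') -> th = th'.
Proof.
move=> th0 th'0 E; have [lt|lt|//] := ltgtP th th'.
  by have := ID_BE_anti th0 lt; rewrite E ltxx.
by have := ID_BE_anti th'0 lt; rewrite E ltxx.
Qed.

Lemma photon_BE th : 0 <= th -> photon_number (BE th) = (ID H (BE th))%:E.
Proof. by move=> th0; rewrite /photon_number (IDEFin (@mH R) (BE_itg th0)). Qed.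

Variables (n0 : R -> R) (n : R -> R -> R).
Hypothesis sol : kompaneets_solution n0 n.

Lemma photon_init : photon_number n0 = (mass n 0)%:E.
Proof.
rewrite -(IDEFin (@mH R) (n_itg sol (lexx 0))); apply: eq_integral => x.
by rewrite inE => /Hpos x0; rewrite (n_init sol).
Qed.

Lemma mass_cont0 e : 0 < e -> exists2 d, 0 < d & forall t, 0 <= t < d -> `|mass n t - mass n 0| <= e.
Proof.
move=> e0; have z0 : 0 <= (0 : R) by [].
have [d d0 hd] := L1d_cont sol z0 e0; exists d => // t /andP[t0 td].
have m1 : measurable_fun H (fun=> 1 : R) by exact: measurable_cst.
have h1 x : 0 < x -> `|1 : R| <= 1 by rewrite normr1.
have := ID_L1d sol t0 z0 m1 h1; rewrite mul1r.
have E s : ID H (fun x => 1 * n x s) = mass n s by apply: IDeq => x _; rewrite mul1r.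
rewrite !E => h; apply: (le_trans h); apply: ltW; apply: hd => //.
by rewrite subr0 ger0_norm.
Qed.

Lemma bigcup_cc : \bigcup_j `[(j.+2%:R : R)^-1, j.+2%:R]%classic = H.
Proof.
apply/seteqP; split=> x.
  move=> [j _] /=; rewrite in_itv/= => /andP[h _]; apply/Hpos; apply: lt_le_trans h.
  by rewrite invr_gt0.
move=> /Hpos x0; have xi : 0 < x^-1 by rewrite invr_gt0.
have X0 : 0 <= x + x^-1 by lra.
exists (Num.bound (x + x^-1)) => //=; rewrite in_itv/=.
have hb : x + x^-1 <= (Num.bound (x + x^-1)).+2%:R.
  by apply: (le_trans (ltW (archi_boundP X0))); rewrite ler_nat leqW.
apply/andP; split; last by lra.
by rewrite -[X in _ <= X]invrK lef_pV2 ?posrE//; lra.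
Qed.

(** The time axis is exhausted by [[1 / (j + 2), j + 2]], where the mass balance is exact.
    Continuity of the mass at time 0 handles the lower end and the limit [N] the upper end; the
    shift by 2 keeps the intervals nondegenerate. *)
Lemma trace_integral N : (forall e, 0 < e -> exists T, 0 < T /\ forall t, T <= t -> `|mass n t - N| <= e) ->
  (\int[mu]_(t in H) ((trace0 n t) ^+ 2)%:E)%E = (mass n 0 - N)%:E.
Proof.
move=> mN; pose F j : set R := `[(j.+2%:R : R)^-1, j.+2%:R]%classic.
pose f t : \bar R := ((trace0 n t) ^+ 2)%:E.
have s0 j : 0 < (j.+2%:R : R)^-1 by rewrite invr_gt0.
have st j : (j.+2%:R : R)^-1 < j.+2%:R.
  by apply: (@lt_trans _ _ 1); rewrite ?invf_lt1 ?ltr1n.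
have mF j : measurable (F j : set (measurableTypeR R)) by exact: measurable_itv.
have nF : nondecreasing_seq F.
  apply/nondecreasing_seqP => j; apply/subsetPset; rewrite /F => x /=; rewrite !in_itv/= => /andP[h1 h2].
  apply/andP; split; last by apply: (le_trans h2); rewrite ler_nat.
  by apply: le_trans h1; rewrite lef_pV2 ?posrE// ler_nat.
have mf j : measurable_fun (F j : set (measurableTypeR R)) f.
  by have [i _] := mass_balance sol (s0 j) (st j); apply/measurable_EFinP; exact: itg_mfun i.
have f0 j (t : measurableTypeR R) : F j t -> (0 <= f t)%E by move=> _; rewrite lee_fin sqr_ge0.
have cF := @ge0_nondecreasing_set_cvg_integral _ (measurableTypeR R) R F f mu nF mF mf f0.
have bF : \bigcup_j F j = H := bigcup_cc.
rewrite bF in cF; apply: (cvg_unique _ cF) => //.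
have -> : (fun j => \int[mu]_(x in F j) f x)%E =
    (fun j => (mass n j.+2%:R^-1 - mass n j.+2%:R)%:E).
  apply/funext => j; have [i h] := mass_balance sol (s0 j) (st j).
  by rewrite (IDEFin (mF j) i); congr EFin; lra.
apply: cvg_EFin; first exact: nearW.
apply/cvgrPdist_le => e e0; have e2 : 0 < e / 2 by rewrite divr_gt0.
have [T [T0 hT]] := mN _ e2; have [d d0 hd] := mass_cont0 e2.
have di : 0 < d^-1 by rewrite invr_gt0.
have X0 : 0 <= T + d^-1 by lra.
exists (Num.bound (T + d^-1)) => // j /= hj.
have hb : T + d^-1 < j.+2%:R.
  by apply: (lt_le_trans (archi_boundP X0)); rewrite ler_nat (leq_trans hj)// leqW.
have := hT j.+2%:R (ltac:(lra)).
have := hd j.+2%:R^-1 (ltac:(rewrite ltW//=; rewrite -[X in _ < X]invrK ltf_pV2 ?posrE//; lra)).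
rewrite !ler_norml => /andP[h1 h2] /andP[h3 h4]; apply/andP; split; lra.
Qed.

Lemma L1dist_cvg th : 0 <= th ->
  (forall e, 0 < e -> exists T, 0 < T /\ forall t, T <= t -> deficit n th t <= e) ->
  (forall e, 0 < e -> exists T, 0 < T /\ forall t, T <= t -> `|mass n t - ID H (BE th)| <= e) ->
  L1dist (fun x => n x t) (BE th) @[t --> +oo] --> 0%E.
Proof.
move=> th0 hd hm.
have E t : 0 <= t -> L1dist (fun x => n x t) (BE th) = (ID H (fun x => `|n x t - BE th x|))%:E.
  move=> t0; apply: (IDEFin (@mH R)).
  exact: (itg_abs (@mH R) (itgB (@mH R) (n_itg sol t0) (BE_itg th0))).
apply: cvg_EFin.
  by exists 0; split => // t t0; rewrite E// ltW.
apply/cvgrPdist_le => e e0; have e3 : 0 < e / 3 by rewrite divr_gt0.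
have [T [T0 hT]] := hd _ e3; have [U [U0 hU]] := hm _ e3.
exists (T + U); split; first exact: num_real.
move=> t tTU /=; have t0 : 0 <= t by lra.
rewrite E//= sub0r normrN ger0_norm; last by apply: ID_ge0.
rewrite (L1_deficit sol th0 t0).
have := hT t (ltac:(lra)); have := hU t (ltac:(lra)).
rewrite ler_norml => /andP[h1 h2] h3; lra.
Qed.

End Conclusion.

Unset Implicit Arguments.

Theorem theorem2p13 (R : realType) (n0 : R -> R) (n : R -> R -> R) :
  measurable_fun (@halfline R) n0 ->
  (forall x, 0 < x -> 0 <= n0 x) ->
  (exists M : R, forall x, 0 < x -> `|n0 x| <= M) ->
  ~ {ae (@lebesgue_measure R), forall x, @halfline R x -> n0 x = 0} ->
  x ^+ 2 * n0 x @[x --> +oo] --> 0 ->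
  kompaneets_solution n0 n ->
  exists mu : R,
    [/\ 0 <= mu,
        photon_number (BE mu) =
          (photon_number n0 -
           \int[@lebesgue_measure R]_(t in @halfline R) ((trace0 n t) ^+ 2)%:E)%E,
        (forall mu' : R, 0 <= mu' ->
           photon_number (BE mu') =
             (photon_number n0 -
              \int[@lebesgue_measure R]_(t in @halfline R) ((trace0 n t) ^+ 2)%:E)%E ->
           mu' = mu) &
        L1dist (fun x => n x t) (BE mu) @[t --> +oo] --> 0%E].
Proof.
move=> _ _ _ nz _ sol; have [th th0 [hd hm]] := limit_exists sol nz.
have lim_photon : photon_number (BE th) = (photon_number n0 -
    \int[@lebesgue_measure R]_(t in @halfline R) ((trace0 n t) ^+ 2)%:E)%E.
  by rewrite photon_BE// (photon_init sol) (trace_integral sol hm) -EFinB; congr EFin; ring.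
exists th; split => // [mu' mu'0|]; last exact: (L1dist_cvg sol th0 hd hm).
by rewrite -lim_photon !photon_BE// => -[]; exact: ID_BE_inj.
Qed.
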